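(* Let $E$ be a finite graph without sinks or sources in which every cycle has an exit, let $k\in\mathbb{N}$, $k\ge 1$, and let $\tau\in\mathrm{Perm}(E^k)$ be an endpoint-fixing permutation with permutation graph $(E_\tau,\mathcal{L}_\tau)$, textile system $T_\tau$ and permutative endomorphism $\lambda_\tau$ of $C^*(E)$. The following are equivalent: (1) $(E_\tau,\mathcal{L}_\tau)$ is synchronizing in both the first and the second label. (2) $T_\tau$ is two-sided 1--1. (3) $\lambda_\tau$ is an automorphism of $C^*(E)$. Furthermore, if these conditions hold, then the inverse of $\lambda_\tau$ is permutative, i.e. $\lambda_\tau^{-1}=\lambda_\pi$ for some $l\in\mathbb{N}$ and some endpoint-fixing $\pi\in\mathrm{Perm}(E^l)$.
   Context: A graph means a directed multigraph $E=(E^0,E^1,r,s)$ with range and source maps $r,s\colon E^1\to E^0$. A path of length $l\ge1$ is $\mu=\mu_1\cdots\mu_l$ with $\mu_i\in E^1$, $r(\mu_i)=s(\mu_{i+1})$; $E^l$ is the set of paths of length $l$ (length-0 paths are the vertices), with $s(\mu)=s(\mu_1)$, $r(\mu)=r(\mu_l)$, and $E^l_{u\to v}=\{\mu\in E^l: s(\mu)=u,\ r(\mu)=v\}$. A cycle is a path $\mu$ of length $\geq 1$ with $s(\mu)=r(\mu)$; it has an exit if some $s(\mu_i)$ emits at least two edges. $C^*(E)$ is the universal $C^*$-algebra generated by mutually orthogonal projections $\{P_v\}_{v\in E^0}$ and partial isometries $\{S_e\}_{e\in E^1}$ with $S_e^*S_e=P_{r(e)}$, $S_e^*S_f=0$ for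 $e\ne f$, $S_eS_e^*\le P_{s(e)}$, and $P_v=\sum_{s(e)=v}S_eS_e^*$ for $v$ emitting a nonzero finite number of edges. For a path $\mu$, $S_\mu=S_{\mu_1}\cdots S_{\mu_l}$ ($S_v=P_v$ for a vertex $v$). $\tau\in\mathrm{Perm}(E^k)$ is endpoint-fixing if $\tau(E^k_{u\to v})=E^k_{u\to v}$ for all $u,v\in E^0$. Then $U_\tau=\sum_{\alpha\in E^k}S_{\tau(\alpha)}S_\alpha^*$ is a unitary, and $\lambda_\tau$ is the unital $*$-endomorphism of $C^*(E)$ with $\lambda_\tau(S_e)=U_\tau S_e$ for all $e\in E^1$ (a permutative endomorphism at level $k$). The permutation graph $(E_\tau,\mathcal{L}_\tau)$ has vertex set $E_\tau^0=E^{k-1}$, edge set $E_\tau^1=E^k$, $s_\tau(\mu)=\tau(\mu)_1\cdots\tau(\mu)_{k-1}$, $r_\tau(\mu)=\mu_2\cdots\mu_k$ (for $k=1$: $s_\tau(\mu)=s(\tau(\mu))$, $r_\tau(\mu)=r(\mu)$), and labels $\mathcal{L}_1(\mu)=\mu_1$, $\mathcal{L}_2(\mu)=\tau(\mu)_k$, $\mathcal{L}_\tau(\mu)=[\mathcal{L}_1(\mu),\mathcal{L}_2(\mu)]\in E^1\times E^1$. Thus there is an edge from $\beta$ to $\alpha$ labeled $[e,f]$ iff $\tau(e\alpha)=\beta f$. Labelings extend to paths letterwise. $(E_\tau,\mathcal{L}_\tau)$ is synchronizing in the first label if there is $m\in\mathbb{N}$ such that any two paths in $E_\tau$ of length $m$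 with the same $\mathcal{L}_1$-label have the same source. It is synchronizing in the second label if there is $m\in\mathbb{N}$ such that any two paths in $E_\tau$ with the same $\mathcal{L}_2$-label and length at least $m$ have the same range. For a graph $G$, $\mathsf{X}_G$ denotes the two-sided edge shift (bi-infinite paths in $G$). $T_\tau=(E_\tau,E,p_\tau,q_\tau)$ is the (non-degenerate) textile system with graph homomorphisms $p_\tau,q_\tau\colon E_\tau\to E$ given on edges by $p_\tau=\mathcal{L}_1$, $q_\tau=\mathcal{L}_2$ and on vertices $\beta\in E^{k-1}$ by $p_\tau(\beta)=s(\beta)$, $q_\tau(\beta)=r(\beta)$. Let $\phi_1,\phi_2\colon\mathsf{X}_{E_\tau}\to\mathsf{X}_E$ be the maps applying $p_\tau$, respectively $q_\tau$, to each edge. $T_\tau$ is two-sided 1--1 if both $\phi_1$ and $\phi_2$ are injective. *)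

(* Defs.v *)
From HB Require Import structures.
From mathcomp Require Import all_boot all_order all_algebra all_fingroup.
From mathcomp Require Import all_classical all_reals all_analysis.
From mathcomp Require Import complex.
Import Order.TTheory GRing.Theory Num.Theory.
Import numFieldNormedType.Exports.

Set Implicit Arguments.
Unset Strict Implicit.
Unset Printing Implicit Defensive.

Local Open Scope classical_set_scope.
Local Open Scope ring_scope.

Record digraph := Digraph {
  vert : finType;
  edge : finType;
  src : edge -> vert;
  rng : edge -> vert }.

Definition no_sinks (G : digraph) : Prop :=
  forall v : vert G, exists e : edge G, src e = v.

Definition no_sources (G : digraph) : Prop :=
  forall v : vert G, exists e : edge G, rng e = v.

Fixpoint walk (G : digraph) (v : vert G) (p : seq (edge G)) : bool :=
  if p is e :: p' then (src e == v) && walk (rng e) p' else true.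

(* A path is stored with its source, so that length-0 paths are exactly the
   vertices; in positive length the source is determined by the first edge. *)
Definition gpath (G : digraph) (n : nat) :=
  {x : vert G * n.-tuple (edge G) | walk x.1 x.2}.

Section Paths.
Variable G : digraph.

Definition pedges n (x : gpath G n) : n.-tuple (edge G) := (val x).2.
Definition psrc n (x : gpath G n) : vert G := (val x).1.
Definition prng n (x : gpath G n) : vert G :=
  last (psrc x) (map (@rng G) (pedges x)).

Definition paths_between n (u v : vert G) : {set gpath G n} :=
  [set x | (psrc x == u) && (prng x == v)]%SET.

Definition first_edge n (x : gpath G n.+1) : edge G := thead (pedges x).
Definition last_edge n (x : gpath G n.+1) : edge G := tnth (pedges x) ord_max.

Definition prefix_edges n (x : gpath G n.+1) : n.-tuple (edge G) :=
  belast_tuple (thead (pedges x)) (behead_tuple (pedges x)).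

Lemma walk_belast (v : vert G) e p : walk v (e :: p) -> walk v (belast e p).
Proof.
elim: p v e => [//|f p IH] v e /= /andP[-> h] /=.
exact: IH.
Qed.

Lemma prefix_walk n (x : gpath G n.+1) : walk (psrc x) (prefix_edges x).
Proof.
case: x => -[v t] /= h; rewrite /prefix_edges /psrc /pedges /=.
by move: h; case/tupleP: t => e t /=; rewrite theadE; apply: walk_belast.
Qed.

Lemma suffix_walk n (x : gpath G n.+1) :
  walk (rng (first_edge x)) (behead_tuple (pedges x)).
Proof.
case: x => -[v t] /= h; rewrite /first_edge /pedges /=.
by move: h; case/tupleP: t => e t /=; rewrite theadE => /andP[].
Qed.

Definition gprefix n (x : gpath G n.+1) : gpath G n :=
  exist (fun y : vert G * n.-tuple (edge G) => is_true (walk y.1 y.2)) (psrc x, prefix_edges x)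
    (prefix_walk x).

Definition gsuffix n (x : gpath G n.+1) : gpath G n :=
  exist (fun y : vert G * n.-tuple (edge G) => is_true (walk y.1 y.2))
    (rng (first_edge x), behead_tuple (pedges x)) (suffix_walk x).

End Paths.

Definition every_cycle_has_exit (G : digraph) : Prop :=
  forall n (x : gpath G n.+1), psrc x = prng x ->
    exists i : 'I_n.+1,
      (1 < #|[pred e : edge G | src e == src (tnth (pedges x) i)]|)%N.

Definition endpoint_fixing (E : digraph) k (tau : {perm gpath E k}) : Prop :=
  forall u v : vert E, tau @: paths_between k u v = paths_between k u v.

(* Permutations are taken at level [k.+1], so that levels are always >= 1. *)
Section PermutationGraph.
Variables (E : digraph) (k : nat) (tau : {perm gpath E k.+1}).

Definition perm_graph : digraph :=
  @Digraph (gpath E k) (gpath E k.+1)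
    (fun mu => gprefix (tau mu)) (fun mu => gsuffix mu).

Definition label1 (mu : edge perm_graph) : edge E :=
  first_edge (mu : gpath E k.+1).
Definition label2 (mu : edge perm_graph) : edge E :=
  last_edge (tau (mu : gpath E k.+1)).

Definition sync_first : Prop :=
  exists m : nat, forall x y : gpath perm_graph m,
    map label1 (pedges x) = map label1 (pedges y) -> psrc x = psrc y.

Definition sync_second : Prop :=
  exists m : nat, forall l l' (x : gpath perm_graph l) (y : gpath perm_graph l'),
    (m <= l)%N -> (m <= l')%N ->
    map label2 (pedges x) = map label2 (pedges y) -> prng x = prng y.

End PermutationGraph.

Record graph_hom (G H : digraph) := GraphHom {
  hvert : vert G -> vert H;
  hedge : edge G -> edge H;
  hom_src : forall e, hvert (src e) = src (hedge e);
  hom_rng : forall e, hvert (rng e) = rng (hedge e) }.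

Record textile := Textile {
  tx_graph : digraph;
  tx_base : digraph;
  tx_p : graph_hom tx_graph tx_base;
  tx_q : graph_hom tx_graph tx_base;
  tx_inj : injective (fun a => (src a, rng a, hedge tx_p a, hedge tx_q a)) }.

Definition edge_shift (G : digraph) : set (int -> edge G) :=
  [set x | forall i : int, rng (x i) = src (x (i + 1))].
Arguments edge_shift : clear implicits.

Definition shift_map (G H : digraph) (h : graph_hom G H)
  (x : int -> edge G) : int -> edge H := fun i => hedge h (x i).

Lemma shift_map_edge_shift (G H : digraph) (h : graph_hom G H) :
  set_fun (edge_shift G) (edge_shift H) (shift_map h).
Proof. by move=> x xG i; rewrite /shift_map -hom_rng -hom_src xG. Qed.

Definition two_sided_11 (T : textile) : Prop :=
  set_inj (edge_shift (tx_graph T)) (shift_map (tx_p T)) /\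
  set_inj (edge_shift (tx_graph T)) (shift_map (tx_q T)).

Section PermutationTextile.
Variables (E : digraph) (k : nat) (tau : {perm gpath E k.+1}).
Hypothesis tau_fix : endpoint_fixing tau.

Lemma endpoint_fixingP (x : gpath E k.+1) :
  psrc (tau x) = psrc x /\ prng (tau x) = prng x.
Proof.
have : tau x \in tau @: paths_between k.+1 (psrc x) (prng x).
  by apply: imset_f; rewrite inE !eqxx.
by rewrite tau_fix inE => /andP[/eqP -> /eqP ->].
Qed.

Lemma src_first_edge n (x : gpath E n.+1) : src (first_edge x) = psrc x.
Proof.
case: x => -[v t] /= h; rewrite /first_edge /pedges /psrc /=.
by move: h; case/tupleP: t => e t /=; rewrite theadE => /andP[/eqP].
Qed.

Lemma rng_last_edge n (x : gpath E n.+1) : rng (last_edge x) = prng x.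
Proof.
rewrite /last_edge /prng (tnth_nth (first_edge x)) (last_nth (psrc x)).
by rewrite size_map size_tuple /= (nth_map (first_edge x)) ?size_tuple.
Qed.

Lemma prng_suffix n (x : gpath E n.+1) : prng (gsuffix x) = prng x.
Proof.
case: x => -[v t] h; rewrite /prng /psrc /pedges /= /first_edge /pedges /=.
by case/tupleP: t h => e t /= h; rewrite theadE.
Qed.

Lemma walk_last_belast (G : digraph) (v : vert G) e0 e p :
  walk v (e :: p) ->
  last v (map (@rng G) (belast e p)) = src (nth e0 (e :: p) (size p)).
Proof.
elim: p v e => [|f p IH] v e /=; first by rewrite andbT => /eqP.
by move=> /andP[_ h]; rewrite (IH _ _ h).
Qed.

Lemma prng_prefix n (x : gpath E n.+1) : prng (gprefix x) = src (last_edge x).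
Proof.
case: x => -[v t] h; rewrite /prng /psrc /pedges /= /last_edge /pedges /=.
rewrite /prefix_edges /pedges /= (tnth_nth (thead t)) /=.
move: h; case/tupleP: t => e t h; rewrite theadE /=.
by rewrite (walk_last_belast e h) size_tuple.
Qed.

Lemma gpath_split_inj n (x y : gpath E n.+1) :
  first_edge x = first_edge y -> gsuffix x = gsuffix y -> x = y.
Proof.
move=> xy1 xy2; have xys : psrc x = psrc y by rewrite -!src_first_edge xy1.
have /(congr1 val) /= xyb : behead_tuple (pedges x) = behead_tuple (pedges y).
  by have /(congr1 (@pedges _ _)) := xy2.
apply: val_inj; apply: injective_projections => //; apply: val_inj.
rewrite (tuple_eta (val x).2) (tuple_eta (val y).2) /=.
by congr cons; [exact: xy1 | exact: xyb].
Qed.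

Lemma perm_textile_p_src (e : edge (perm_graph tau)) :
  psrc (src e : gpath E k) = src (label1 e).
Proof. by rewrite /= src_first_edge -(endpoint_fixingP e).1. Qed.

Lemma perm_textile_p_rng (e : edge (perm_graph tau)) :
  psrc (rng e : gpath E k) = rng (label1 e).
Proof. by []. Qed.

Lemma perm_textile_q_src (e : edge (perm_graph tau)) :
  prng (src e : gpath E k) = src (label2 e).
Proof. exact: prng_prefix. Qed.

Lemma perm_textile_q_rng (e : edge (perm_graph tau)) :
  prng (rng e : gpath E k) = rng (label2 e).
Proof. by rewrite /label2 rng_last_edge prng_suffix (endpoint_fixingP e).2. Qed.

Definition perm_p : graph_hom (perm_graph tau) E :=
  @GraphHom (perm_graph tau) E (@psrc E k) (@label1 E k tau)
    perm_textile_p_src perm_textile_p_rng.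

Definition perm_q : graph_hom (perm_graph tau) E :=
  @GraphHom (perm_graph tau) E (@prng E k) (@label2 E k tau)
    perm_textile_q_src perm_textile_q_rng.

Lemma perm_textile_inj :
  injective (fun a : edge (perm_graph tau) =>
    (src a, rng a, hedge perm_p a, hedge perm_q a)).
Proof.
move=> x y xy; apply: (@gpath_split_inj k).
  exact: (congr1 (fun z => z.1.2) xy).
exact: (congr1 (fun z => z.1.1.2) xy).
Qed.

Definition perm_textile : textile :=
  @Textile (perm_graph tau) E perm_p perm_q perm_textile_inj.

End PermutationTextile.

(* C*-algebras are not assumed unital. The norm is [R[i]]-valued, as for every
   normed module over [R[i]]; its values are nonnegative reals. *)
HB.mixin Record CompleteNormedModule_isCstarAlg (R : realType) A
    of CompleteNormedModule R[i] A := {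
  cmul : A -> A -> A;
  cstar : A -> A;
  cmulA : associative cmul;
  cmulDl : left_distributive cmul +%R;
  cmulDr : right_distributive cmul +%R;
  cmulZl : forall (a : R[i]) (x y : A), cmul (a *: x) y = a *: cmul x y;
  cmulZr : forall (a : R[i]) (x y : A), cmul x (a *: y) = a *: cmul x y;
  cstarK : involutive cstar;
  cstarD : {morph cstar : x y / x + y};
  cstarZ : forall (a : R[i]) (x : A), cstar (a *: x) = a^* *: cstar x;
  cstarM : forall x y : A, cstar (cmul x y) = cmul (cstar y) (cstar x);
  cnormM_le : forall x y : A, `|cmul x y| <= `|x| * `|y|;
  cnorm_star_mul : forall x : A, `|cmul (cstar x) x| = `|x| ^+ 2 }.

#[short(type="cstarAlgType")]
HB.structure Definition CstarAlg (R : realType) :=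
  {A of CompleteNormedModule_isCstarAlg R A & CompleteNormedModule R[i] A}.

Notation "x ** y" := (cmul x y) (at level 40, left associativity) : ring_scope.
Notation "x ^†" := (cstar x) (at level 3, left associativity, format "x ^†")
  : ring_scope.

Section Cstar.
Variable R : realType.

Definition is_star_hom (A B : cstarAlgType R) (f : A -> B) : Prop :=
  [/\ linear f, {morph f : x y / x ** y} & {morph f : x / x^†}].

Definition is_unit_elt (A : cstarAlgType R) (u : A) : Prop :=
  forall x : A, u ** x = x /\ x ** u = x.

Definition is_unital (A B : cstarAlgType R) (f : A -> B) : Prop :=
  forall u : A, is_unit_elt u -> is_unit_elt (f u).

Definition is_star_automorphism (A : cstarAlgType R) (f : A -> A) : Prop :=
  is_star_hom f /\ bijective f.

(* [b - a] is positive: positive elements are those of the form [x^* x]. *)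
Definition cstar_le (A : cstarAlgType R) (a b : A) : Prop :=
  exists x : A, b - a = x^† ** x.

Definition is_projection (A : cstarAlgType R) (p : A) : Prop :=
  p^† = p /\ p ** p = p.

Definition is_partial_isometry (A : cstarAlgType R) (s : A) : Prop :=
  s ** s^† ** s = s.

Definition is_closed_star_subalg (A : cstarAlgType R) (B : set A) : Prop :=
  [/\ closed B,
      B 0,
      forall (a : R[i]) (x y : A), B x -> B y -> B (a *: x + y),
      forall x y : A, B x -> B y -> B (x ** y) &
      forall x : A, B x -> B x^†].

Record cuntz_krieger_family (E : digraph) (A : cstarAlgType R)
    (P : vert E -> A) (S : edge E -> A) : Prop := CuntzKriegerFamily {
  ck_proj : forall v, is_projection (P v);
  ck_orth : forall v w, v != w -> P v ** P w = 0;
  ck_pisom : forall e, is_partial_isometry (S e);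
  ck_source : forall e, (S e)^† ** S e = P (rng e);
  ck_edge_orth : forall e f, e != f -> (S e)^† ** S f = 0;
  ck_range : forall e, cstar_le (S e ** (S e)^†) (P (src e));
  ck_sum : forall v, (exists e, src e = v) ->
    P v = \sum_(e | src e == v) S e ** (S e)^† }.

(* [(A, P, S)] is the universal C*-algebra generated by a family as above,
   that is, C*(E) with its canonical generators; this determines the triple
   up to a unique isomorphism. *)
Record is_graph_cstar (E : digraph) (A : cstarAlgType R)
    (P : vert E -> A) (S : edge E -> A) : Prop := IsGraphCstar {
  graph_cstar_family : cuntz_krieger_family P S;
  graph_cstar_gen : forall B : set A, is_closed_star_subalg B ->
    (forall v, B (P v)) -> (forall e, B (S e)) -> forall x, B x;
  graph_cstar_univ : forall (B : cstarAlgType R)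
      (Q : vert E -> B) (T : edge E -> B), cuntz_krieger_family Q T ->
    exists f : A -> B,
      [/\ is_star_hom f, forall v, f (P v) = Q v & forall e, f (S e) = T e] }.

Section PermutativeEndomorphism.
Variables (E : digraph) (A : cstarAlgType R).
Variables (P : vert E -> A) (S : edge E -> A).

Definition path_elt n (x : gpath E n) : A :=
  if tval (pedges x) is e :: p then foldl (fun a f => a ** S f) (S e) p
  else P (psrc x).

Definition perm_unitary k (tau : {perm gpath E k}) : A :=
  \sum_(x : gpath E k) path_elt (tau x) ** (path_elt x)^†.

(* [lam] is the endomorphism associated with [tau]; at most one function
   qualifies when [A] is generated by [P] and [S], since [E] has no sinks. *)
Definition is_permutative_endo k (tau : {perm gpath E k}) (lam : A -> A) : Prop :=
  [/\ is_star_hom lam, is_unital lam &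
      forall e, lam (S e) = perm_unitary tau ** S e].

End PermutativeEndomorphism.

End Cstar.

(* Main.v *)
(* A path of the permutation graph with first label [a] and range [b] has source [b'] and
   second label [a'], where the word [b' a'] is obtained from [a b] by applying [tau]
   successively at the positions [size a], ..., 2, 1; call this map [sweep]. It describes the
   endomorphism: [lam (S_a) S_b = S_(sweep (a b))].

   (1) <-> (2). Two long paths with the same label that never meet repeat a pair of vertices,
   and running through the two cycles so obtained gives two bi-infinite paths with the same
   label.

   (1) -> (3). If both labels synchronize within [m] steps and [n = 2 m + 1], then the conjugate
   [sweep^-1 tau^-1 sweep] acts on the first [n] letters only. It is therefore given by a
   permutation [pi] of the paths of length [n], and [lam (U_pi) U_tau = 1], that is,
   [lam] is a left inverse of [lam_pi]. Since [lam] is injective on the span of the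
   [S_a S_b^*] with [size a = size b], also [lam_pi (U_tau) U_pi = 1].

   (3) -> (1). Let C*(E) act on the square-summable functions of infinite paths and let
   [t = lam t']. Approximating [t'] by combinations of the [S_a S_b^*], and using that between
   paths without small periods (they exist in every cylinder since cycles have exits)
   only the pairs with [size a = size b] contribute to the matrix entries of
   [lam (S_a S_b^* )], one sees that these entries of [t] only depend on finitely many labels.
   For [t = S_w S_w^*] this is synchronization in the first label; for [t = U_tau^*] it shows
   that the state reached does not change when the first letter read is dropped, which gives
   synchronization in the second label.

   Star homomorphisms from a unital C*-algebra are continuous because a small self-adjoint
   element is the real part of a unitary. *)

Require Import Defs.
From HB Require Import structures.
From mathcomp Require Import all_boot all_order all_algebra all_fingroup.
From mathcomp Require Import all_classical all_reals all_analysis.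
From mathcomp Require Import finmap complex ring lra zify.
Import Order.TTheory GRing.Theory Num.Theory.
Import numFieldNormedType.Exports.
Set Implicit Arguments.
Unset Strict Implicit.
Unset Printing Implicit Defensive.
Local Open Scope classical_set_scope.
Local Open Scope ring_scope.

(** * The Hilbert space of square-summable families *)

(** Identities in [A] are tested on words: the unit is the sum of $S_w S_w^*$ over the paths $w$ of
    a fixed length, so an identity holds once it holds after right multiplication by every such
    $S_w$ ([word_test]). As $\lambda(S_a)$ is in general not a single word, only $\lambda(S_a) S_b$
    with $b$ of length at least $k$ is computed; the leading $k$ letters of $b$ are the state of a
    transducer working from right to left.

    For (3) -> (1) this formula is read backwards: $\lambda(S_a)^*$ applied to the basis vector of a
    path decodes that path, testing whether the decoded word starts with $a$ and leaving the state
    in front of the unread rest. An approximation within $1/16$ of a preimage of $t$ gives the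
    entries of $t$ up to $1/4$, which suffices to tell 0 from 1. Its length bound does not depend on
    the paths, whence a uniform number of steps.

    When $k = 0$ the states are vertices and their words are empty, so a vertex must be recovered
    from a neighbouring edge; this causes several case distinctions. *)

Section SquareSummable.
Variable R : realType.
Implicit Types z w c : R[i].

(* The real part of [z * w^*]. A complex-linear operator has the same adjoint for the real
   part of the inner product, so that only limits of real numbers are needed. *)
Definition cdot z w : R := complex.Re z * complex.Re w + complex.Im z * complex.Im w.

Lemma cdotC z w : cdot z w = cdot w z.
Proof. by rewrite /cdot mulrC [_ * complex.Im w]mulrC. Qed.

Lemma cdotDl z z' w : cdot (z + z') w = cdot z w + cdot z' w.
Proof. by case: z z' w => [a b] [a' b'] [c d]; rewrite /cdot /=; ring. Qed.

Lemma cdotZl c z w : cdot (c * z) w = cdot z (c^* * w).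
Proof. by case: c z w => [a b] [a' b'] [c d]; rewrite /cdot /=; ring. Qed.

Lemma cdotNl z w : cdot (- z) w = - cdot z w.
Proof. by case: z w => [a b] [c d]; rewrite /cdot /=; ring. Qed.

Lemma cdotM c z : cdot (c * z) (c * z) = cdot c c * cdot z z.
Proof. by case: c z => [a b] [c d]; rewrite /cdot /=; ring. Qed.

Lemma cdot0l w : cdot 0 w = 0.
Proof. by rewrite /cdot /= !mul0r addr0. Qed.

Lemma cdot_ge0 z : 0 <= cdot z z.
Proof. by rewrite addr_ge0 // -expr2 sqr_ge0. Qed.

Lemma cdot_eq0 z : cdot z z = 0 -> z = 0.
Proof.
case: z => a b /eqP; rewrite /cdot /= -!expr2 paddr_eq0 ?sqr_ge0 //.
by rewrite !sqrf_eq0 => /andP[/eqP -> /eqP ->].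
Qed.

Lemma cdotD_le z w : cdot (z + w) (z + w) <= 2 * cdot z z + 2 * cdot w w.
Proof.
case: z w => [a b] [c d]; rewrite /cdot /= -subr_ge0.
have -> : 2 * (a * a + b * b) + 2 * (c * c + d * d) -
  ((a + c) * (a + c) + (b + d) * (b + d)) = (a - c) ^+ 2 + (b - d) ^+ 2 by ring.
by rewrite addr_ge0 ?sqr_ge0.
Qed.

Variable X : choiceType.

Definition sqsum (A : {fset X}) (f : X -> R[i]) : R := \sum_(x <- A) cdot (f x) (f x).

Definition sqsummable (f : X -> R[i]) := exists M, forall A, sqsum A f <= M.

Definition l2_pred : {pred X -> R[i]} := fun f => `[< sqsummable f >].

Lemma l2P f : reflect (sqsummable f) (f \in l2_pred).
Proof. by rewrite unfold_in; apply: asboolP. Qed.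

Lemma l2_submod_closed : submod_closed l2_pred.
Proof.
split; first by apply/l2P; exists 0 => A; rewrite /sqsum big1 // => x _; rewrite cdot0l.
move=> c f g /l2P[M fM] /l2P[M' gM']; apply/l2P.
exists (2 * (cdot c c * M) + 2 * M') => A.
apply: (@le_trans _ _ (2 * (cdot c c * sqsum A f) + 2 * sqsum A g)).
  rewrite /sqsum !mulr_sumr -big_split /=; apply: ler_sum => x _.
  by rewrite (le_trans (cdotD_le _ _)) // cdotM.
by rewrite lerD // ler_wpM2l // ler_wpM2l // cdot_ge0.
Qed.

HB.instance Definition _ :=
  GRing.isSubmodClosed.Build R[i] (X -> R[i]) l2_pred l2_submod_closed.

Record l2 := L2 { l2_fun :> X -> R[i]; _ : l2_fun \in l2_pred }.
HB.instance Definition _ := [isSub for l2_fun].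
HB.instance Definition _ := [Choice of l2 by <:].
HB.instance Definition _ := [SubChoice_isSubLmodule of l2 by <:].

Implicit Types f g h : l2.

Lemma l2D f g x : (f + g) x = f x + g x. Proof. by []. Qed.
Lemma l2N f x : (- f) x = - f x. Proof. by []. Qed.
Lemma l2Z c f x : (c *: f) x = c * f x. Proof. by []. Qed.
Lemma l20 x : (0 : l2) x = 0. Proof. by []. Qed.

Lemma l2_inj f g : (forall x, f x = g x) -> f = g.
Proof. by move=> fg; apply/val_inj/funext. Qed.

Definition nsq f : R := sup [set sqsum A f | A in [set: {fset X}]].

Lemma nsq_has_sup f : has_sup [set sqsum A f | A in [set: {fset X}]].
Proof.
split; first by exists (sqsum fset0 f), fset0.
by have /l2P[M fM] := valP f; exists M => _ [A _ <-].
Qed.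

Lemma sqsum_le_nsq A f : sqsum A f <= nsq f.
Proof. by apply: sup_upper_bound; [exact: nsq_has_sup|exists A]. Qed.

Lemma nsq_le f (M : R) : (forall A, sqsum A f <= M) -> nsq f <= M.
Proof.
move=> fM; apply: ge_sup; first by exists (sqsum fset0 f), fset0.
by move=> _ [A _ <-].
Qed.

Lemma nsq_ge0 f : 0 <= nsq f.
Proof. by apply: le_trans (sqsum_le_nsq fset0 f); rewrite /sqsum big_seq_fset0. Qed.

Lemma cdot_le_nsq f x : cdot (f x) (f x) <= nsq f.
Proof. by have := sqsum_le_nsq [fset x]%fset f; rewrite /sqsum big_seq_fset1. Qed.

Lemma nsq_eq0 f : nsq f = 0 -> f = 0.
Proof.
move=> f0; apply: l2_inj => x; apply: cdot_eq0; apply/eqP.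
by rewrite eq_le cdot_ge0 -{1}f0 cdot_le_nsq.
Qed.

Lemma sqsum_mono (A B : {fset X}) (f : X -> R[i]) : (A `<=` B)%fset -> sqsum A f <= sqsum B f.
Proof.
move=> AB; rewrite /sqsum.
rewrite (big_fsetID _ (mem A) B) /=.
have -> : [fset x in B | x \in A]%fset = A.
  by apply/fsetP => x; rewrite !inE /=; apply/andb_idl/(fsubsetP AB).
by rewrite lerDl sumr_ge0 // => x _; exact: cdot_ge0.
Qed.

(** Limits along this filter are unordered sums over [X]. *)
Definition finite_parts : set_system {fset X} :=
  filter_from setT (fun A => [set B | (A `<=` B)%fset]).

Instance finite_parts_filter : ProperFilter finite_parts.
Proof.
eapply filter_from_proper; last by move=> A _; exists A; rewrite /= fsubset_refl.
apply: filter_fromT_filter; first by exists fset0.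
by move=> A B; exists (A `|` B)%fset => C /=; rewrite fsubUset => /andP[].
Qed.

Lemma nsq_cvg f : (sqsum^~ f @ finite_parts) --> nsq f.
Proof.
apply/cvgrPdist_le => e e0.
have [_ [A _ <-] fA] := sup_adherent e0 (nsq_has_sup f).
exists A => // B /= AB; rewrite ger0_norm ?subr_ge0 ?sqsum_le_nsq //.
by rewrite lerBlDr -lerBlDl (le_trans (ltW fA)) // sqsum_mono.
Qed.

(** Polarization makes the pairing total at once; [ip_cvg] identifies it with the unordered sum of
    the products, and the algebraic rules are read off from that limit. *)
Definition ip f g : R := (nsq (f + g) - nsq (f - g)) / 4.

Definition dotsum f g (A : {fset X}) : R := \sum_(x <- A) cdot (f x) (g x).

Lemma ip_cvg f g : dotsum f g @ finite_parts --> ip f g.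
Proof.
have -> : dotsum f g =
    (fun A => (sqsum A (f + g : l2) - sqsum A (f - g : l2)) / 4).
  apply/funext => A.
  rewrite /sqsum -sumrB mulr_suml; apply: eq_bigr => x _.
  rewrite !l2D l2N; case: (f x) (g x) => [a b] [c d].
  by rewrite /cdot /=; field.
by apply: cvgMr_tmp; apply: cvgB; exact: nsq_cvg.
Qed.

Lemma ip_unique f g (l : R) : dotsum f g @ finite_parts --> l -> ip f g = l.
Proof. by apply: cvg_unique => //; exact: ip_cvg. Qed.

Lemma ip_eq f g f' g' :
  (forall x, cdot (f x) (g x) = cdot (f' x) (g' x)) -> ip f g = ip f' g'.
Proof.
move=> E; apply: ip_unique.
have -> : dotsum f g = dotsum f' g'.
  by apply/funext => A; apply: eq_bigr => x _.
exact: ip_cvg.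
Qed.

Lemma ipC f g : ip f g = ip g f.
Proof. by apply: ip_eq => x; rewrite cdotC. Qed.

Lemma ipDl f f' g : ip (f + f') g = ip f g + ip f' g.
Proof.
apply: ip_unique.
have -> : dotsum (f + f') g = (fun A => dotsum f g A + dotsum f' g A).
  by apply/funext => A; rewrite -big_split; apply: eq_bigr => x _; rewrite cdotDl.
by apply: cvgD; exact: ip_cvg.
Qed.

Lemma ipZl c f g : ip (c *: f) g = ip f (c^* *: g).
Proof. by apply: ip_eq => x; rewrite !l2Z cdotZl. Qed.

Lemma ipNl f g : ip (- f) g = - ip f g.
Proof.
apply: ip_unique.
have -> : dotsum (- f) g = (fun A => - dotsum f g A).
  by apply/funext => A; rewrite -sumrN; apply: eq_bigr => x _; rewrite cdotNl.
by apply: cvgN; exact: ip_cvg.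
Qed.

Lemma ipDr f g g' : ip f (g + g') = ip f g + ip f g'.
Proof. by rewrite ipC ipDl !(ipC _ f). Qed.

Lemma ipNr f g : ip f (- g) = - ip f g.
Proof. by rewrite ipC ipNl ipC. Qed.

Lemma ipBr f g g' : ip f (g - g') = ip f g - ip f g'.
Proof. by rewrite ipDr ipNr. Qed.

Lemma ip_real (a : R) f g : ip (a%:C%C *: f) g = a * ip f g.
Proof.
apply: ip_unique.
have -> : dotsum (a%:C%C *: f) g = (fun A => a * dotsum f g A).
  apply/funext => A; rewrite mulr_sumr; apply: eq_bigr => x _; rewrite l2Z /cdot /=.
  by case: (f x) (g x) => [b b'] [d d'] /=; ring.
by apply: cvgMl_tmp; exact: ip_cvg.
Qed.

Lemma ip0l f : ip 0 f = 0.
Proof. by rewrite -(scale0r (0 : l2)) (ip_real 0) mul0r. Qed.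

Lemma ipxx f : ip f f = nsq f.
Proof. by apply: ip_unique; exact: nsq_cvg. Qed.

Lemma ip_nondeg f g : (forall h, ip f h = ip g h) -> f = g.
Proof.
move=> fg; apply/eqP; rewrite -subr_eq0; apply/eqP/nsq_eq0.
by rewrite -ipxx ipDl ipNl fg subrr.
Qed.

Definition l2norm f : R := Num.sqrt (nsq f).

Lemma l2norm_ge0 f : 0 <= l2norm f. Proof. exact: sqrtr_ge0. Qed.

Lemma l2norm_sq f : l2norm f ^+ 2 = nsq f.
Proof. by rewrite sqr_sqrtr ?nsq_ge0. Qed.

Lemma l2norm0 : l2norm 0 = 0.
Proof. by rewrite /l2norm -ipxx ip0l sqrtr0. Qed.

Lemma l2norm_eq0 f : l2norm f = 0 -> f = 0.
Proof. by move=> f0; apply: nsq_eq0; rewrite -l2norm_sq f0 expr0n. Qed.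

Lemma ip_le f g : ip f g <= l2norm f * l2norm g.
Proof.
have [f0|f_neq0] := eqVneq (l2norm f) 0.
  by rewrite f0 mul0r (l2norm_eq0 f0) ip0l.
have [g0|g_neq0] := eqVneq (l2norm g) 0.
  by rewrite g0 mulr0 ipC (l2norm_eq0 g0) ip0l.
have fg_gt0 : 0 < l2norm f * l2norm g.
  by rewrite mulr_gt0 // lt_neqAle eq_sym ?f_neq0 ?g_neq0 l2norm_ge0.
(* With $a = \|f\|$ and $b = \|g\|$, the square norm of $bf - ag$ is $2ab(ab - \langle f,
   g\rangle)$. *)
have := nsq_ge0 ((l2norm g)%:C%C *: f - (l2norm f)%:C%C *: g).
rewrite -ipxx ipBr !ipDl !ipNl !ip_real.
rewrite (ipC f (_ *: f)) (ipC f (_ *: g)) (ipC g (_ *: f)) (ipC g (_ *: g)) !ip_real.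
rewrite !ipxx (ipC g f) -!l2norm_sq => le0.
rewrite -subr_ge0 -(pmulr_rge0 _ fg_gt0); lra.
Qed.

Lemma l2norm_le f (M : R) : 0 <= M -> nsq f <= M ^+ 2 -> l2norm f <= M.
Proof.
by move=> M0 fM; rewrite -(ler_pXn2r (_ : 0 < 2)%N) ?nnegrE ?l2norm_ge0 // l2norm_sq.
Qed.

Lemma l2normD f g : l2norm (f + g) <= l2norm f + l2norm g.
Proof.
apply: l2norm_le; first by rewrite addr_ge0 ?l2norm_ge0.
rewrite -ipxx ipDl !ipDr !ipxx (ipC g f) -!l2norm_sq.
have := ip_le f g; lra.
Qed.

Lemma nsqZ c f : nsq (c *: f) = cdot c c * nsq f.
Proof.
rewrite -!ipxx ipZl scalerA.
have -> : c^* * c = (cdot c c)%:C%C.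
  by case: c => a b; rewrite /cdot; apply/eqP; rewrite eq_complex /=; apply/andP; split; apply/eqP; ring.
by rewrite ipC ip_real ipxx.
Qed.

Lemma l2normZ c f : l2norm (c *: f) = Num.sqrt (cdot c c) * l2norm f.
Proof. by rewrite /l2norm nsqZ sqrtrM // cdot_ge0. Qed.

Lemma normc_cdot c : `|c| = (Num.sqrt (cdot c c))%:C%C.
Proof. by rewrite normc_def /cdot !expr2. Qed.
End SquareSummable.

(** * The C*-algebra of bounded operators *)

Section BoundedOperators.
Variables (R : realType) (X : choiceType).
Local Notation H := (l2 R X).
Implicit Types (f g h : H) (c : R[i]).

Definition modulus c : R := Num.sqrt (cdot c c).

Definition bounded_by (T : H -> H) (M : R) := forall f, l2norm (T f) <= M * l2norm f.

Definition adjoint_to (T T' : H -> H) := forall f g, ip (T f) g = ip f (T' g).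

(** An adjoint is part of the data and yields additivity ([bop_add]). Complex homogeneity is asked
    separately: [ip] is the real part of the inner product, so an adjoint for it gives real
    linearity only. *)
Definition bounded_operator (T : H -> H) :=
  [/\ forall c f, T (c *: f) = c *: T f, exists M, bounded_by T M &
      exists T', adjoint_to T T'].

Definition bop_pred : {pred H -> H} := fun T => `[< bounded_operator T >].

Lemma bop_predP (T : H -> H) : reflect (bounded_operator T) (T \in bop_pred).
Proof. by rewrite unfold_in; apply: asboolP. Qed.

Lemma bop_submod_closed : submod_closed bop_pred.
Proof.
split.
  apply/bop_predP; split; first by move=> c f; rewrite /= scaler0.
    by exists 0 => f; rewrite mul0r l2norm0.
  by exists (fun=> 0) => f g; rewrite ip0l ipC ip0l.
move=> c T U /bop_predP[Tl [M TM] [T' TT']] /bop_predP[Ul [N UN] [U' UU']].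
apply/bop_predP; split.
- move=> a f; rewrite -[LHS]/(c *: T (a *: f) + U (a *: f)) Tl Ul.
  by rewrite scalerA mulrC -scalerA -scalerDr.
- exists (modulus c * M + N) => f; rewrite mulrDl.
  rewrite (le_trans (l2normD _ _)) // lerD // [l2norm (c *: T f)]l2normZ -mulrA.
  by rewrite ler_wpM2l // sqrtr_ge0.
exists (fun g => T' (c^* *: g) + U' g) => f g.
by rewrite [LHS]ipDl ipDr ipZl TT' UU'.
Qed.

HB.instance Definition _ :=
  GRing.isSubmodClosed.Build R[i] (H -> H) bop_pred bop_submod_closed.

Record bop := Bop { bop_fun :> H -> H; _ : bop_fun \in bop_pred }.
HB.instance Definition _ := [isSub for bop_fun].
HB.instance Definition _ := [Choice of bop by <:].
HB.instance Definition _ := [SubChoice_isSubLmodule of bop by <:].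

Implicit Types T U : bop.

Lemma bop_inj T U : (forall f, T f = U f) -> T = U.
Proof. by move=> TU; apply: (@val_inj _ _ bop); apply/funext. Qed.

Lemma bopD T U f : (T + U) f = T f + U f. Proof. by []. Qed.
Lemma bopN T f : (- T) f = - T f. Proof. by []. Qed.
Lemma bopZ c T f : (c *: T) f = c *: T f. Proof. by []. Qed.
Lemma bop0 f : (0 : bop) f = 0. Proof. by []. Qed.

Lemma bop_scale T c f : T (c *: f) = c *: T f.
Proof. by have /bop_predP[] := valP T. Qed.

Lemma bop_adjoint_ex T : exists T' : H -> H, adjoint_to T T'.
Proof. by have /bop_predP[_ _ [T' TT']] := valP T; exists T'. Qed.

Definition adj T : H -> H := projT1 (cid (bop_adjoint_ex T)).

Lemma adjE T f g : ip (T f) g = ip f (adj T g).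
Proof. exact: (projT2 (cid (bop_adjoint_ex T))). Qed.

Lemma adjEr T f g : ip f (T g) = ip (adj T f) g.
Proof. by rewrite ipC adjE ipC. Qed.

Lemma adj_unique T (T' : H -> H) : adjoint_to T T' -> adj T = T'.
Proof.
move=> TT'; apply/funext => g; apply: ip_nondeg => h.
by rewrite ipC -adjE TT' ipC.
Qed.

Lemma bop_add T f g : T (f + g) = T f + T g.
Proof. by apply: ip_nondeg => h; rewrite adjE !ipDl !adjE. Qed.

Lemma bop_at0 T : T 0 = 0.
Proof. by have := bop_scale T 0 0; rewrite !scale0r. Qed.

Definition opbounds T := [set M | 0 <= M /\ bounded_by T M].

Lemma opbounds_ex T : opbounds T !=set0.
Proof.
have /bop_predP[_ [M TM] _] := valP T.
exists (Num.max 0 M); split; first by rewrite le_max lexx.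
by move=> f; rewrite (le_trans (TM f)) // ler_wpM2r ?l2norm_ge0 // le_max lexx orbT.
Qed.

Definition opnorm T : R := inf (opbounds T).

Lemma opnorm_ge0 T : 0 <= opnorm T.
Proof. by apply: lb_le_inf; [exact: opbounds_ex | move=> M []]. Qed.

Lemma opnormP T f : l2norm (T f) <= opnorm T * l2norm f.
Proof.
have [/l2norm_eq0 -> |f0] := eqVneq (l2norm f) 0.
  by rewrite bop_at0 l2norm0 mulr0.
have f_gt0 : 0 < l2norm f by rewrite lt_neqAle eq_sym f0 l2norm_ge0.
rewrite -ler_pdivrMr //; apply: lb_le_inf; first exact: opbounds_ex.
by move=> M [_ TM]; rewrite ler_pdivrMr.
Qed.

Lemma opnorm_le T M : 0 <= M -> bounded_by T M -> opnorm T <= M.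
Proof. by move=> M0 TM; apply: ge_inf => //; exists 0 => ? []. Qed.

Lemma opnormD T U : opnorm (T + U) <= opnorm T + opnorm U.
Proof.
apply: opnorm_le; first by rewrite addr_ge0 ?opnorm_ge0.
move=> f; rewrite bopD mulrDl (le_trans (l2normD _ _)) //.
by rewrite lerD ?opnormP.
Qed.

Lemma opnorm_eq0 T : opnorm T = 0 -> T = 0.
Proof.
move=> T0; apply: bop_inj => f; apply: l2norm_eq0; apply/eqP.
by rewrite eq_le l2norm_ge0 andbT (le_trans (opnormP _ _)) // T0 mul0r.
Qed.

Lemma modulus_ge0 c : 0 <= modulus c. Proof. exact: sqrtr_ge0. Qed.

Lemma modulusM a c : modulus (a * c) = modulus a * modulus c.
Proof. by rewrite /modulus cdotM sqrtrM // cdot_ge0. Qed.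

Lemma opnormZ_le c T : opnorm (c *: T) <= modulus c * opnorm T.
Proof.
apply: opnorm_le; first by rewrite mulr_ge0 ?opnorm_ge0 ?modulus_ge0.
by move=> f; rewrite bopZ l2normZ -mulrA ler_wpM2l ?modulus_ge0 ?opnormP.
Qed.

Lemma opnormZ c T : opnorm (c *: T) = modulus c * opnorm T.
Proof.
apply/eqP; rewrite eq_le opnormZ_le /=.
have [->|c0] := eqVneq c 0; first by rewrite /modulus cdot0l sqrtr0 mul0r opnorm_ge0.
have := opnormZ_le c^-1 (c *: T); rewrite scalerA mulVf // scale1r => le1.
rewrite (le_trans (ler_wpM2l (modulus_ge0 c) le1)) // mulrA -modulusM mulfV //.
by rewrite /modulus /cdot /= !mulr1 !mulr0 addr0 sqrtr1 mul1r.
Qed.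

Lemma bopM_subproof T U : (T \o U : H -> H) \in bop_pred.
Proof.
apply/bop_predP; split; first by move=> c f; rewrite /= !bop_scale.
  exists (opnorm T * opnorm U) => f /=; rewrite -mulrA.
  by rewrite (le_trans (opnormP _ _)) // ler_wpM2l ?opnorm_ge0 ?opnormP.
by exists (adj U \o adj T) => f g /=; rewrite !adjE.
Qed.

Definition bopM T U := Bop (bopM_subproof T U).

Lemma adj_bound T : bounded_by (adj T) (opnorm T).
Proof.
move=> f; have [->|Tf0] := eqVneq (l2norm (adj T f)) 0.
  by rewrite mulr_ge0 ?opnorm_ge0 ?l2norm_ge0.
have Tf_gt0 : 0 < l2norm (adj T f) by rewrite lt_neqAle eq_sym Tf0 l2norm_ge0.
rewrite -(ler_pM2l Tf_gt0) -expr2 l2norm_sq -ipxx -adjE.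
rewrite (le_trans (ip_le _ _)) // mulrA ler_wpM2r ?l2norm_ge0 //.
by rewrite mulrC opnormP.
Qed.

Lemma adj_subproof T : adj T \in bop_pred.
Proof.
apply/bop_predP; split; last by exists T => f g; rewrite adjEr.
  by move=> c f; apply: ip_nondeg => h; rewrite -adjEr !ipZl -bop_scale adjEr.
by exists (opnorm T); exact: adj_bound.
Qed.

Definition bopS T := Bop (adj_subproof T).

Lemma opnormS_le T : opnorm (bopS T) <= opnorm T.
Proof. by apply: opnorm_le; [exact: opnorm_ge0 | exact: adj_bound]. Qed.

Lemma bopSK : involutive bopS.
Proof.
move=> T; apply: bop_inj => f.
by have /(congr1 (@^~ f)) := @adj_unique (bopS T) T (fun f g => esym (adjEr T f g)).
Qed.

Lemma opnormM T U : opnorm (bopM T U) <= opnorm T * opnorm U.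
Proof.
apply: opnorm_le; first by rewrite mulr_ge0 ?opnorm_ge0.
by move=> f /=; rewrite -mulrA (le_trans (opnormP _ _)) // ler_wpM2l ?opnorm_ge0 ?opnormP.
Qed.

Lemma opnorm_star_mul T : opnorm (bopM (bopS T) T) = opnorm T ^+ 2.
Proof.
apply/eqP; rewrite eq_le; apply/andP; split.
  by rewrite (le_trans (opnormM _ _)) // expr2 ler_wpM2r ?opnorm_ge0 ?opnormS_le.
rewrite -[leRHS]sqr_sqrtr ?opnorm_ge0 // ler_pXn2r ?nnegrE ?opnorm_ge0 ?sqrtr_ge0 //.
apply: opnorm_le; first exact: sqrtr_ge0.
move=> f; apply: l2norm_le; first by rewrite mulr_ge0 ?sqrtr_ge0 ?l2norm_ge0.
rewrite -ipxx adjE (le_trans (ip_le _ _)) // exprMn sqr_sqrtr ?opnorm_ge0 //.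
rewrite [leRHS](_ : _ = l2norm f * (opnorm (bopM (bopS T) T) * l2norm f)); last by ring.
by rewrite ler_wpM2l ?l2norm_ge0 // (opnormP (bopM (bopS T) T) f).
Qed.

Definition bop_norm T : R[i] := (opnorm T)%:C%C.

Lemma bop_normD T U : bop_norm (T + U) <= bop_norm T + bop_norm U.
Proof. by rewrite /bop_norm -rmorphD lecR opnormD. Qed.

Lemma bop_normZ c T : bop_norm (c *: T) = `|c| * bop_norm T.
Proof. by rewrite /bop_norm opnormZ rmorphM normc_cdot. Qed.

Lemma bop_norm_eq0 T : bop_norm T = 0 -> T = 0.
Proof. by move=> /complexI /opnorm_eq0. Qed.

HB.instance Definition _ := @Lmodule_isNormed.Build R[i] bop
  bop_norm bop_normD bop_normZ bop_norm_eq0.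

Lemma bop_normE T : `|T| = (opnorm T)%:C%C. Proof. by []. Qed.

Lemma bop_ball T U (e : R) : ball T e%:C%C U <-> opnorm (T - U) < e.
Proof. by rewrite -ball_normE /= bop_normE ltcR. Qed.

(** * Completeness of the operator algebra *)

Section Completeness.
Variables (F : set_system bop).
Context {FF : ProperFilter F}.
Hypothesis F_cauchy : cauchy F.

Lemma cauchy_close (e : R) : 0 < e -> exists T, F [set U | opnorm (T - U) < e].
Proof.
move=> e0; have /cauchyP/(_ e%:C%C) := F_cauchy.
case; first by rewrite ltcR.
move=> T FT; exists T; apply: filterS FT => U /bop_ball; exact.
Qed.

Lemma cdot_le_opnorm T f x : cdot (T f x) (T f x) <= (opnorm T * l2norm f) ^+ 2.
Proof.
rewrite (le_trans (cdot_le_nsq _ _)) // -l2norm_sq.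
by rewrite ler_pXn2r ?nnegrE ?l2norm_ge0 ?mulr_ge0 ?opnorm_ge0 ?l2norm_ge0 ?opnormP.
Qed.

Lemma Re_le_opnorm T f x : `|complex.Re (T f x)| <= opnorm T * l2norm f.
Proof.
rewrite -(ler_pXn2r (_ : 0 < 2)%N) ?nnegrE ?mulr_ge0 ?opnorm_ge0 ?l2norm_ge0 //.
rewrite (le_trans _ (cdot_le_opnorm T f x)) // real_normK ?num_real //.
by rewrite /cdot -!expr2 lerDl sqr_ge0.
Qed.

Lemma Im_le_opnorm T f x : `|complex.Im (T f x)| <= opnorm T * l2norm f.
Proof.
rewrite -(ler_pXn2r (_ : 0 < 2)%N) ?nnegrE ?mulr_ge0 ?opnorm_ge0 ?l2norm_ge0 //.
rewrite (le_trans _ (cdot_le_opnorm T f x)) // real_normK ?num_real //.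
by rewrite /cdot -!expr2 lerDr sqr_ge0.
Qed.

Lemma coordinate_cvg (p : bop -> R) (M : R) : 0 <= M ->
  (forall T U, `|p T - p U| <= opnorm (T - U) * M) -> cvg (p @ F).
Proof.
move=> M0 pM; apply: cauchy_cvg; apply/cauchyP => e e0.
have [T FT] := @cauchy_close (e / (M + 1)) (divr_gt0 e0 (ltr_wpDl M0 ltr01)).
exists (p T); change (F (p @^-1` ball (p T) e)); apply: filterS FT => U /= TU; change (`|p T - p U| < e).
rewrite (le_lt_trans (pM _ _)) //.
have M1 : 0 < M + 1 by rewrite ltr_wpDl.
move: TU; rewrite ltr_pdivlMr //; apply: le_lt_trans.
by rewrite ler_wpM2l ?opnorm_ge0 // lerDl.
Qed.

Definition lim_entry f x : R[i] :=
  Complex (lim ((fun T => complex.Re (T f x)) @ F)) (lim ((fun T => complex.Im (T f x)) @ F)).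

Lemma Re_entry_cvg f x : cvg ((fun T => complex.Re (T f x)) @ F).
Proof.
apply: (@coordinate_cvg _ (l2norm f)); first exact: l2norm_ge0.
move=> T U; have := Re_le_opnorm (T - U) f x.
by rewrite bopD bopN l2D l2N; case: (T f x) (U f x) => [a b] [c d].
Qed.

Lemma Im_entry_cvg f x : cvg ((fun T => complex.Im (T f x)) @ F).
Proof.
apply: (@coordinate_cvg _ (l2norm f)); first exact: l2norm_ge0.
move=> T U; have := Im_le_opnorm (T - U) f x.
by rewrite bopD bopN l2D l2N; case: (T f x) (U f x) => [a b] [c d].
Qed.

(** A sum over a finite set is continuous in the entries, so the bound $\|(T - U) f\| \le e \|f\|$
    passes to the entrywise limit. It is uniform in [A], which gives both square-summability of the
    limit and convergence in norm. *)
Lemma lim_entry_sqsum T e f A : 0 <= e -> F [set U | opnorm (T - U) < e] ->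
  sqsum A (fun x => T f x - lim_entry f x) <= (e * l2norm f) ^+ 2.
Proof.
move=> e0 FT.
have cv : (fun U => sqsum A (fun x => T f x - U f x)) @ F -->
    sqsum A (fun x => T f x - lim_entry f x).
  apply: cvg_big => [|x _]; first exact: add_continuous.
  rewrite /cdot.
  have Re_sub z w : complex.Re (z - w) = complex.Re z - complex.Re w :> R.
    by case: z w => [a b] [c d].
  have Im_sub z w : complex.Im (z - w) = complex.Im z - complex.Im w :> R.
    by case: z w => [a b] [c d].
  under eq_fun do rewrite Re_sub Im_sub.
  rewrite Re_sub Im_sub.
  have cR : (fun U : bop => complex.Re (T f x) - complex.Re (U f x)) @ F -->
      complex.Re (T f x) - complex.Re (lim_entry f x).
    by apply: cvgB; [exact: cvg_cst | exact: Re_entry_cvg].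
  have cI : (fun U : bop => complex.Im (T f x) - complex.Im (U f x)) @ F -->
      complex.Im (T f x) - complex.Im (lim_entry f x).
    by apply: cvgB; [exact: cvg_cst | exact: Im_entry_cvg].
  by apply: cvgD; apply: cvgM.
apply: (cvgr_to_le cv); apply: filterS FT => U /= TU.
have -> : (fun x => T f x - U f x) = (T - U) f :> (X -> R[i]) by [].
rewrite (le_trans (sqsum_le_nsq _ _)) // -l2norm_sq.
rewrite ler_pXn2r ?nnegrE ?l2norm_ge0 ?mulr_ge0 ?l2norm_ge0 //.
by rewrite (le_trans (opnormP _ _)) // ler_wpM2r ?l2norm_ge0 // ltW.
Qed.

Lemma lim_entry_l2 f : lim_entry f \in @l2_pred R X.
Proof.
have [T FT] := cauchy_close ltr01.
have Tl : (fun x => T f x - lim_entry f x) \in @l2_pred R X.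
  by apply/l2P; eexists => A; apply: lim_entry_sqsum FT.
have -> : lim_entry f = (T f : X -> R[i]) - (fun x => T f x - lim_entry f x).
  apply/funext => x; change (lim_entry f x = T f x - (T f x - lim_entry f x)).
  by rewrite opprB addrC subrK.
by rewrite rpredB // (valP (T f)).
Qed.

Definition lim_op f : H := L2 (lim_entry_l2 f).

Lemma lim_op_close T e f : 0 <= e -> F [set U | opnorm (T - U) < e] ->
  l2norm (T f - lim_op f) <= e * l2norm f.
Proof.
move=> e0 FT; apply: l2norm_le; first by rewrite mulr_ge0 ?l2norm_ge0.
by apply: nsq_le => A; exact: lim_entry_sqsum.
Qed.
End Completeness.

Lemma opnormN T : opnorm (- T) = opnorm T.
Proof. by have := normrN T; rewrite !bop_normE => /complexI. Qed.

Lemma bopSB T U : bopS (T - U) = bopS T - bopS U.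
Proof.
apply: val_inj; apply: adj_unique => f g.
by rewrite [in LHS]/= ipDl ipNl !adjE -ipBr.
Qed.

Lemma opnormS T : opnorm (bopS T) = opnorm T.
Proof. by apply/eqP; rewrite eq_le opnormS_le -{1}(bopSK T) opnormS_le. Qed.

Section Limit.
Variables (F : set_system bop).
Context {FF : ProperFilter F}.
Hypothesis F_cauchy : cauchy F.

Let FS := bopS @ F.

Lemma starred_cauchy : cauchy FS.
Proof.
apply/cauchyP => e e0.
have [T FT] := (cauchyP F).1 F_cauchy e e0.
exists (bopS T); change (F (bopS @^-1` ball (bopS T) e)); apply: filterS FT => U /=.
by rewrite -!ball_normE /= !bop_normE -bopSB opnormS.
Qed.

Lemma small_eq0 (u M : R) : (forall e, 0 < e -> `|u| <= e * M) -> 0 <= M -> u = 0.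
Proof.
move=> uM M0; apply/eqP; rewrite -normr_le0; apply/ler_addgt0Pl => e e0.
have M1 : 0 < M + 1 by rewrite ltr_wpDl.
rewrite addr0 (le_trans (uM _ (divr_gt0 e0 M1))) // -mulrA.
apply: ler_piMr; first exact: ltW.
by rewrite ler_pdivrMl // mulr1 lerDl.
Qed.

Lemma ip_abs_le f g : `|ip f g| <= l2norm f * l2norm g.
Proof.
rewrite ler_norml ip_le andbT lerNl -ipNl (le_trans (ip_le _ _)) //.
by rewrite /l2norm -[nsq (- f)]ipxx ipNl ipC ipNl opprK ipxx.
Qed.

(** Taking adjoints is isometric, so the adjoints form a Cauchy filter as well; their limit is the
    adjoint that membership in [bop] requires. *)
Lemma lim_adjoint : adjoint_to (lim_op F_cauchy) (lim_op starred_cauchy).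
Proof.
move=> f g; apply/eqP; rewrite -subr_eq0; apply/eqP.
apply: (@small_eq0 _ (2 * (l2norm f * l2norm g))); last first.
  by rewrite !mulr_ge0 ?l2norm_ge0.
move=> e e0; have [T FT] := cauchy_close F_cauchy e0.
have FST : FS [set U | opnorm (bopS T - U) < e].
  change (F (bopS @^-1` [set U | opnorm (bopS T - U) < e])).
  by apply: filterS FT => U /=; rewrite -bopSB opnormS.
set Lf := lim_op F_cauchy f; set Lg := lim_op starred_cauchy g.
have le2 : l2norm (T f - Lf) <= e * l2norm f by apply: lim_op_close (ltW e0) FT.
have le1 : l2norm (bopS T g - Lg) <= e * l2norm g by apply: lim_op_close (ltW e0) FST.
have -> : ip Lf g - ip f Lg = ip f (bopS T g - Lg) - ip (T f - Lf) g.
  by rewrite ipBr ipDl ipNl [ip f (bopS T g)]/= -adjE; ring.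
rewrite (le_trans (ler_normB _ _)) //.
have := ip_abs_le f (bopS T g - Lg); have := ip_abs_le (T f - Lf) g => le3 le4.
have := ler_wpM2l (l2norm_ge0 f) le1; have := ler_wpM2r (l2norm_ge0 g) le2.
lra.
Qed.

Lemma lim_op_subproof : lim_op F_cauchy \in bop_pred.
Proof.
apply/bop_predP; split; last by exists (lim_op starred_cauchy); exact: lim_adjoint.
  move=> c f; apply/eqP; rewrite -subr_eq0; apply/eqP/l2norm_eq0.
  apply: (@small_eq0 _ (2 * (modulus c * l2norm f))); last first.
    by rewrite !mulr_ge0 ?l2norm_ge0 ?modulus_ge0.
  move=> e e0; have [T FT] := cauchy_close F_cauchy e0.
  set Lg := lim_op F_cauchy (c *: f); set Lf := lim_op F_cauchy f.
  have le1 : l2norm (T f - Lf) <= e * l2norm f by apply: lim_op_close (ltW e0) FT.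
  have le2 : l2norm (T (c *: f) - Lg) <= e * l2norm (c *: f).
    by apply: lim_op_close (ltW e0) FT.
  have -> : Lg - c *: Lf = c *: (T f - Lf) - (T (c *: f) - Lg).
    by rewrite bop_scale scalerBr opprB [RHS]addrC addrA subrK.
  rewrite ger0_norm ?l2norm_ge0 // (le_trans (l2normD _ _)) //.
  rewrite [X in _ + X](_ : _ = l2norm (T (c *: f) - Lg)); last first.
    by rewrite /l2norm -!ipxx ipNl ipNr opprK.
  rewrite l2normZ -/(modulus c); rewrite l2normZ -/(modulus c) in le2.
  have := ler_wpM2l (modulus_ge0 c) le1; lra.
have [T FT] := cauchy_close F_cauchy ltr01.
exists (opnorm T + 1) => f; set Lf := lim_op F_cauchy f.
have le1 : l2norm (T f - Lf) <= 1 * l2norm f by apply: lim_op_close ler01 FT.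
have -> : Lf = T f - (T f - Lf) by rewrite opprB addrC subrK.
rewrite (le_trans (l2normD _ _)) //.
rewrite [X in _ + X](_ : _ = l2norm (T f - Lf)); last first.
  by rewrite /l2norm -!ipxx ipNl ipNr opprK.
by rewrite mulrDl lerD // opnormP.
Qed.

Lemma bop_cauchy_cvg : cvg F.
Proof.
apply/cvg_ex; exists (Bop lim_op_subproof); apply/cvg_ballP => e e0.
have e1 : (complex.Re e)%:C%C = e by apply: RRe_real; exact: gtr0_real.
have e2 : 0 < complex.Re e by rewrite -ltcR e1.
rewrite -e1; have [T FT] := cauchy_close F_cauchy (divr_gt0 e2 (ltr0Sn R 2)).
apply: filterS (FT) => U /= TU; apply/bop_ball.
set L := Bop _.
have TL : opnorm (T - L) <= complex.Re e / 3.
  apply: opnorm_le; first by rewrite ltW // divr_gt0.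
  by move=> f; apply: lim_op_close FT; rewrite ltW // divr_gt0.
have -> : L - U = (T - U) - (T - L) by rewrite opprB [RHS]addrC addrA subrK.
rewrite (le_lt_trans (opnormD _ _)) // opnormN; move: TU TL e2; lra.
Qed.
End Limit.

HB.instance Definition _ := Uniform_isComplete.Build bop (@bop_cauchy_cvg).

Lemma bopMA : associative bopM.
Proof. by move=> T U V; apply: bop_inj. Qed.

Lemma bopMDl : left_distributive bopM +%R.
Proof. by move=> T U V; apply: bop_inj. Qed.

Lemma bopMDr : right_distributive bopM +%R.
Proof. by move=> T U V; apply: bop_inj => f; rewrite /= bop_add. Qed.

Lemma bopMZl c T U : bopM (c *: T) U = c *: bopM T U.
Proof. exact: bop_inj. Qed.

Lemma bopMZr c T U : bopM T (c *: U) = c *: bopM T U.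
Proof. by apply: bop_inj => f; rewrite /= bop_scale. Qed.

Lemma bopSD : {morph bopS : T U / T + U}.
Proof.
move=> T U; apply: val_inj; apply: adj_unique => f g.
by rewrite [in LHS]/= ipDl !adjE -ipDr.
Qed.

Lemma bopSZ c T : bopS (c *: T) = c^* *: bopS T.
Proof.
apply: val_inj; apply: adj_unique => f g.
by rewrite [in LHS]/= ipZl adjE; congr ip; exact: (bop_scale (bopS T)).
Qed.

Lemma bopSM T U : bopS (bopM T U) = bopM (bopS U) (bopS T).
Proof. by apply: val_inj; apply: adj_unique => f g; rewrite [in LHS]/= !adjE. Qed.

Lemma bop_normM T U : `|bopM T U| <= `|T| * `|U|.
Proof. by rewrite !bop_normE -rmorphM lecR opnormM. Qed.

Lemma bop_norm_star_mul T : `|bopM (bopS T) T| = `|T| ^+ 2.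
Proof. by rewrite !bop_normE -rmorphXn opnorm_star_mul. Qed.

HB.instance Definition _ := @CompleteNormedModule_isCstarAlg.Build R bop
  bopM bopS bopMA bopMDl bopMDr bopMZl bopMZr bopSK bopSD bopSZ bopSM
  bop_normM bop_norm_star_mul.

End BoundedOperators.

(** * C*-algebras and continuity of star homomorphisms *)

Section CstarAlgebra.
Variables (R : realType) (A : cstarAlgType R).
Implicit Types (a b x y : A) (c e : R[i]).

Lemma cmul0l x : 0 ** x = 0.
Proof. by have := cmulZl 0 (0 : A) x; rewrite !scale0r. Qed.

Lemma cmul0r x : x ** 0 = 0.
Proof. by have := cmulZr 0 x (0 : A); rewrite !scale0r. Qed.

Lemma cmulNl x y : (- x) ** y = - (x ** y).
Proof. by rewrite -scaleN1r cmulZl scaleN1r. Qed.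

Lemma cmulNr x y : x ** (- y) = - (x ** y).
Proof. by rewrite -scaleN1r cmulZr scaleN1r. Qed.

Lemma cmulBl x y z : (x - y) ** z = x ** z - y ** z.
Proof. by rewrite cmulDl cmulNl. Qed.

Lemma cmulBr x y z : x ** (y - z) = x ** y - x ** z.
Proof. by rewrite cmulDr cmulNr. Qed.

Lemma cmul_suml (I : Type) (r : seq I) (D : pred I) (F : I -> A) x :
  (\sum_(i <- r | D i) F i) ** x = \sum_(i <- r | D i) F i ** x.
Proof. by apply: (big_morph (fun y => y ** x)) => [y z|]; rewrite ?cmulDl ?cmul0l. Qed.

Lemma cmul_sumr (I : Type) (r : seq I) (D : pred I) (F : I -> A) x :
  x ** (\sum_(i <- r | D i) F i) = \sum_(i <- r | D i) x ** F i.
Proof. by apply: (big_morph (fun y => x ** y)) => [y z|]; rewrite ?cmulDr ?cmul0r. Qed.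

Lemma cstar0 : (0 : A)^† = 0.
Proof. by have := cstarZ 0 (0 : A); rewrite conjC0 !scale0r. Qed.

Lemma cstarN x : (- x)^† = - x^†.
Proof. by rewrite -scaleN1r cstarZ rmorphN1 scaleN1r. Qed.

Lemma cstarB x y : (x - y)^† = x^† - y^†.
Proof. by rewrite cstarD cstarN. Qed.

Lemma cstar_sum (I : Type) (r : seq I) (D : pred I) (F : I -> A) :
  (\sum_(i <- r | D i) F i)^† = \sum_(i <- r | D i) (F i)^†.
Proof. by apply: (big_morph (@cstar R A)) => [y z|]; rewrite ?cstarD ?cstar0. Qed.

Lemma cstar_mul_eq0 x : x^† ** x = 0 -> x = 0.
Proof.
move=> x0; apply/eqP; rewrite -normr_eq0 -sqrf_eq0 -cnorm_star_mul.
by rewrite x0 normr0.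
Qed.

Lemma norm_cstar_le x : `|x| <= `|x^†|.
Proof.
have [->|x0] := eqVneq x 0; first by rewrite normr0.
by rewrite -(ler_pM2r (_ : 0 < `|x|)) ?normr_gt0 // -expr2 -cnorm_star_mul cnormM_le.
Qed.

Lemma norm_cstar x : `|x^†| = `|x|.
Proof.
apply/eqP; rewrite eq_le norm_cstar_le andbT.
by have := norm_cstar_le x^†; rewrite cstarK.
Qed.

Lemma projection_norm_le1 x : x^† ** x = x -> `|x| <= 1.
Proof.
move=> xx; have [->|x0] := eqVneq x 0; first by rewrite normr0.
by rewrite -(ler_pM2r (_ : 0 < `|x|)) ?normr_gt0 // -expr2 -cnorm_star_mul xx mul1r.
Qed.

Lemma unit_elt_unique x y : is_unit_elt x -> is_unit_elt y -> x = y.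
Proof. by move=> /(_ y)[xy _] /(_ x)[_ yx]; rewrite -xy yx. Qed.

Lemma unit_elt_cstar x : is_unit_elt x -> x^† = x.
Proof.
move=> x1; apply: (unit_elt_unique _ x1) => y.
by split; apply: (can_inj (@cstarK R A)); rewrite cstarM cstarK; have [] := x1 y^†.
Qed.

(** The norm as a real number, so that estimates are inequalities in the ordered field [R]. *)
Definition cnrm x : R := complex.Re `|x|.

Lemma cnrmE x : `|x| = (cnrm x)%:C%C.
Proof. by rewrite /cnrm RRe_real // ger0_real. Qed.

Lemma cnrm_ge0 x : 0 <= cnrm x.
Proof. by rewrite -ler0c -cnrmE. Qed.

Lemma cnrm_eq0 x : cnrm x = 0 -> x = 0.
Proof. by move=> x0; apply/eqP; rewrite -normr_eq0 cnrmE x0. Qed.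

Lemma cnrmD x y : cnrm (x + y) <= cnrm x + cnrm y.
Proof. by rewrite -lecR rmorphD /= -!cnrmE ler_normD. Qed.

Lemma cnrmN x : cnrm (- x) = cnrm x.
Proof. by rewrite /cnrm normrN. Qed.

Lemma cnrmB x y : cnrm (x - y) <= cnrm x + cnrm y.
Proof. by rewrite (le_trans (cnrmD _ _)) // cnrmN. Qed.

Lemma cnrmBC x y : cnrm (x - y) = cnrm (y - x).
Proof. by rewrite -cnrmN opprB. Qed.

Lemma cnrmM x y : cnrm (x ** y) <= cnrm x * cnrm y.
Proof. by rewrite -lecR rmorphM /= -!cnrmE cnormM_le. Qed.

Lemma cnrmZ (r : R) x : 0 <= r -> cnrm (r%:C%C *: x) = r * cnrm x.
Proof.
move=> r0; apply: complexI; rewrite rmorphM /= -!cnrmE normrZ.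
by rewrite (@ger0_norm _ (r%:C%C)) ?ler0c.
Qed.

Lemma cnrm_cstar x : cnrm x^† = cnrm x.
Proof. by rewrite /cnrm norm_cstar. Qed.

Lemma cnrm0 : cnrm 0 = 0. Proof. by rewrite /cnrm normr0. Qed.

Lemma small_cnrm_eq0 x (M : R) :
  (forall r : R, 0 < r -> cnrm x <= r * M) -> 0 <= M -> x = 0.
Proof.
move=> xM M0; apply: cnrm_eq0; apply/eqP; rewrite eq_le cnrm_ge0 andbT.
apply/ler_addgt0Pl => e e0; have M1 : 0 < M + 1 by rewrite ltr_wpDl.
rewrite addr0 (le_trans (xM _ (divr_gt0 e0 M1))) // -mulrA.
apply: ler_piMr; first exact: ltW.
by rewrite ler_pdivrMl // mulr1 lerDl.
Qed.

Lemma approx_closed (B : set A) :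
  (forall x, (forall r : R, 0 < r -> exists2 y, B y & cnrm (x - y) < r) -> B x) -> closed B.
Proof.
move=> BP x clx; apply: BP => r r0.
have [|y [By xy]] := clx (ball x r%:C%C); first by apply: nbhsx_ballx; rewrite ltcR.
by exists y => //; move: xy; rewrite -ball_normE /= cnrmE ltcR.
Qed.

(* The fixed point of [y = (a^2 + y^2) / 2] is [1 - sqrt (1 - a^2)]; it is found
   by iteration, so that no unit is needed. *)
Section SquareRoot.
Variable a : A.
Hypothesis a_small : cnrm a <= 2^-1.
Hypothesis a_selfadj : a^† = a.

Fixpoint sqrt_iter n : A :=
  if n is m.+1 then (2^-1 : R)%:C%C *: (a ** a + sqrt_iter m ** sqrt_iter m) else 0.

Let ha : cnrm (a ** a) <= 4^-1.
Proof. by have := cnrmM a a; have := cnrm_ge0 a; move: a_small; nra. Qed.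

Lemma sqrt_iter_le n : cnrm (sqrt_iter n) <= 4^-1.
Proof.
elim: n => [|n IH] /=; first by rewrite cnrm0.
rewrite cnrmZ //; set y := sqrt_iter n in IH *.
have := cnrmD (a ** a) (y ** y); have := cnrmM y y; have := cnrm_ge0 y.
move: ha IH; nra.
Qed.

(** On the ball of radius $1/4$ the iteration contracts by $1/4$: $y^2 - z^2 = y(y - z) + (y - z)z$
    has norm at most $(1/4 + 1/4)\|y - z\|$, and this is halved. *)
Lemma sqrt_iter_step n : cnrm (sqrt_iter n.+1 - sqrt_iter n) <= 4^-1 ^+ n.+1.
Proof.
elim: n => [|n IH].
  rewrite /= cmul0l addr0 subr0 cnrmZ // expr1; move: ha; have := cnrm_ge0 (a ** a); lra.
have -> : sqrt_iter n.+2 - sqrt_iter n.+1 = (2^-1 : R)%:C%C *: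
    (sqrt_iter n.+1 ** (sqrt_iter n.+1 - sqrt_iter n) +
     (sqrt_iter n.+1 - sqrt_iter n) ** sqrt_iter n).
  rewrite cmulBl cmulBr addrA subrK.
  rewrite [in LHS]/= -/(sqrt_iter n.+1) -scalerBr.
  by rewrite [sqrt_iter n.+1]lock /= opprD addrACA subrr add0r.
rewrite cnrmZ // exprS; set d := _ - _ in IH *.
have := sqrt_iter_le n.+1; have := sqrt_iter_le n.
set y := sqrt_iter n.+1; set z := sqrt_iter n => le1 le2.
have := cnrmD (y ** d) (d ** z); have := cnrmM y d; have := cnrmM d z.
have := cnrm_ge0 d; have := cnrm_ge0 y; have := cnrm_ge0 z; move: IH le1 le2; nra.
Qed.

Lemma sqrt_iter_dist n m :
  cnrm (sqrt_iter (n + m) - sqrt_iter n) <= 4^-1 ^+ n - 4^-1 ^+ (n + m).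
Proof.
elim: m => [|m IH]; first by rewrite addn0 !subrr cnrm0.
have := sqrt_iter_step (n + m); rewrite addnS.
have := cnrmD (sqrt_iter (n + m).+1 - sqrt_iter (n + m)) (sqrt_iter (n + m) - sqrt_iter n).
rewrite addrA subrK exprS; have : (0 : R) <= 4^-1 ^+ (n + m) by rewrite exprn_ge0.
move: IH; lra.
Qed.

Lemma quarter_pow_small (r : R) : 0 < r -> exists n, 4^-1 ^+ n < r.
Proof.
move=> r0.
have cv : (4^-1 : R) ^+ n @[n --> \oo] --> (0 : R) by apply: cvg_expr; rewrite ger0_norm //; lra.
have /cvgrPdist_lt/(_ r r0)[N _ HN] := cv.
by exists N; have /= := HN N (leqnn N); rewrite sub0r normrN ger0_norm ?exprn_ge0.
Qed.

Lemma sqrt_iter_cvg : exists y, forall n, cnrm (y - sqrt_iter n) <= 2 * 4^-1 ^+ n.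
Proof.
have cau : cauchy (sqrt_iter @ \oo).
  apply/cauchyP => e e0.
  have [r r0 ->] : exists2 r : R, 0 < r & e = r%:C%C.
    have e1 : (complex.Re e)%:C%C = e by apply: RRe_real; exact: gtr0_real.
    by exists (complex.Re e); rewrite -?ltcR e1.
  have [N HN] := quarter_pow_small r0.
  exists (sqrt_iter N); exists N => // n /= Nn.
  rewrite -ball_normE /= cnrmE ltcR cnrmBC -(subnKC Nn).
  apply: le_lt_trans HN; rewrite (le_trans (sqrt_iter_dist _ _)) //.
  by rewrite gerBl exprn_ge0.
have cvy : cvg (sqrt_iter @ \oo) by apply: cauchy_cvg.
set y := lim (sqrt_iter @ \oo) in cvy; exists y => n.
have p0 : 0 < 4^-1 ^+ n :> R by rewrite exprn_gt0.
have /cvg_ballP/(_ (4^-1 ^+ n)%:C%C) := cvy; rewrite ltcR => /(_ p0)[N _ HN].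
have := HN (n + N)%N (leq_addl _ _); rewrite -ball_normE /= cnrmE ltcR => lt1.
have := cnrmD (y - sqrt_iter (n + N)) (sqrt_iter (n + N) - sqrt_iter n).
rewrite addrA subrK; have := sqrt_iter_dist n N.
have : (0 : R) <= 4^-1 ^+ (n + N) by rewrite exprn_ge0.
move: lt1; lra.
Qed.

Lemma sqrt_iter_comm n : a ** sqrt_iter n = sqrt_iter n ** a.
Proof.
elim: n => [|n IH] /=; first by rewrite cmul0r cmul0l.
by rewrite cmulZr cmulZl cmulDl cmulDr !cmulA IH -!cmulA IH.
Qed.

Lemma sqrt_iter_selfadj n : (sqrt_iter n)^† = sqrt_iter n.
Proof.
elim: n => [|n IH] /=; first exact: cstar0.
rewrite cstarZ cstarD !cstarM IH a_selfadj; congr (_ *: _); exact: conjc_real.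
Qed.

Lemma sqrt_fixpoint : exists y,
  [/\ y^† = y, a ** y = y ** a & y + y = a ** a + y ** y].
Proof.
have [y yP] := sqrt_iter_cvg; exists y.
have close (r : R) : 0 < r -> exists n, cnrm (y - sqrt_iter n) <= r /\
    cnrm (y - sqrt_iter n.+1) <= r.
  move=> r0; have [n rn] := quarter_pow_small (divr_gt0 r0 (ltr0Sn R 1)).
  exists n; have := yP n; have := yP n.+1; rewrite exprS.
  have : (0 : R) <= 4^-1 ^+ n by rewrite exprn_ge0.
  by move: rn => *; split; lra.
split.
- apply/eqP; rewrite -subr_eq0; apply/eqP/(@small_cnrm_eq0 _ 2) => // r r0.
  have [n [yn _]] := close r r0.
  have -> : y^† - y = (y - sqrt_iter n)^† - (y - sqrt_iter n).
    by rewrite cstarB sqrt_iter_selfadj opprB addrA subrK.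
  have := cnrmB (y - sqrt_iter n)^† (y - sqrt_iter n); rewrite cnrm_cstar; lra.
- apply/eqP; rewrite -subr_eq0; apply/eqP/(@small_cnrm_eq0 _ 1) => // r r0.
  have [n [yn _]] := close r r0.
  have -> : a ** y - y ** a = a ** (y - sqrt_iter n) - (y - sqrt_iter n) ** a.
    by rewrite cmulBr cmulBl sqrt_iter_comm opprB addrA subrK.
  have := cnrmB (a ** (y - sqrt_iter n)) ((y - sqrt_iter n) ** a).
  have := cnrmM a (y - sqrt_iter n); have := cnrmM (y - sqrt_iter n) a.
  have := cnrm_ge0 (y - sqrt_iter n); have := cnrm_ge0 a; move: a_small yn; nra.
- apply/eqP; rewrite -subr_eq0; apply/eqP/(@small_cnrm_eq0 _ (2 + cnrm y + 1)); last first.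
    by have := cnrm_ge0 y; lra.
  move=> r r0; have [n [yn yn1]] := close r r0.
  have E : sqrt_iter n.+1 + sqrt_iter n.+1 = a ** a + sqrt_iter n ** sqrt_iter n.
    rewrite [sqrt_iter n.+1]/= -scalerDl -rmorphD.
    by rewrite (_ : 2^-1 + 2^-1 = 1 :> R) ?scale1r //; field.
  have -> : y + y - (a ** a + y ** y) =
      ((y - sqrt_iter n.+1) + (y - sqrt_iter n.+1)) -
      (y ** (y - sqrt_iter n) + (y - sqrt_iter n) ** sqrt_iter n).
    have -> : y ** (y - sqrt_iter n) + (y - sqrt_iter n) ** sqrt_iter n =
        - (sqrt_iter n ** sqrt_iter n) + y ** y.
      by rewrite cmulBr cmulBl addrA subrK addrC.
    by rewrite addrACA -opprD E -[RHS]addrA -opprD addrA addrK.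
  set d := y - sqrt_iter n.+1 in yn1 *; set d' := y - sqrt_iter n in yn *.
  have := cnrmB (d + d) (y ** d' + d' ** sqrt_iter n).
  have := cnrmD d d; have := cnrmD (y ** d') (d' ** sqrt_iter n).
  have := cnrmM y d'; have := cnrmM d' (sqrt_iter n); have := sqrt_iter_le n.
  have := cnrm_ge0 d'; have := cnrm_ge0 d; have := cnrm_ge0 y.
  have := cnrm_ge0 (sqrt_iter n); move: yn yn1 r0; nra.
Qed.
End SquareRoot.
End CstarAlgebra.

Section StarHoms.
Variable R : realType.

Section Basics.
Variables (A B : cstarAlgType R) (phi : A -> B).
Hypothesis phi_hom : is_star_hom phi.

Lemma star_homM x y : phi (x ** y) = phi x ** phi y. Proof. by have [_ ->] := phi_hom. Qed.
Lemma star_homS x : phi x^† = (phi x)^†. Proof. by have [_ _ ->] := phi_hom. Qed.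
Lemma star_hom_linear : linear phi. Proof. by have [] := phi_hom. Qed.
Lemma star_homD x y : phi (x + y) = phi x + phi y.
Proof. by have := star_hom_linear 1 x y; rewrite !scale1r. Qed.
Lemma star_hom0 : phi 0 = 0.
Proof.
by have := star_homD 0 0; rewrite addr0 => /eqP; rewrite -subr_eq0 opprD addrA subrr sub0r oppr_eq0 => /eqP.
Qed.
Lemma star_homZ c x : phi (c *: x) = c *: phi x.
Proof. by have := star_hom_linear c x 0; rewrite star_hom0 !addr0. Qed.
Lemma star_homN x : phi (- x) = - phi x.
Proof. by rewrite -scaleN1r star_homZ scaleN1r. Qed.
Lemma star_homB x y : phi (x - y) = phi x - phi y.
Proof. by rewrite star_homD star_homN. Qed.
Lemma star_hom_sum (I : Type) (r : seq I) (D : pred I) (F : I -> A) :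
  phi (\sum_(i <- r | D i) F i) = \sum_(i <- r | D i) phi (F i).
Proof. by apply: (big_morph phi) => [x y|]; rewrite ?star_homD ?star_hom0. Qed.

Variable one : A.
Hypothesis one_unit : is_unit_elt one.

(** [phi] may fail to be unital, but [phi one] is a projection and so has norm at most 1, and
    $\|\phi(u)\|^2 = \|\phi(u^* u)\|$. *)
Lemma star_hom_unitary_le u : u^† ** u = one -> cnrm (phi u) <= 1.
Proof.
move=> uu; have := projection_norm_le1 (x := phi one).
rewrite -star_homS -star_homM unit_elt_cstar // (one_unit one).1 => /(_ erefl).
rewrite -uu star_homM star_homS cnorm_star_mul cnrmE -rmorphXn /= -[1]/(1%:C%C) lecR.
by have := cnrm_ge0 (phi u); nra.
Qed.

(* [a] is the real part of the unitary [a + i sqrt(1 - a^2)], and unitaries are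
   mapped to partial isometries. *)
Lemma star_hom_selfadj_le a : a^† = a -> cnrm a <= 2^-1 -> cnrm (phi a) <= 1.
Proof.
move=> aa a_small; have [y [yy ay yE]] := sqrt_fixpoint a_small aa.
pose c := one - y; pose j : R[i] := Complex 0 1.
have onel x : one ** x = x by have [] := one_unit x.
have oner x : x ** one = x by have [] := one_unit x.
have jj : j * j = -1.
  by apply/eqP; rewrite eq_complex /= !mul0r !mulr0 mulr1 sub0r addr0 oppr0 !eqxx.
have js : j^* = - j by apply/eqP; rewrite eq_complex /= oppr0 !eqxx.
have cc : c^† = c by rewrite cstarB yy unit_elt_cstar.
have ac : a ** c = c ** a by rewrite cmulBl cmulBr onel oner ay.
have sq : a ** a + c ** c = one.
  have -> : c ** c = one - (y + y) + y ** y.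
    by rewrite /c cmulBl !cmulBr !onel oner opprB addrA opprD addrA addrAC.
  by rewrite yE opprD !addrA subrK addrAC subrr add0r.
pose u := a + j *: c; pose v := a - j *: c.
have us : u^† = v by rewrite cstarD cstarZ cc aa js scaleNr.
have vs : v^† = u by rewrite -us cstarK.
have vu : v ** u = one.
  rewrite /v /u cmulBl !cmulDr !cmulZr !cmulZl scalerA jj scaleN1r ac.
  by rewrite opprD opprK addrA addrK.
have uv : u ** v = one.
  rewrite /v /u cmulDl !cmulBr !cmulZr !cmulZl scalerA jj scaleN1r opprK ac.
  by rewrite addrA subrK.
have u1 : cnrm (phi u) <= 1 by apply: star_hom_unitary_le; rewrite us.
have v1 : cnrm (phi v) <= 1 by apply: star_hom_unitary_le; rewrite vs.
have -> : phi a = (2^-1 : R)%:C%C *: (phi u + phi v).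
  rewrite -star_homD /u /v addrACA subrr addr0 -star_homZ -mulr2n -(scaler_nat 2 a) scalerA.
  rewrite (_ : _ * _ = 1) ?scale1r // -(rmorph_nat (real_complex R)) -rmorphM /=.
  by rewrite mulVf // pnatr_eq0.
rewrite cnrmZ //; have := cnrmD (phi u) (phi v); lra.
Qed.

Lemma star_hom_selfadj_lip a : a^† = a -> cnrm (phi a) <= 2 * cnrm a.
Proof.
move=> aa; have [a0|a0] := eqVneq (cnrm a) 0.
  by rewrite (cnrm_eq0 a0) star_hom0 !cnrm0 mulr0.
have a_gt0 : 0 < cnrm a by rewrite lt_neqAle eq_sym a0 cnrm_ge0.
pose r := (2 * cnrm a)^-1; have r_ge0 : 0 <= r by rewrite invr_ge0 mulr_ge0 // ltW.
have : cnrm (phi (r%:C%C *: a)) <= 1.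
  apply: star_hom_selfadj_le; last by rewrite cnrmZ // /r invfM -mulrA mulVf // mulr1.
  by rewrite cstarZ aa; congr (_ *: _); exact: conjc_real.
rewrite star_homZ cnrmZ // /r mulrC ler_pdivrMr ?mul1r //.
by rewrite mulr_gt0.
Qed.

(** The real and the imaginary part of [x] have norm at most that of [x], and each contributes the
    factor 2 of the self-adjoint case. *)
Lemma star_hom_lip x : cnrm (phi x) <= 4 * cnrm x.
Proof.
pose j : R[i] := Complex 0 1; pose h : R[i] := (2^-1 : R)%:C%C.
have hs : h^* = h by exact: conjc_real.
have js : j^* = - j by apply/eqP; rewrite eq_complex /= oppr0 !eqxx.
have jj : j * j = -1.
  by apply/eqP; rewrite eq_complex /= !mul0r !mulr0 mulr1 sub0r addr0 oppr0 !eqxx.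
have jn (B' : cstarAlgType R) (z : B') : cnrm (j *: z) = cnrm z.
  apply: complexI; rewrite -!cnrmE normrZ normc_def /= expr0n expr1n add0r sqrtr1.
  by rewrite mul1r.
have hn (B' : cstarAlgType R) (z : B') : cnrm (h *: z) = 2^-1 * cnrm z by rewrite cnrmZ.
pose a := h *: (x + x^†); pose b := h *: (j *: (x^† - x)).
have aa : a^† = a by rewrite cstarZ hs cstarD cstarK addrC.
have bb : b^† = b.
  by rewrite !cstarZ hs js cstarB cstarK scaleNr -scalerN opprB.
have xE : x = a + j *: b.
  rewrite /a /b scalerA mulrC -scalerA (scalerA j) jj scaleN1r opprB -scalerDr.
  rewrite addrACA subrr addr0 -mulr2n -(scaler_nat 2 x) scalerA (_ : _ * _ = 1) ?scale1r //.
  by rewrite -(rmorph_nat (real_complex R)) -rmorphM /= mulVf // pnatr_eq0.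
rewrite {1}xE star_homD (star_homZ j b).
have := cnrmD (phi a) (j *: phi b); rewrite jn.
have := star_hom_selfadj_lip aa; have := star_hom_selfadj_lip bb.
have na : cnrm a = 2^-1 * cnrm (x + x^†) by rewrite hn.
have nb : cnrm b = 2^-1 * cnrm (x^† - x) by rewrite hn jn.
have := cnrmD x x^†; have := cnrmB x^† x; rewrite cnrm_cstar na nb; lra.
Qed.
End Basics.

Lemma star_hom_comp (A B C : cstarAlgType R) (f : A -> B) (g : B -> C) :
  is_star_hom f -> is_star_hom g -> is_star_hom (g \o f).
Proof.
move=> fh gh; split=> [c x y|x y|x] /=.
- by rewrite (star_hom_linear fh) (star_hom_linear gh).
- by rewrite (star_homM fh) (star_homM gh).
- by rewrite (star_homS fh) (star_homS gh).
Qed.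

Lemma star_hom_equalizer_closed (A B : cstarAlgType R) (one : A) (f g : A -> B) :
  is_unit_elt one -> is_star_hom f -> is_star_hom g ->
  is_closed_star_subalg [set x | f x = g x].
Proof.
move=> u fh gh; split=> /=.
- apply: approx_closed => x xP; apply/eqP; rewrite -subr_eq0; apply/eqP.
  apply: (@small_cnrm_eq0 _ _ _ 8) => // r r0; have [y /= fg xy] := xP r r0.
  have -> : f x - g x = f (x - y) - g (x - y).
    by rewrite (star_homB fh) (star_homB gh) fg opprB addrA subrK.
  have := cnrmB (f (x - y)) (g (x - y)).
  by have := star_hom_lip fh u (x - y); have := star_hom_lip gh u (x - y); lra.
- by rewrite (star_hom0 fh) (star_hom0 gh).
- by move=> c x y xE yE; rewrite (star_hom_linear fh) (star_hom_linear gh) xE yE.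
- by move=> x y xE yE; rewrite (star_homM fh) (star_homM gh) xE yE.
- by move=> x xE; rewrite (star_homS fh) (star_homS gh) xE.
Qed.

End StarHoms.

(** * Permutation graphs as transducers *)

Lemma drop_catl (T : Type) n (s t : seq T) : (n <= size s)%N ->
  drop n (s ++ t) = drop n s ++ t.
Proof.
by move=> ns; rewrite -{1}(cat_take_drop n s) -catA drop_size_cat // size_takel.
Qed.

Section Walks.
Variable E : digraph.
Implicit Types (v : vert E) (w z : seq (edge E)).

Definition walk_end v w : vert E := last v (map (@rng E) w).

Lemma walk_cat v w z : walk v (w ++ z) = walk v w && walk (walk_end v w) z.
Proof. by elim: w v => [|e w IH] v //=; rewrite IH andbA. Qed.

Lemma walk_end_cat v w z : walk_end v (w ++ z) = walk_end (walk_end v w) z.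
Proof. by rewrite /walk_end map_cat last_cat. Qed.

Lemma walk_end_size v v' w : (0 < size w)%N -> walk_end v w = walk_end v' w.
Proof. by case: w. Qed.

Lemma walk_start v v' w : (0 < size w)%N -> walk v w -> walk v' w -> v = v'.
Proof. by case: w => //= e w _ /andP[/eqP <- _] /andP[/eqP <-]. Qed.

Lemma walk_extension (E_sinks : no_sinks E) v n : exists2 w, walk v w & size w = n.
Proof.
elim: n v => [|n IH] v; first by exists [::].
have [e ev] := E_sinks v; have [w wn wS] := IH (rng e).
by exists (e :: w); rewrite /= ?ev ?eqxx ?wS.
Qed.

Lemma walk_gpath v w n : walk v w -> size w = n ->
  {x : gpath E n | psrc x = v & tval (pedges x) = w}.
Proof. by move=> wv /eqP wn; exists (exist _ (v, Tuple wn) wv). Qed.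

Lemma gpath_walk n (x : gpath E n) : walk (psrc x) (pedges x).
Proof. exact: (valP x). Qed.

Lemma gpath_eqP n (x y : gpath E n) :
  psrc x = psrc y -> tval (pedges x) = tval (pedges y) -> x = y.
Proof.
by move=> xy1 xy2; apply: val_inj; apply: injective_projections => //; apply: val_inj.
Qed.

Lemma gpath_pedges_inj n (x y : gpath E n.+1) :
  tval (pedges x) = tval (pedges y) -> x = y.
Proof.
move=> xy; apply: gpath_eqP => //; have := gpath_walk y; rewrite -xy => wy.
by apply: walk_start (gpath_walk x) wy; rewrite size_tuple.
Qed.

Lemma prngE n (x : gpath E n) : prng x = walk_end (psrc x) (pedges x).
Proof. by []. Qed.

End Walks.

Section PrefixAction.
Variables (E : digraph) (k : nat).
Implicit Types (v : vert E) (w z : seq (edge E)) (tau : {perm gpath E k.+1}).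

(** A word that is too short, or whose first $k + 1$ letters do not form a path, is left unchanged;
    the function is thus total and always preserves the length. *)
Definition prefix_act tau w : seq (edge E) :=
  if [pick x : gpath E k.+1 | tval (pedges x) == take k.+1 w] is Some x
  then pedges (tau x) ++ drop k.+1 w else w.

Lemma prefix_act_gpath tau (x : gpath E k.+1) z :
  prefix_act tau (pedges x ++ z) = pedges (tau x) ++ z.
Proof.
rewrite /prefix_act; case: pickP => [y|/(_ x)];
  rewrite take_size_cat ?size_tuple // ?eqxx // => /eqP /gpath_pedges_inj ->.
by rewrite drop_size_cat // size_tuple.
Qed.

Lemma walk_split v w : walk v w -> (k < size w)%N ->
  exists2 x : gpath E k.+1, psrc x = v & w = pedges x ++ drop k.+1 w.
Proof.
move=> wv kw; move: wv; rewrite -{1}(cat_take_drop k.+1 w) walk_cat => /andP[w1 w2].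
have [|x xv xE] := walk_gpath (n := k.+1) w1; first by rewrite size_take_min; apply/minn_idPl.
by exists x => //; rewrite xE cat_take_drop.
Qed.

Lemma prefix_act_size tau w : size (prefix_act tau w) = size w.
Proof.
rewrite /prefix_act; case: pickP => [x /eqP xw|//].
by rewrite size_cat size_tuple -{2}(cat_take_drop k.+1 w) size_cat -xw size_tuple.
Qed.

Lemma prefix_act_cat tau w z : (k < size w)%N ->
  prefix_act tau (w ++ z) = prefix_act tau w ++ z.
Proof.
move=> kw; rewrite /prefix_act takel_cat // drop_catl //.
by case: pickP => // x _; rewrite catA.
Qed.

Lemma prefix_actK tau v w : walk v w -> (k < size w)%N ->
  prefix_act tau^-1 (prefix_act tau w) = w.
Proof.
move=> wv /(walk_split wv)[x _ ->].
by rewrite !prefix_act_gpath permK.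
Qed.

Lemma endpoint_fixingV tau : endpoint_fixing tau -> endpoint_fixing tau^-1%g.
Proof.
move=> fx u v; apply/setP => x; apply/imsetP/idP => [[y yuv ->]|xuv].
  by move: yuv; rewrite -{1}(fx u v) => /imsetP[z zuv ->]; rewrite permK.
exists (tau x); last by rewrite permK.
by rewrite -(fx u v); apply: imset_f.
Qed.

Lemma prefix_actKV tau v w : walk v w -> (k < size w)%N ->
  prefix_act tau (prefix_act tau^-1 w) = w.
Proof. by move=> wv kw; have := @prefix_actK tau^-1%g v w wv kw; rewrite invgK. Qed.

Lemma prefix_act_walk tau v w : endpoint_fixing tau -> walk v w -> (k < size w)%N ->
  walk v (prefix_act tau w) /\ walk_end v (prefix_act tau w) = walk_end v w.
Proof.
move=> fx wv kw; have [x xv wE] := walk_split wv kw.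
rewrite wE prefix_act_gpath walk_cat !walk_end_cat.
have [xs xr] := endpoint_fixingP fx x.
have xe : walk_end v (pedges (tau x)) = walk_end v (pedges x).
  by rewrite -xv -[RHS]prngE -{1}xs -prngE xr.
rewrite xe; split=> //; move: wv; rewrite {1}wE walk_cat => /andP[_ ->]; rewrite andbT.
by rewrite -xv -xs gpath_walk.
Qed.

Lemma prefix_act_drop tau w : drop k.+1 (prefix_act tau w) = drop k.+1 w.
Proof.
by rewrite /prefix_act; case: pickP => // x _; rewrite drop_size_cat // size_tuple.
Qed.

Lemma prefix_act_inj tau v v' w w' : walk v w -> walk v' w' -> (k < size w)%N ->
  prefix_act tau w = prefix_act tau w' -> w = w'.
Proof.
move=> wv wv' kw ww'; have kw' : (k < size w')%N.
  by rewrite -(prefix_act_size tau) -ww' prefix_act_size.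
by rewrite -(prefix_actK tau wv kw) ww' (prefix_actK tau wv' kw').
Qed.

(* The path of the permutation graph with first label [a] and range [b] has source [b'] and
   second label [a'] given by [b' ++ a' = sweep tau (size a) (a ++ b)]. *)
Fixpoint sweep tau n w : seq (edge E) :=
  if n is m.+1 then if w is e :: w' then prefix_act tau (e :: sweep tau m w') else w else w.

Lemma sweep_size tau n w : size (sweep tau n w) = size w.
Proof. by elim: n w => [|n IH] [|e w] //=; rewrite prefix_act_size /= IH. Qed.

Lemma sweep_walk tau n v w : endpoint_fixing tau -> walk v w -> (n + k <= size w)%N ->
  walk v (sweep tau n w) /\ walk_end v (sweep tau n w) = walk_end v w.
Proof.
move=> fx; elim: n v w => [|n IH] v [|e w] //= /andP[/eqP ev wv] nw.
have [w1 w2] := IH _ _ wv nw.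
have := @prefix_act_walk tau v (e :: sweep tau n w) fx.
rewrite /= ev eqxx w1 sweep_size => /(_ isT) [|-> ->]; first by rewrite ltnS (leq_trans (leq_addl n k)).
by split => //; rewrite /walk_end /= -/(walk_end _ _) w2.
Qed.

Lemma sweep_cat tau n w z : (n + k <= size w)%N -> sweep tau n (w ++ z) = sweep tau n w ++ z.
Proof.
elim: n w => [|n IH] [|e w] //= nw; rewrite IH // -cat_cons prefix_act_cat //=.
by rewrite sweep_size ltnS (leq_trans (leq_addl n k)).
Qed.

Lemma sweep_add tau a m w : sweep tau (size a + m) (a ++ w) = sweep tau (size a) (a ++ sweep tau m w).
Proof. by elim: a => [|e a IH] //=; rewrite IH. Qed.

Lemma sweep_inj tau n v v' w w' : endpoint_fixing tau -> walk v w -> walk v' w' ->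
  (n + k <= size w)%N -> sweep tau n w = sweep tau n w' -> w = w'.
Proof.
move=> fx; elim: n v v' w w' => [|n IH] v v' [|e w] w' //=; case: w' => [|e' w'] //=.
  by move=> _ _ _ /(congr1 size); rewrite prefix_act_size.
move=> /andP[ev wv] /andP[ev' wv'] nw ww'.
have sw : (n + k <= size w')%N.
  by have /eqP := congr1 size ww'; rewrite !prefix_act_size /= !sweep_size eqSS => /eqP <-.
have [w1 _] := sweep_walk fx wv nw; have [w2 _] := sweep_walk fx wv' sw.
have kw : (k < size (e :: sweep tau n w))%N by rewrite /= sweep_size ltnS (leq_trans (leq_addl n k)).
have [-> ] : e :: sweep tau n w = e' :: sweep tau n w'.
  by apply: (prefix_act_inj (v := v) (v' := v') _ _ kw ww'); rewrite /= ?ev ?ev' ?w1 ?w2.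
by move=> /(IH _ _ _ _ wv wv' nw) ->.
Qed.

(** The first position is where [sweep] acts last, so it is undone by applying $\tau^{-1}$ there and
    then recursing on the tail. *)
Lemma sweep_surj tau n v w : endpoint_fixing tau -> walk v w -> (n + k <= size w)%N ->
  exists z, [/\ walk v z, size z = size w & sweep tau n z = w].
Proof.
move=> fx; elim: n v w => [|n IH] v w wv nw; first by exists w.
have kw : (k < size w)%N by apply: leq_trans nw; rewrite addSn ltnS leq_addl.
have [w1 _] := prefix_act_walk (endpoint_fixingV fx) wv kw.
have w2 := prefix_act_size tau^-1%g w; have w3 := prefix_actKV tau wv kw.
case: (prefix_act tau^-1 w) w1 w2 w3 => [|e y] /= w1 w2 w3.
  by move: nw; rewrite -w2 ltn0.
have /andP[ev yv] := w1; have [|z [zv zs zE]] := IH _ _ yv; first by rewrite -ltnS -addSn w2.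
by exists (e :: z); split; rewrite /= ?ev ?zE // zs.
Qed.

End PrefixAction.

(** * Paths of the permutation graph as words *)

Section Dictionary.
Variables (E : digraph) (k : nat) (tau : {perm gpath E k.+1}).
Hypothesis tau_fix : endpoint_fixing tau.
Let G := perm_graph tau.
Notation vx := (vert G).

Lemma edge_cons (x : gpath E k.+1) : tval (pedges x) = first_edge x :: pedges (gsuffix x).
Proof. exact: (congr1 val (tuple_eta (pedges x))). Qed.

Lemma edge_rcons (x : gpath E k.+1) : tval (pedges x) = pedges (gprefix x) ++ [:: last_edge x].
Proof.
rewrite /= /prefix_edges /last_edge; case/tupleP: (pedges x) => e t /=.
rewrite theadE cats1 (tnth_nth e) /=.
have <- : last e t = nth e (e :: t) k by rewrite (last_nth e) size_tuple.
by rewrite -lastI.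
Qed.

(** An edge from $\beta$ to $\alpha$ labelled $[e, f]$ is the equation $\tau(e\alpha) = \beta f$.
    Chained along a path, starting at its range, these equations are the successive steps of
    [sweep]. *)
Lemma perm_graph_walk_sweep (v : vx) (g : seq (edge G)) : walk v g ->
  walk (psrc (v : gpath E k)) (map (@label1 _ _ tau) g ++ pedges (walk_end v g : gpath E k)) /\
  sweep tau (size g) (map (@label1 _ _ tau) g ++ pedges (walk_end v g : gpath E k)) =
  pedges (v : gpath E k) ++ map (@label2 _ _ tau) g.
Proof.
elim: g v => [|x g IH] v /=; first by rewrite cats0 gpath_walk.
move=> /andP[/eqP <- gw]; have [w1 w2] := IH _ gw.
have [xs xr] := endpoint_fixingP tau_fix x.
have E1 : psrc (src x : gpath E k) = src (label1 x) by exact: perm_textile_p_src.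
rewrite E1 eqxx /=; split; first exact: w1.
rewrite /walk_end /= -/(walk_end _ _) w2 -cat_cons -[_ :: _]/(first_edge (x : gpath E k.+1) :: pedges (gsuffix (x : gpath E k.+1))) -edge_cons.
by rewrite prefix_act_gpath {1}edge_rcons -catA.
Qed.

(** The edge with range [w] and first label [e] is the path [e w], so a path with prescribed first
    label is built backwards from its range. That [a] ends at the source of [u] is a separate
    hypothesis because for $k = 0$ the word of [u] is empty and does not determine its vertex. *)
Lemma perm_graph_walk_lift (u : vx) (a : seq (edge E)) (v : vert E) :
  walk v (a ++ pedges (u : gpath E k)) -> walk_end v a = psrc (u : gpath E k) ->
  exists (w : vx) (g : seq (edge G)),
    [/\ walk w g, walk_end w g = u & map (@label1 _ _ tau) g = a].
Proof.
elim: a v => [|e a IH] v /=; first by move=> _ _; exists u, [::].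
move=> /andP[ev aw] ae; have [w [g [g1 g2 g3]]] := IH _ aw ae.
have [w1 _] := perm_graph_walk_sweep g1.
have rw : rng e = psrc (w : gpath E k).
  case: g g1 g2 g3 w1 => [|x g] g1 g2 g3 w1.
    by have <- : u = w := esym g2; rewrite -ae -g3.
  move: aw; rewrite -g3 /= => /andP[/eqP <- _].
  by move: w1 => /= /andP[/eqP ->].
have wv : walk v (e :: pedges (w : gpath E k)).
  by rewrite /= ev rw gpath_walk.
have [|x xv xE] := walk_gpath (n := k.+1) wv; first by rewrite /= size_tuple.
have [x1 x2] : first_edge x = e /\ tval (pedges (gsuffix x)) = pedges (w : gpath E k).
  by move: xE; rewrite edge_cons => -[].
have xw : gsuffix x = w by apply: gpath_eqP x2; rewrite -rw -x1.
exists (src (x : edge G)), (x :: g); split.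
- by rewrite /= eqxx /= xw.
- by rewrite /walk_end /= xw.
- by rewrite /= g3; congr cons; exact: x1.
Qed.
End Dictionary.

(** * Synchronization and injectivity of the textile system *)

Section BiinfinitePairs.
Variables (G : digraph) (T : Type) (L : edge G -> T).
Implicit Types (u v : vert G) (p q : seq (edge G)).

Lemma periodic_edge_shift u e p : walk u (e :: p) -> walk_end u (e :: p) = u ->
  edge_shift G (fun t : int => nth e (e :: p) `|(t %% (size p).+1)%Z|%N).
Proof.
set c := e :: p => cw ce t /=.
have rP : (0 <= (t %% (size p).+1)%Z)%R by apply: modz_ge0.
have rlt : ((t %% (size p).+1)%Z < (size p).+1)%R by apply: ltz_pmod.
rewrite -modzDml; move: rP rlt; case: (t %% _)%Z => // r _; rewrite ltz_nat => rn.
have step q w f j : walk w q -> (j.+1 < size q)%N -> rng (nth f q j) = src (nth f q j.+1).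
  elim: q w j => [|g q IH] w j //= /andP[_ qw].
  case: j => [|j] //= jq; last exact: IH qw jq.
  by case: q qw {IH} jq => //= g' q /andP[/eqP].
case: (ltnP r.+1 (size p).+1) => rn1.
  rewrite modz_small; last by rewrite -PoszD ltz_nat addn1 rn1 andbT.
  by rewrite -PoszD addn1 /=; apply: (step c u).
have {rn1} -> : r = size p by apply/eqP; rewrite eqn_leq -ltnS rn -ltnS rn1.
rewrite -PoszD addn1 modzz /= -(last_nth e).
move: ce; rewrite /walk_end /= last_map => ->.
by have /andP[/eqP] := cw.
Qed.

Lemma periodic_pair u u' p p' : u != u' -> (0 < size p)%N ->
  walk u p -> walk u' p' -> walk_end u p = u -> walk_end u' p' = u' ->
  map L p = map L p' ->
  exists x y, [/\ edge_shift G x, edge_shift G y, L \o x = L \o y & x <> y].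
Proof.
case: p p' => [|e p] [|e' p'] // uu' _ pw pw' pe pe' Lpp'.
have sz : size p = size p' by have := congr1 size Lpp'; rewrite /= !size_map => -[].
exists (fun t : int => nth e (e :: p) `|(t %% (size p).+1)%Z|%N).
exists (fun t : int => nth e' (e' :: p') `|(t %% (size p').+1)%Z|%N).
split; try exact: periodic_edge_shift pw pe; try exact: periodic_edge_shift pw' pe'.
  apply/funext => t /=; rewrite -sz; set j := `|_|%N.
  have jlt : (j < (size p).+1)%N.
    by rewrite -ltz_nat /j gez0_abs ?modz_ge0 // ltz_pmod.
  by rewrite -!(nth_map _ (L e)) /= -?sz // [_ :: _]Lpp'.
move=> /(congr1 (@^~ (0 : int))); rewrite !mod0z /= => ee'.
by move: pw pw' uu' => /= /andP[/eqP <- _] /andP[/eqP <- _]; rewrite ee' eqxx.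
Qed.

Lemma distinct_walks_pair v v' p p' :
  (#|vert G| ^ 2 <= size p)%N -> walk v p -> walk v' p' -> map L p = map L p' ->
  (forall i, (i <= size p)%N -> walk_end v (take i p) != walk_end v' (take i p')) ->
  exists x y, [/\ edge_shift G x, edge_shift G y, L \o x = L \o y & x <> y].
Proof.
move=> sp pw pw' Lpp' dif.
have sz : size p = size p' by have := congr1 size Lpp'; rewrite !size_map.
pose f (i : 'I_(size p).+1) := (walk_end v (take i p), walk_end v' (take i p')).
(* There are [size p + 1] times but only [#|vert G| ^ 2] pairs of vertices. *)
have [i [j [ij fij]]] : exists i j : 'I_(size p).+1, (i < j)%N /\ f i = f j.
  have /injectivePn[i [j ij fij]] : ~~ injectiveb f.
    apply/negP => /injectiveP f_inj; have := leq_card f f_inj.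
    by rewrite card_ord card_prod mulnn ltnNge sp.
  case: (ltngtP i j) => [lt|lt|/val_inj e]; first by exists i, j.
    by exists j, i.
  by rewrite e eqxx in ij.
have split_at (w : vert G) q : size q = size p -> walk w q ->
    walk (walk_end w (take i q)) (take (j - i) (drop i q)) /\
    walk_end (walk_end w (take i q)) (take (j - i) (drop i q)) = walk_end w (take j q).
  move=> sq qw; have tk : take j q = take i q ++ take (j - i) (drop i q).
    by rewrite -takeD subnKC // ltnW.
  split; last by rewrite tk walk_end_cat.
  by move: qw; rewrite -{1}(cat_take_drop j q) walk_cat tk walk_cat => /andP[/andP[_ ->]].
have [w1 e1] := split_at v p erefl pw; have [w2 e2] := split_at v' p' (esym sz) pw'.
apply: (periodic_pair _ _ w1 w2); rewrite ?e1 ?e2.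
- by rewrite dif // -ltnS.
- by rewrite size_takel ?subn_gt0 // size_drop leq_sub2r // -ltnS.
- exact: esym (congr1 fst fij).
- exact: esym (congr1 snd fij).
- by rewrite !map_take !map_drop Lpp'.
Qed.

Definition window (x : int -> edge G) (i : int) n : seq (edge G) :=
  mkseq (fun j => x (i + j%:Z)) n.

Lemma window_walk x i n : edge_shift G x -> walk (src (x i)) (window x i n).
Proof.
move=> xG; elim: n i => [|n IH] i //.
rewrite /window /mkseq /= addr0 eqxx /= -[iota 1 n]/(iota (1 + 0) n) iotaDl -map_comp.
have := IH (i + 1); rewrite xG /window /mkseq.
by rewrite (eq_map (g := (fun j => x (i + j%:Z)) \o addn 1)) // => j /=; rewrite -addrA.
Qed.

Lemma window_end x i n : edge_shift G x ->
  walk_end (src (x i)) (window x i n.+1) = rng (x (i + n%:Z)).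
Proof.
move=> xG; rewrite /window /walk_end -map_comp /mkseq -addn1 iotaD /= map_cat last_cat.
by rewrite add0n.
Qed.

End BiinfinitePairs.

Section SyncTextile.
Variables (E : digraph) (k : nat) (tau : {perm gpath E k.+1}).
Hypothesis tau_fix : endpoint_fixing tau.
Let G := perm_graph tau.

(** The first label is deterministic backwards, since $x$ is its label followed by its range. The
    second label is deterministic forwards ([label2_determ]), since $\tau(x)$ is the source of $x$
    followed by its label. *)
Lemma label1_determ (x y : edge G) : rng x = rng y -> label1 x = label1 y -> x = y.
Proof. by move=> xy1 xy2; apply: (@gpath_split_inj E k). Qed.

Lemma label2_determ (x y : edge G) : src x = src y -> label2 x = label2 y -> x = y.
Proof.
move=> xy1 xy2; apply: (@perm_inj _ tau); apply: gpath_pedges_inj.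
rewrite !edge_rcons; congr (tval (pedges _) ++ _); first exact: xy1.
by congr [:: _]; exact: xy2.
Qed.

Lemma label1_walk_source (v v' : vert G) p p' : walk v p -> walk v' p' ->
  map (@label1 _ _ tau) p = map (@label1 _ _ tau) p' -> walk_end v p = walk_end v' p' -> v = v'.
Proof.
elim: p v p' v' => [|x p IH] v [|x' p'] v' //= /andP[/eqP <- pw] /andP[/eqP <- pw'] [Lx Lp] pe.
by rewrite (@label1_determ x x') //; apply: (IH _ p').
Qed.

Lemma label2_walk_range (v : vert G) p p' : walk v p -> walk v p' ->
  map (@label2 _ _ tau) p = map (@label2 _ _ tau) p' -> walk_end v p = walk_end v p'.
Proof.
elim: p v p' => [|x p IH] v [|x' p'] //= /andP[/eqP xv pw] /andP[/eqP xv' pw'] [Lx Lp].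
have xx' : x = x' by apply: label2_determ => //; exact: etrans xv (esym xv').
by rewrite /walk_end /= -!/(walk_end _ _) -xx' in pw' *; apply: IH.
Qed.

Lemma two_sided_of_sync :
  sync_first tau -> sync_second tau -> two_sided_11 (perm_textile tau_fix).
Proof.
move=> [m sf] [n ss]; split=> x y /set_mem xG /set_mem yG Lxy.
  have Lxyi i : label1 (x i) = label1 (y i) by exact: (congr1 (@^~ i) Lxy).
  have sxy i : src (x i) = src (y i).
    have [p p1 p2] := walk_gpath (window_walk i m xG) (size_mkseq _ _).
    have [q q1 q2] := walk_gpath (window_walk i m yG) (size_mkseq _ _).
    rewrite -p1 -q1; apply: sf; rewrite p2 q2 /window -!map_comp.
    by apply: eq_map => j; exact: Lxyi.
  apply/funext => i; apply: label1_determ => //.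
  by rewrite (xG i) (yG i) sxy.
have Lxyi i : label2 (x i) = label2 (y i) by exact: (congr1 (@^~ i) Lxy).
have rxy i : rng (x i) = rng (y i).
  (* A window of $n + 1$ edges is nonempty and has edge [i] as its last one, so its range is
     [rng (x i)]. *)
  have [p p1 p2] := walk_gpath (window_walk (i - n%:Z) n.+1 xG) (size_mkseq _ _).
  have [q q1 q2] := walk_gpath (window_walk (i - n%:Z) n.+1 yG) (size_mkseq _ _).
  have := @ss n.+1 n.+1 p q (leqnSn n) (leqnSn n).
  rewrite !prngE p1 p2 q1 q2 !window_end // subrK; apply.
  by rewrite /window -!map_comp; apply: eq_map => j; exact: Lxyi.
apply/funext => i; apply: label2_determ => //.
by have := rxy (i - 1); rewrite xG yG subrK.
Qed.

Lemma sync_first_of_two_sided : two_sided_11 (perm_textile tau_fix) -> sync_first tau.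
Proof.
move=> [p_inj _]; exists (#|vert G| ^ 2)%N => p q Lpq.
apply/eqP/negPn/negP => pq.
have sz : size (pedges p) = size (pedges q) by rewrite !size_tuple.
have [||||i ip|x [y [xG yG Lxy xy]]] := @distinct_walks_pair G _ (@label1 _ _ tau)
  (psrc p) (psrc q) (pedges p) (pedges q).
- by rewrite size_tuple.
- exact: gpath_walk.
- exact: gpath_walk.
- exact: Lpq.
(* Had the two walks met at time [i], backward determinism would make their sources equal. *)
- apply: contraNneq pq => pq.
  have pw := gpath_walk p; have qw := gpath_walk q.
  rewrite -(cat_take_drop i (pedges p)) walk_cat in pw.
  rewrite -(cat_take_drop i (pedges q)) walk_cat in qw.
  move: pw qw => /andP[pw _] /andP[qw _].
  by rewrite (label1_walk_source pw qw) // !map_take Lpq.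
by apply: xy; apply: p_inj => //; exact: mem_set.
Qed.

Lemma sync_second_of_two_sided : two_sided_11 (perm_textile tau_fix) -> sync_second tau.
Proof.
move=> [_ q_inj]; exists (#|vert G| ^ 2)%N => l l' p q lp lq Lpq.
apply/eqP/negPn/negP => pq.
have [||||i ip|x [y [xG yG Lxy xy]]] := @distinct_walks_pair G _ (@label2 _ _ tau)
  (psrc p) (psrc q) (pedges p) (pedges q).
- by rewrite size_tuple.
- exact: gpath_walk.
- exact: gpath_walk.
- exact: Lpq.
(* Had they met at time [i], forward determinism would make their ranges equal. *)
- apply: contraNneq pq => pq.
  have pw := gpath_walk p; have qw := gpath_walk q.
  rewrite !prngE -(cat_take_drop i (pedges p)) -(cat_take_drop i (pedges q)).
  rewrite -(cat_take_drop i (pedges p)) walk_cat in pw.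
  rewrite -(cat_take_drop i (pedges q)) walk_cat in qw.
  move: pw qw => /andP[_ pw] /andP[_ qw]; rewrite !walk_end_cat pq.
  by rewrite pq in pw; rewrite (label2_walk_range pw qw) // !map_drop Lpq.
by apply: xy; apply: q_inj => //; exact: mem_set.
Qed.

End SyncTextile.

(** * Synchronization in terms of words *)

Section WordSync.
Variables (E : digraph) (k : nat) (tau : {perm gpath E k.+1}).
Hypothesis tau_fix : endpoint_fixing tau.
Let G := perm_graph tau.
Implicit Types (v : vert E) (a b z : seq (edge E)).

(** Source and range of a path in the permutation graph appear here only as words of length [k]. For
    $k = 0$ these are empty and the vertex is lost; [first_of_left_sync] and [second_of_right_sync]
    recover it from a nonempty label, which is why they pass to [m.+1]. *)
Definition left_sync m := forall v v' a b b', walk v (a ++ b) -> walk v' (a ++ b') ->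
  size a = m -> size b = k -> size b' = k ->
  take k (sweep tau m (a ++ b)) = take k (sweep tau m (a ++ b')).

Definition right_sync m := forall v v' a a' b b', walk v (a ++ b) -> walk v' (a' ++ b') ->
  size a = m -> size a' = m -> size b = k -> size b' = k ->
  drop k (sweep tau m (a ++ b)) = drop k (sweep tau m (a' ++ b')) -> b = b'.

Lemma word_lift v a b : walk v (a ++ b) -> size b = k ->
  exists (w u : vert G) (g : seq (edge G)),
    [/\ walk w g, walk_end w g = u, map (@label1 _ _ tau) g = a,
        tval (pedges (u : gpath E k)) = b &
        sweep tau (size a) (a ++ b) = pedges (w : gpath E k) ++ map (@label2 _ _ tau) g].
Proof.
move=> abw bk; have := abw; rewrite walk_cat => /andP[_ bw].
have [u uv ub] := walk_gpath bw bk.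
have [|w [g [g1 g2 g3]]] := @perm_graph_walk_lift E k tau tau_fix u a v _ (esym uv).
  by rewrite ub.
exists w, u, g; split => //; have [_] := perm_graph_walk_sweep tau_fix g1.
by rewrite g2 g3 ub -g3 size_map.
Qed.

Lemma gpathk_eq_rng (x y : gpath E k) : tval (pedges x) = tval (pedges y) ->
  prng x = prng y -> x = y.
Proof.
move=> xy1 xy2; apply: gpath_eqP => //.
have xw := gpath_walk x; have yw := gpath_walk y.
have sx := size_tuple (pedges x); rewrite -xy1 in yw.
move: xy2; rewrite !prngE -xy1.
by case: (tval (pedges x)) xw yw => //= e p /andP[/eqP <- _] /andP[/eqP <- _].
Qed.

Lemma left_sync_of_first : sync_first tau -> exists m, left_sync m.
Proof.
move=> [m sf]; exists m => v v' a b b' abw abw' am bk bk'.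
have [w [u [g [g1 g2 g3 _]]]] := word_lift abw bk; rewrite am => ->.
have [w' [u' [g' [g1' g2' g3' _]]]] := word_lift abw' bk'; rewrite am => ->.
have [|p p1 p2] := walk_gpath (n := m) g1; first by rewrite -am -g3 size_map.
have [|q q1 q2] := walk_gpath (n := m) g1'; first by rewrite -am -g3' size_map.
rewrite !take_size_cat ?size_tuple // -p1 -q1 (sf p q) // p2 q2 g3 g3'; done.
Qed.

Lemma right_sync_of_second : sync_second tau -> exists m, right_sync m.
Proof.
move=> [m ss]; exists m => v v' a a' b b' abw abw' am am' bk bk'.
have [w [u [g [g1 g2 g3 ub]]]] := word_lift abw bk; rewrite am => ->.
have [w' [u' [g' [g1' g2' g3' ub']]]] := word_lift abw' bk'; rewrite am' => ->.
rewrite !drop_size_cat ?size_tuple // => gg'.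
have [|p p1 p2] := walk_gpath (n := m) g1; first by rewrite -am -g3 size_map.
have [|q q1 q2] := walk_gpath (n := m) g1'; first by rewrite -am' -g3' size_map.
have := ss m m p q (leqnn m) (leqnn m).
by rewrite !prngE p1 p2 q1 q2 g2 g2' -ub -ub' => ->.
Qed.

(** The additional application of $\tau$ in front sees only the new letter and the [k] letters that
    are already determined. *)
Lemma left_syncS m : left_sync m -> left_sync m.+1.
Proof.
move=> ls v v' [|e a] b b' //= /andP[_ abw] /andP[_ abw'] [am] bk bk'.
have := ls _ _ _ _ _ abw abw' am bk bk'.
have s1 := sweep_size tau m (a ++ b); have s2 := sweep_size tau m (a ++ b').
rewrite size_cat bk in s1; rewrite size_cat bk' in s2.
set z := sweep tau m (a ++ b) in s1 *; set z' := sweep tau m (a ++ b') in s2 * => zz'.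
have sz : size (take k z) = k by rewrite size_takel // s1 leq_addl.
rewrite -(cat_take_drop k z) -(cat_take_drop k z') -zz' -!cat_cons.
rewrite !prefix_act_cat /= ?sz //.
by rewrite !takel_cat // prefix_act_size /= sz.
Qed.

(** The additional application of $\tau$ changes only the first $k + 1$ letters; what lies beyond
    them is the second label of the remaining [m] steps. *)
Lemma right_syncS m : right_sync m -> right_sync m.+1.
Proof.
move=> rs v v' [|e a] [|e' a'] b b' //= /andP[_ abw] /andP[_ abw'] [am] [am'] bk bk' ee'.
apply: (rs _ _ _ _ _ _ abw abw' am am' bk bk').
by have := congr1 (drop 1) ee'; rewrite !drop_drop !add1n !prefix_act_drop.
Qed.

Lemma left_sync_mono m n : (m <= n)%N -> left_sync m -> left_sync n.
Proof. by move=> /subnK <- ls; elim: (n - m)%N => // j; exact: left_syncS. Qed.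

Lemma right_sync_mono m n : (m <= n)%N -> right_sync m -> right_sync n.
Proof. by move=> /subnK <- rs; elim: (n - m)%N => // j; exact: right_syncS. Qed.

Lemma first_of_left_sync m : left_sync m -> sync_first tau.
Proof.
move=> /left_syncS ls; exists m.+1 => p q pq.
have [pw1 pw2] := perm_graph_walk_sweep tau_fix (gpath_walk p).
have [qw1 qw2] := perm_graph_walk_sweep tau_fix (gpath_walk q).
rewrite -pq !size_tuple in pw1 pw2 qw1 qw2.
have := ls _ _ _ _ _ pw1 qw1; rewrite !size_map !size_tuple pw2 qw2.
rewrite !take_size_cat ?size_tuple // => /(_ erefl erefl erefl) pe.
apply: gpath_eqP _ pe.
move: pw1 qw1; have := size_tuple (pedges p).
by case: (tval (pedges p)) => //= e s _ /andP[/eqP <- _] /andP[/eqP <- _].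
Qed.

Lemma second_of_right_sync m : right_sync m -> sync_second tau.
Proof.
move=> rs0; exists m.+1 => l l' p q lp lq pq.
have ll' : l = l' by have := congr1 size pq; rewrite !size_map !size_tuple.
subst l'; have rs : right_sync l by apply: right_sync_mono rs0; exact: ltnW.
have [pw1 pw2] := perm_graph_walk_sweep tau_fix (gpath_walk p).
have [qw1 qw2] := perm_graph_walk_sweep tau_fix (gpath_walk q).
rewrite !size_tuple in pw2 qw2.
have := rs _ _ _ _ _ _ pw1 qw1; rewrite !size_map !size_tuple pw2 qw2.
rewrite !drop_size_cat ?size_tuple // => /(_ erefl erefl erefl erefl pq) pe.
apply: gpathk_eq_rng pe _.
(* As [perm_q] is a graph homomorphism, the second label determines the range in [E] of the final
   state, which identifies the state when $k = 0$. *)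
have nonempty (r : gpath G l) : prng (prng r : gpath E k) =
    last (prng (psrc r : gpath E k)) (map (@rng E) (map (@label2 _ _ tau) (pedges r))).
  change (prng (last (psrc r) (map (@rng G) (pedges r)) : gpath E k) =
    last (prng (psrc r : gpath E k)) (map (@rng E) (map (@label2 _ _ tau) (pedges r)))).
  elim: (tval (pedges r)) (psrc r) => //= e s IH u.
  by rewrite IH; congr last; exact: (perm_textile_q_rng tau_fix e).
have sq : (0 < size (pedges q))%N by rewrite size_tuple (leq_ltn_trans _ lq).
by rewrite !nonempty pq; case: (tval (pedges q)) sq.
Qed.

(** After [j] steps the leading [k] letters are the intermediate state; the letters behind it are
    final output, out of reach of the [i] further steps. *)
Lemma sweep_split i j a z : size a = i -> size z = (j + k)%N ->
  sweep tau (i + j) (a ++ z) =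
  sweep tau i (a ++ take k (sweep tau j z)) ++ drop k (sweep tau j z).
Proof.
move=> <- zj; rewrite sweep_add -{1}(cat_take_drop k (sweep tau j z)) catA sweep_cat //.
by rewrite size_cat size_takel // sweep_size zj leq_addl.
Qed.

(* The word [e :: sweep tau (m + m) (a ++ b)] is [tau^-1] applied to
   [sweep tau (m + m).+1 (e :: a ++ b)], so both have the same letters from position
   [k + 1] on; right synchronization turns this into equality of the states reached
   after [m + 1] steps. *)
Lemma conjugate_word_tail m : right_sync m -> forall v e a1 a2 b,
  walk v (e :: a1 ++ a2 ++ b) -> size a1 = m -> size a2 = m -> size b = k ->
  exists c, [/\ size c = m.+1, walk v (c ++ a2 ++ b) &
    sweep tau (m.+1 + m) (c ++ a2 ++ b) = e :: sweep tau (m + m) (a1 ++ a2 ++ b)].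
Proof.
move=> rs v e a1 a2 b abw a1m a2m bk.
have bs : size (a2 ++ b) = (m + k)%N by rewrite size_cat a2m bk.
have as_ : size (a1 ++ a2 ++ b) = (m + m + k)%N by rewrite size_cat bs a1m addnA.
have /andP[ev abw'] : (src e == v) && walk (rng e) (a1 ++ a2 ++ b) := abw.
have [|w1 _] := sweep_walk (n := m + m) tau_fix abw'; first by rewrite as_.
have [||z [zw zs zE]] := @sweep_surj E k tau (m.+1 + m) v
  (e :: sweep tau (m + m) (a1 ++ a2 ++ b)) tau_fix; first by rewrite /= ev w1.
  by rewrite /= sweep_size as_ addSn addSn.
rewrite /= sweep_size as_ in zs.
exists (take m.+1 z); suff E1 : drop m.+1 z = a2 ++ b.
  split; first by rewrite size_takel // zs -addnA ltnS leq_addr.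
    by rewrite -E1 cat_take_drop.
  by rewrite -{1}E1 cat_take_drop.
case: z zw zs zE => [|f z] //= /andP[fv zw] [zs] zE.
have z1s : size (take m z) = m by rewrite size_takel // zs -addnA leq_addr.
have z2s : size (drop m z) = (m + k)%N by rewrite size_drop zs -addnA addKn.
have zE' : prefix_act tau (f :: sweep tau (m + m) (take m z ++ drop m z)) =
    e :: sweep tau (m + m) (a1 ++ a2 ++ b) by rewrite cat_take_drop.
have tails := congr1 (drop k.+1) zE'.
rewrite prefix_act_drop /= (sweep_split a1m bs) (sweep_split z1s z2s) in tails.
have sk y : size y = (m + k)%N -> size (take k (sweep tau m y)) = k.
  by move=> ys; rewrite size_takel // sweep_size ys leq_addl.
have sw a y : size a = m -> size y = (m + k)%N ->
    size (sweep tau m (a ++ take k (sweep tau m y))) = (k + m)%N.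
  by move=> am ys; rewrite sweep_size size_cat am sk // addnC.
have dropk a y : size a = m -> size y = (m + k)%N ->
    drop k (sweep tau m (a ++ take k (sweep tau m y)) ++ drop k (sweep tau m y)) =
    drop k (sweep tau m (a ++ take k (sweep tau m y))) ++ drop k (sweep tau m y).
  by move=> am ys; rewrite drop_catl // sw // leq_addr.
rewrite !dropk // in tails.
have /eqP := tails; rewrite eqseq_cat; last by rewrite !size_drop !sw.
move=> /andP[/eqP heads /eqP rests].
have abw2 : walk (walk_end (rng e) a1) (a2 ++ b).
  by move: abw'; rewrite walk_cat => /andP[_].
have [|xw _] := sweep_walk (n := m) tau_fix abw2; first by rewrite bs.
have zw' : walk (rng f) (take m z ++ drop m z) by rewrite cat_take_drop.
move: zw'; rewrite walk_cat => /andP[z1w z2w].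
have [|yw _] := sweep_walk (n := m) tau_fix z2w; first by rewrite z2s.
(* [heads] says that the two runs have the same second label during the [m] steps leading from these
   states to the front, so right synchronization applies. *)
have states : take k (sweep tau m (drop m z)) = take k (sweep tau m (a2 ++ b)).
  have prefix_walk (u : vert E) y : walk u y -> walk u (take k y).
    by rewrite -{1}(cat_take_drop k y) walk_cat => /andP[].
  apply: (rs (rng f) (rng e) (take m z) a1) => //; try by rewrite sk.
    by rewrite walk_cat z1w prefix_walk.
  by move: abw'; rewrite !walk_cat => /andP[-> _]; rewrite prefix_walk.
have : sweep tau m (drop m z) = sweep tau m (a2 ++ b).
  by rewrite -(cat_take_drop k (sweep tau m (drop m z))) states rests cat_take_drop.
apply: (sweep_inj tau_fix z2w (v' := walk_end (rng e) a1)).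
  by move: abw'; rewrite walk_cat => /andP[_].
by rewrite z2s.
Qed.

(* With [n = 2 m + 1], conjugating [tau^-1] by the transducer [sweep tau n] changes only
   the first [n] letters [a] of a word [a ++ b], in a way that does not depend on [b]:
   by right synchronization nothing changes past position [m + 1], and by left
   synchronization the first [m + 1] letters do not depend on [b]. *)
Lemma conjugate_word_local m : left_sync m -> right_sync m -> forall v e a,
  size a = (m + m)%N -> exists c, forall b, size b = k -> walk v (e :: a ++ b) ->
    [/\ size c = (m + m).+1, walk v (c ++ b) &
    sweep tau (m + m).+1 (c ++ b) = e :: sweep tau (m + m) (a ++ b)].
Proof.
move=> ls rs v e a am.
have a1m : size (take m a) = m by rewrite size_takel // am leq_addr.
have a2m : size (drop m a) = m by rewrite size_drop am addKn.
have key b : size b = k -> walk v (e :: a ++ b) -> exists c, [/\ size c = m.+1,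
    walk v (c ++ drop m a ++ b) &
    sweep tau (m.+1 + m) (c ++ drop m a ++ b) = e :: sweep tau (m + m) (a ++ b)].
  move=> bk abw; have := @conjugate_word_tail m rs v e (take m a) (drop m a) b.
  by rewrite catA cat_take_drop; apply.
(* Without an admissible [b] the claim is void and any [c] serves. Otherwise [c] is taken from one
   such [b0], and the work is to show that every other [b] yields the same word. *)
have [[b0 [b0k b0w]]|none] := pselect (exists b, size b = k /\ walk v (e :: a ++ b)); last first.
  by exists [::] => b bk bw; case: none; exists b.
have [c [cs cw cE]] := key _ b0k b0w; exists (c ++ drop m a) => b bk abw.
have [c' [cs' cw' cE']] := key _ bk abw.
suff -> : c = c' by rewrite -!catA; split => //; rewrite size_cat cs' a2m addSn.
have bs y : size y = k -> size (drop m a ++ y) = (m + k)%N by move=> yk; rewrite size_cat a2m yk.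
have st y : size y = k -> size (take k (sweep tau m (drop m a ++ y))) = k.
  by move=> yk; rewrite size_takel // sweep_size bs // leq_addl.
have split_walk (u : vert E) x y : walk u (x ++ y) -> walk (walk_end u x) y by rewrite walk_cat => /andP[].
have /andP[_ aw0] : (src e == v) && walk (rng e) (a ++ b0) := b0w.
have /andP[_ aw] : (src e == v) && walk (rng e) (a ++ b) := abw.
have same : take k (sweep tau m (drop m a ++ b0)) = take k (sweep tau m (drop m a ++ b)).
  rewrite -(cat_take_drop m a) -catA in aw0; rewrite -(cat_take_drop m a) -catA in aw.
  by apply: (ls _ _ _ _ _ (split_walk _ _ _ aw0) (split_walk _ _ _ aw)).
have first_part x y : size x = m.+1 -> size y = k ->
    sweep tau (m.+1 + m) (x ++ drop m a ++ y) = e :: sweep tau (m + m) (a ++ y) ->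
    sweep tau m.+1 (x ++ take k (sweep tau m (drop m a ++ y))) =
    e :: sweep tau m (take m a ++ take k (sweep tau m (drop m a ++ y))).
  move=> xm yk; rewrite -{2}(cat_take_drop m a) -catA.
  rewrite (sweep_split xm (bs _ yk)) (sweep_split a1m (bs _ yk)) -cat_cons.
  move=> /eqP; rewrite eqseq_cat => [/andP[/eqP -> //]|].
  by rewrite sweep_size /= sweep_size !size_cat xm a1m st.
have := first_part _ _ cs b0k cE; rewrite same -(first_part _ _ cs' bk cE').
move=> /(sweep_inj tau_fix (v := v) (v' := v)) inj.
have tw (y : seq (edge E)) u : walk u y -> walk u (take k y).
  by rewrite -{1}(cat_take_drop k y) walk_cat => /andP[].
have cat_walk x y : size y = k -> walk v (x ++ drop m a ++ y) ->
    walk v (x ++ take k (sweep tau m (drop m a ++ y))).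
  move=> yk; rewrite !walk_cat => /andP[-> xw] /=; apply: tw.
  rewrite -walk_cat in xw.
  by have [] := @sweep_walk E k tau m _ _ tau_fix xw _; rewrite ?bs.
have /eqP : c ++ take k (sweep tau m (drop m a ++ b)) = c' ++ take k (sweep tau m (drop m a ++ b)).
  apply: inj; last by rewrite size_cat cs st.
    by rewrite -same; apply: cat_walk.
  exact: cat_walk.
by rewrite eqseq_cat ?cs ?cs' // => /andP[/eqP].
Qed.

End WordSync.

(** * Cuntz-Krieger families and permutative endomorphisms *)

Section LinearSpan.
Variables (R : realType) (A : cstarAlgType R).
Implicit Types (G : set A).

Inductive lspan G : A -> Prop :=
| lspan_zero : lspan G 0
| lspan_cons c g y : G g -> lspan G y -> lspan G (c *: g + y).

Lemma lspan_gen G g : G g -> lspan G g.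
Proof. by move=> Gg; rewrite -[g]addr0 -(scale1r g); apply: lspan_cons => //; exact: lspan_zero. Qed.

Lemma lspanD G x y : lspan G x -> lspan G y -> lspan G (x + y).
Proof.
by move=> xG yG; elim: xG => [|c g z Gg _ IH]; rewrite ?add0r // -addrA; exact: lspan_cons.
Qed.

Lemma lspanZ G c x : lspan G x -> lspan G (c *: x).
Proof.
elim=> [|d g z Gg _ IH]; first by rewrite scaler0; exact: lspan_zero.
by rewrite scalerDr scalerA; exact: lspan_cons.
Qed.

Lemma lspan_sum G (I : Type) (r : seq I) (D : pred I) (F : I -> A) :
  (forall i, D i -> lspan G (F i)) -> lspan G (\sum_(i <- r | D i) F i).
Proof. by move=> FG; apply: big_ind => //; [exact: lspan_zero | exact: lspanD]. Qed.

Lemma lspan_mull G H a x : (forall g, G g -> lspan H (a ** g)) ->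
  lspan G x -> lspan H (a ** x).
Proof.
move=> aG; elim=> [|c g y Gg _ IH]; first by rewrite cmul0r; exact: lspan_zero.
by rewrite cmulDr cmulZr; apply: lspanD IH; apply: lspanZ; exact: aG.
Qed.
End LinearSpan.

(** * Calculus of words in a Cuntz-Krieger family *)

Section CuntzKriegerWords.
Variables (R : realType) (E : digraph) (E_sinks : no_sinks E).
Variables (A : cstarAlgType R) (P : vert E -> A) (S : edge E -> A).
Hypothesis fam : cuntz_krieger_family P S.
Let one : A := \sum_v P v.
Hypothesis one_unit : is_unit_elt one.

Let onel x : one ** x = x. Proof. by have [] := one_unit x. Qed.
Let oner x : x ** one = x. Proof. by have [] := one_unit x. Qed.

(** The empty word is the unit and not a vertex projection, which makes [word] multiplicative on all
    sequences. A nonempty sequence that is not a path gives 0 ([word_nonwalk0]). *)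
Definition word p : A := foldr (fun e a => S e ** a) one p.

Lemma projS v : (P v)^† = P v. Proof. by have [] := ck_proj fam v. Qed.

Lemma projM v w : P v ** P w = if v == w then P v else 0.
Proof.
by case: eqVneq => [<-|vw]; [have [] := ck_proj fam v | exact: (ck_orth fam vw)].
Qed.

Lemma isom_proj e : S e ** P (rng e) = S e.
Proof. by rewrite -(ck_source fam) cmulA (ck_pisom fam). Qed.

Lemma isom_starM e f : (S e)^† ** S f = if e == f then P (rng e) else 0.
Proof.
by case: eqVneq => [<-|ef]; [rewrite (ck_source fam) | exact: (ck_edge_orth fam ef)].
Qed.

Lemma proj_sum v : P v = \sum_(e | src e == v) S e ** (S e)^†.
Proof. exact: (ck_sum fam (E_sinks v)). Qed.

Lemma proj_isom v e : P v ** S e = if src e == v then S e else 0.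
Proof.
have src_e : P (src e) ** S e = S e.
  rewrite proj_sum cmul_suml (bigD1 e) //= -[in RHS](ck_pisom fam e).
  rewrite big1 ?addr0 // => f /andP[_ fe].
  by rewrite -cmulA (ck_edge_orth fam fe) cmul0r.
case: eqVneq => [<- //|ve]; rewrite -src_e cmulA projM eq_sym (negbTE ve).
exact: cmul0l.
Qed.

Lemma word_cat p q : word (p ++ q) = word p ** word q.
Proof. by elim: p => [|e p IH] /=; rewrite ?onel // -cmulA -IH. Qed.

Lemma word1 e : word [:: e] = S e. Proof. exact: oner. Qed.

Lemma proj_word v e p : P v ** word (e :: p) = if src e == v then word (e :: p) else 0.
Proof. by rewrite /= cmulA proj_isom; case: eqP => // _; rewrite cmul0l. Qed.

Lemma isom_word_nonwalk e p : ~~ walk (rng e) p -> S e ** word p = 0.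
Proof.
elim: p e => //= f p IH e; rewrite negb_and -isom_proj -cmulA (cmulA (P _)) proj_isom.
case: eqP => /= [_ /IH -> | _ _]; first exact: cmul0r.
by rewrite cmul0l cmul0r.
Qed.

Lemma word_nonwalk v p : (0 < size p)%N -> ~~ walk v p -> P v ** word p = 0.
Proof.
case: p => // e p _; rewrite proj_word /=; case: eqP => //= _.
exact: isom_word_nonwalk.
Qed.

Lemma word_nonwalk0 p : (0 < size p)%N -> (forall v, ~~ walk v p) -> word p = 0.
Proof.
by move=> p0 np; rewrite -(onel (word p)) cmul_suml big1 // => v _; apply: word_nonwalk.
Qed.

Lemma proj_wordC v p : walk v p -> P v ** word p = word p ** P (walk_end v p).
Proof.
elim: p v => [|e p IH] v /=; first by rewrite onel oner.
move=> /andP[/eqP <- pw]; rewrite cmulA proj_isom eqxx -{1}isom_proj -cmulA (IH _ pw).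
by rewrite cmulA.
Qed.

Lemma proj_word_walk v p : (0 < size p)%N -> walk v p -> P v ** word p = word p.
Proof. by case: p => // e p _; rewrite proj_word /= => /andP[-> _]. Qed.

Lemma word_starM v p : walk v p -> (word p)^† ** P v ** word p = P (walk_end v p).
Proof.
elim: p v => [|e p IH] v /=; first by rewrite oner unit_elt_cstar // onel.
move=> /andP[ev pw]; rewrite cstarM -!cmulA (cmulA (P v)) proj_isom ev.
by rewrite (cmulA (S e)^†) (ck_source fam) -(IH _ pw) cmulA.
Qed.

Lemma word_star_neq v p q : size p = size q -> p != q -> (word p)^† ** P v ** word q = 0.
Proof.
elim: p v q => [|e p IH] v [|f q] //= [sz]; rewrite eqseq_cons negb_and => pq.
rewrite cstarM -!cmulA (cmulA (P v)) proj_isom; case: eqP => [_|_]; last first.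
  by rewrite cmul0l !cmul0r.
rewrite (cmulA (S e)^†) isom_starM; move: pq.
case: eqVneq => [_ /= pq|_ _]; last by rewrite cmul0l cmul0r.
by rewrite cmulA (IH _ _ sz).
Qed.

Lemma word_star_neq0 p q : size p = size q -> p != q -> (word p)^† ** word q = 0.
Proof.
move=> sz pq; rewrite -(onel (word q)) cmulA cmul_sumr cmul_suml big1 // => v _.
exact: word_star_neq.
Qed.

Lemma word_star_self v p : (0 < size p)%N -> walk v p ->
  (word p)^† ** word p = P (walk_end v p).
Proof. by move=> p0 pw; rewrite -(word_starM pw) -cmulA proj_word_walk. Qed.

(** Each step replaces $P_v$ by the sum of $S_e S_e^*$ over the edges leaving $v$, so that testing
    on paths of length $n + 1$ implies testing on those of length $n$; at length 0 the vertex
    projections add up to the unit. *)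
Lemma word_test_proj n a :
  (forall v w, walk v w -> size w = n -> a ** (P v ** word w) = 0) -> a = 0.
Proof.
elim: n => [|n IH] an.
  rewrite -(oner a) cmul_sumr big1 // => v _.
  by have := an v [::] isT erefl; rewrite /= oner.
apply: IH => v w vw wn; rewrite proj_wordC // proj_sum cmul_sumr cmul_sumr big1 // => e /eqP ew.
have := an v (rcons w e); rewrite -cats1 walk_cat vw /= ew eqxx size_cat addn1 wn.
rewrite word_cat word1 => /(_ isT erefl) E0.
have Pw : word w ** S e = P v ** word w ** S e.
  by rewrite proj_wordC // -cmulA proj_isom ew eqxx.
rewrite (cmulA (word w)) Pw -(cmulA (P v)) (cmulA a) E0.
by rewrite cmul0l.
Qed.

Lemma word_test n a : (0 < n)%N ->
  (forall v w, walk v w -> size w = n -> a ** word w = 0) -> a = 0.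
Proof.
move=> n0 an; apply: (@word_test_proj n) => v w vw wn.
by rewrite proj_word_walk ?wn // (an v).
Qed.

Lemma path_elt_word n (x : gpath E n.+1) : path_elt P S x = word (pedges x).
Proof.
rewrite /path_elt edge_cons; move: (first_edge x) (tval _) => e p.
elim/last_ind: p e => [|p f IH] e /=; first by rewrite oner.
by rewrite foldl_rcons IH -cats1 word_cat word1 cmulA.
Qed.

Section Unitary.
Variable k : nat.
Implicit Type tau : {perm gpath E k.+1}.
Local Notation U := (perm_unitary P S).

Lemma perm_unitaryE tau :
  U tau = \sum_(x : gpath E k.+1) word (pedges (tau x)) ** (word (pedges x))^†.
Proof. by apply: eq_bigr => x _; rewrite !path_elt_word. Qed.

Lemma perm_unitaryS tau : (U tau)^† = U tau^-1%g.
Proof.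
rewrite !perm_unitaryE cstar_sum (reindex_perm tau^-1%g) /=.
by apply: eq_bigr => x _; rewrite cstarM cstarK permKV.
Qed.

Lemma perm_unitary_word tau v w : endpoint_fixing tau -> walk v w -> (k < size w)%N ->
  U tau ** word w = word (prefix_act tau w).
Proof.
move=> fx vw kw; have [x xv xw] := walk_split vw kw.
rewrite xw prefix_act_gpath !word_cat perm_unitaryE cmul_suml (bigD1 x) //=.
have x0 : (0 < size (pedges x))%N by rewrite size_tuple.
have tx0 : (0 < size (pedges (tau x)))%N by rewrite size_tuple.
rewrite -cmulA (cmulA (word (pedges x))^†) (word_star_self x0 (gpath_walk x)).
rewrite big1 ?addr0 => [|y yx].
  have [s1 s2] := endpoint_fixingP fx x.
  rewrite cmulA; have -> : walk_end (psrc x) (pedges x) = walk_end (psrc (tau x)) (pedges (tau x)).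
    by rewrite -!prngE s2.
  by rewrite -(proj_wordC (gpath_walk (tau x))) proj_word_walk ?gpath_walk.
rewrite -cmulA (cmulA _^†) word_star_neq0 ?size_tuple ?cmul0l ?cmul0r //.
by apply: contraNneq yx => /gpath_pedges_inj ->.
Qed.

Lemma perm_unitary_starM tau : endpoint_fixing tau -> (U tau)^† ** U tau = one.
Proof.
move=> fx; apply/eqP; rewrite -subr_eq0; apply/eqP.
apply: (@word_test k.+1) => // v w vw wk.
have [w1 _] := prefix_act_walk fx vw (eq_leq (esym wk)).
rewrite cmulBl onel -cmulA (perm_unitary_word fx vw) ?wk // perm_unitaryS.
rewrite (perm_unitary_word (endpoint_fixingV fx) w1) ?prefix_act_size ?wk //.
by rewrite (prefix_actK tau vw) ?wk // subrr.
Qed.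

Lemma perm_unitary_mulS tau : endpoint_fixing tau -> U tau ** (U tau)^† = one.
Proof.
move=> fx; have := perm_unitary_starM (endpoint_fixingV fx).
by rewrite !perm_unitaryS invgK.
Qed.

Lemma perm_unitary_proj tau v : endpoint_fixing tau -> U tau ** P v = P v ** U tau.
Proof.
move=> fx; apply/eqP; rewrite -subr_eq0; apply/eqP.
apply: (@word_test k.+1) => // u w uw wk.
have kw : (k < size w)%N by rewrite wk.
have [w1 _] := prefix_act_walk fx uw kw.
rewrite cmulBl -!cmulA (perm_unitary_word fx uw kw).
have cond z : walk u z -> (0 < size z)%N -> P v ** word z = if u == v then word z else 0.
  by case: z => // e z /= /andP[/eqP <- _] _; rewrite -/(word (e :: z)) proj_word.
rewrite !cond ?prefix_act_size ?wk //; case: eqP => _; last by rewrite cmul0r subrr.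
by rewrite (perm_unitary_word fx uw kw) subrr.
Qed.
End Unitary.

(** The other relations follow. For $x = T_e Q_{r(e)} - T_e$ one computes $x^* x = 0$, so $T_e$ is a
    partial isometry; and $Q_{s(e)} - T_e T_e^*$ is the sum of the other range projections, a
    self-adjoint idempotent $q = q^* q$. *)
Lemma cuntz_krieger_intro (B : cstarAlgType R) (Q : vert E -> B) (T : edge E -> B) :
  (forall v, is_projection (Q v)) -> (forall v w, v != w -> Q v ** Q w = 0) ->
  (forall e, (T e)^† ** T e = Q (rng e)) -> (forall e f, e != f -> (T e)^† ** T f = 0) ->
  (forall v, Q v = \sum_(e | src e == v) T e ** (T e)^†) -> cuntz_krieger_family Q T.
Proof.
move=> Qp Qo TT To Qs.
have TQ e : T e ** Q (rng e) = T e.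
  have [q1 q2] := Qp (rng e).
  apply/eqP; rewrite -subr_eq0; apply/eqP/cstar_mul_eq0.
  rewrite cstarB cstarM q1 cmulBl !cmulBr -!cmulA TT (cmulA (T e)^†) TT q2.
  by rewrite q2 !subrr.
have Tpi e : is_partial_isometry (T e) by rewrite /is_partial_isometry -cmulA TT TQ.
split=> // e; rewrite /cstar_le (Qs (src e)) (bigD1 e) //= addrC addrK.
set q := \sum_(f | _) _; exists q.
have qs : q^† = q by rewrite cstar_sum; apply: eq_bigr => f _; rewrite cstarM cstarK.
rewrite qs [RHS]cmul_suml; apply: eq_bigr => f fe.
rewrite cmul_sumr (bigD1 f) //= big1 ?addr0 => [|g /andP[_ gf]].
  by rewrite -cmulA (cmulA _ (T f)) TT cmulA TQ.
by rewrite -cmulA (cmulA _ (T g)) To 1?eq_sym // cmul0l cmul0r.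
Qed.

(** Because $\tau$ fixes endpoints, $U_\tau$ commutes with every $P_v$, and the twisted isometries
    keep the same vertex projections. *)
Lemma perm_unitary_family k (tau : {perm gpath E k.+1}) : endpoint_fixing tau ->
  cuntz_krieger_family P (fun e => perm_unitary P S tau ** S e).
Proof.
move=> fx; have UU := perm_unitary_starM fx; have UU' := perm_unitary_mulS fx.
apply: cuntz_krieger_intro.
- exact: ck_proj fam.
- exact: ck_orth fam.
- by move=> e; rewrite cstarM -cmulA (cmulA _^† _ (S e)) UU onel (ck_source fam).
- by move=> e f ef; rewrite cstarM -cmulA (cmulA _^† _ (S f)) UU onel (ck_edge_orth fam ef).
move=> v; rewrite -[LHS]onel -UU' -cmulA.
have := congr1 (@cstar R A) (perm_unitary_proj v fx); rewrite !cstarM projS => <-.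
rewrite cmulA; under eq_bigr do rewrite cstarM -cmulA (cmulA (S _)).
by rewrite -cmul_sumr -cmul_suml -proj_sum cmulA.
Qed.
End CuntzKriegerWords.

Section GraphAlgebra.
Variables (R : realType) (E : digraph).
Hypotheses (E_sinks : no_sinks E) (E_sources : no_sources E).
Variables (A : cstarAlgType R) (P : vert E -> A) (S : edge E -> A).
Hypothesis A_graph : is_graph_cstar P S.
Let fam := graph_cstar_family A_graph.
Let one : A := \sum_v P v.
Local Notation word := (word P S).
Local Notation U := (perm_unitary P S).

Lemma graph_unit : is_unit_elt one.
Proof.
have oneP v : one ** P v = P v.
  rewrite cmul_suml (bigD1 v) //= (projM fam) eqxx big1 ?addr0 // => w wv.
  by rewrite (projM fam) (negbTE wv).
have onePr v : P v ** one = P v.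
  rewrite cmul_sumr (bigD1 v) //= (projM fam) eqxx big1 ?addr0 // => w wv.
  by rewrite (projM fam) eq_sym (negbTE wv).
have oneS : one^† = one by rewrite cstar_sum; apply: eq_bigr => v _; rewrite (projS fam).
apply: (graph_cstar_gen A_graph (B := [set x | one ** x = x /\ x ** one = x])).
- split=> /=.
  + apply: approx_closed => x xP.
    split; apply/eqP; rewrite -subr_eq0; apply/eqP;
      apply: (@small_cnrm_eq0 _ _ _ (cnrm one + 1)); rewrite ?addr_ge0 ?cnrm_ge0 //;
      move=> r r0; have [y [y1 y2] xy] := xP r r0.
    * have -> : one ** x - x = one ** (x - y) - (x - y).
        by rewrite cmulBr y1 opprB addrA subrK.
      have := cnrmB (one ** (x - y)) (x - y); have := cnrmM one (x - y).
      have := cnrm_ge0 one; have := cnrm_ge0 (x - y); move: xy; nra.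
    * have -> : x ** one - x = (x - y) ** one - (x - y).
        by rewrite cmulBl y2 opprB addrA subrK.
      have := cnrmB ((x - y) ** one) (x - y); have := cnrmM (x - y) one.
      have := cnrm_ge0 one; have := cnrm_ge0 (x - y); move: xy; nra.
  + by rewrite cmul0l cmul0r.
  + by move=> c x y [x1 x2] [y1 y2]; rewrite cmulDl cmulDr cmulZl cmulZr x1 x2 y1 y2.
  + by move=> x y [x1 x2] [y1 y2]; rewrite cmulA x1 -cmulA y2.
  + by move=> x [x1 x2]; split; rewrite -{1}oneS -cstarM ?x1 ?x2.
- by move=> v; split.
move=> e; split; last by rewrite -(isom_proj fam) -cmulA onePr.
by rewrite cmul_suml (bigD1 (src e)) //= (proj_isom E_sinks fam) eqxx big1 ?addr0 // => v ve;
  rewrite (proj_isom E_sinks fam) eq_sym (negbTE ve).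
Qed.

Let u1 := graph_unit.

Lemma graph_hom_eq (B : cstarAlgType R) (f g : A -> B) :
  is_star_hom f -> is_star_hom g -> (forall e, f (S e) = g (S e)) -> forall x, f x = g x.
Proof.
move=> fh gh fg; apply: (graph_cstar_gen A_graph (star_hom_equalizer_closed u1 fh gh)) => //=.
(* Every vertex receives an edge, so its projection is some $S_e^* S_e$. *)
move=> v; have [e <-] := E_sources v.
by rewrite -(ck_source fam) (star_homM fh) (star_homM gh) (star_homS fh) (star_homS gh) fg.
Qed.

Section Endomorphism.
Variables (k : nat) (tau : {perm gpath E k.+1}).
Hypothesis tau_fix : endpoint_fixing tau.
Variable lam : A -> A.
Hypothesis lam_tau : is_permutative_endo P S tau lam.

Let lam_hom : is_star_hom lam. Proof. by have [] := lam_tau. Qed.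

Lemma endo_isom e : lam (S e) = U tau ** S e. Proof. by have [] := lam_tau. Qed.

Lemma endo_one : lam one = one.
Proof.
by have [_ lamu _] := lam_tau; apply: unit_elt_unique (lamu _ u1) u1.
Qed.

Lemma endo_proj v : lam (P v) = P v.
Proof.
have [e <-] := E_sources v; rewrite -(ck_source fam) (star_homM lam_hom) (star_homS lam_hom).
rewrite endo_isom cstarM -cmulA (cmulA _^† _ (S e)).
by rewrite (perm_unitary_starM E_sinks fam u1 tau_fix) (u1 _).1.
Qed.

Lemma endo_word v a b : walk v (a ++ b) -> (k <= size b)%N ->
  lam (word a) ** word b = word (sweep tau (size a) (a ++ b)).
Proof.
elim: a v => [|e a IH] v; first by rewrite /= endo_one (u1 _).1.
move=> /andP[ev abw] kb; rewrite /= (star_homM lam_hom) -cmulA.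
rewrite (IH (rng e) abw kb) endo_isom -cmulA -[S e ** _]/(word (e :: _)).
have [|w1 _] := sweep_walk (n := size a) tau_fix abw; first by rewrite size_cat leq_add2l.
rewrite (@perm_unitary_word R E E_sinks A P S fam u1 k tau v) //=.
  by rewrite ev w1.
by rewrite sweep_size size_cat ltnS (leq_trans kb) // leq_addl.
Qed.

(* This property holds on the span of the elements [S_a S_b^*] with [size a = size b]; it is
   visibly stable under products, whereas expanding elements in matrix units is not needed. *)
Definition words n : set A := [set word a | a in [set a | size a = n]].

Definition core d := exists N, forall n, (N <= n)%N ->
  forall w, size w = n -> lspan (words n) (d ** word w).

Lemma core_one : core one.
Proof. by exists 0 => n _ w wn; rewrite (u1 _).1; apply: lspan_gen; exists w. Qed.

Lemma coreD d d' : core d -> core d' -> core (d + d').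
Proof.
move=> [N dN] [M dM]; exists (maxn N M) => n; rewrite geq_max => /andP[Nn Mn] w wn.
by rewrite cmulDl; apply: lspanD; [exact: dN | exact: dM].
Qed.

Lemma coreN d : core d -> core (- d).
Proof.
move=> [N dN]; exists N => n Nn w wn.
by rewrite cmulNl -scaleN1r; apply: lspanZ; exact: dN.
Qed.

Lemma core_sum (I : Type) (r : seq I) (D : pred I) (F : I -> A) :
  (forall i, D i -> core (F i)) -> core (\sum_(i <- r | D i) F i).
Proof.
move=> FG; apply: big_ind => //; last exact: coreD.
by exists 0 => n _ w _; rewrite cmul0l; exact: lspan_zero.
Qed.

Lemma coreM d d' : core d -> core d' -> core (d ** d').
Proof.
move=> [N dN] [M dM]; exists (maxn N M) => n; rewrite geq_max => /andP[Nn Mn] w wn.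
rewrite -cmulA; apply: lspan_mull (dM n Mn w wn) => _ [a an <-]; exact: dN.
Qed.

Lemma core_isom e f d : core d -> core (S e ** d ** (S f)^†).
Proof.
move=> [N dN]; exists N.+2 => -[|[|n]] // Nn [|g [|h w]] //= [wn].
rewrite -!cmulA (cmulA _^†) (isom_starM fam); case: eqVneq => [_|_]; last first.
  by rewrite cmul0l !cmul0r; exact: lspan_zero.
rewrite (cmulA (P _)) (proj_isom E_sinks fam); case: eqP => _; last first.
  by rewrite cmul0l !cmul0r; exact: lspan_zero.
have dw : lspan (words n.+1) (d ** word (h :: w)) by apply: dN; rewrite //= ?wn // ltnW.
apply: lspan_mull dw => _ [a an <-].
by apply: lspan_gen; exists (e :: a) => //=; rewrite an.
Qed.

Lemma core_unitary l (pi : {perm gpath E l.+1}) : endpoint_fixing pi -> core (U pi).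
Proof.
move=> fx; exists l.+1 => n ln w wn.
have [[v vw]|nw] := pselect (exists v, walk v w).
  rewrite (perm_unitary_word E_sinks fam u1 fx vw) ?wn //.
  by apply: lspan_gen; exists (prefix_act pi w); rewrite //= prefix_act_size.
rewrite (word_nonwalk0 E_sinks fam u1) ?cmul0r; first exact: lspan_zero.
  by rewrite wn (leq_ltn_trans _ ln).
by move=> v; apply/negP => vw; apply: nw; exists v.
Qed.

Lemma endo_core_words a b : size a = size b -> core (lam (word a) ** (lam (word b))^†).
Proof.
elim: a b => [|e a IH] [|f b] //=.
  by rewrite endo_one (unit_elt_cstar u1) (u1 _).1 => _; exact: core_one.
move=> [ab]; rewrite !(star_homM lam_hom) !endo_isom.
have -> : U tau ** S e ** lam (word a) ** (U tau ** S f ** lam (word b))^† =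
    U tau ** (S e ** (lam (word a) ** (lam (word b))^†) ** (S f)^†) ** (U tau)^†.
  by rewrite !cstarM !cmulA.
apply: coreM; last by rewrite (perm_unitaryS _ u1); exact/core_unitary/endpoint_fixingV.
by apply: coreM; [exact: core_unitary | apply: core_isom; exact: IH].
Qed.

Lemma endo_core_unitary l (pi : {perm gpath E l.+1}) : core (lam (U pi)).
Proof.
rewrite (perm_unitaryE _ u1) (star_hom_sum lam_hom); apply: core_sum => x _.
by rewrite (star_homM lam_hom) (star_homS lam_hom); apply: endo_core_words; rewrite !size_tuple.
Qed.

(** For words of equal positive length, $S_a^* S_b$ is 0 or a vertex projection, and [lam] fixes
    both. Hence [lam] fixes $S_a^* d S_w$ for long $a$ and $w$ of equal length, while it sends $d
    S_w$ to 0; so all these elements vanish. *)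
Lemma endo_core_inj d : core d -> lam d = 0 -> d = 0.
Proof.
move=> [N dN] d0; apply: (@word_test _ E E_sinks _ P S fam u1 N.+1) => // v w vw wn.
have dw := dN N.+1 (leqnSn N) w wn; set y := d ** word w in dw *.
have y0 : lam y = 0 by rewrite (star_homM lam_hom) d0 cmul0l.
apply: (can_inj (@cstarK R A)); rewrite cstar0.
apply: (@word_test _ E E_sinks _ P S fam u1 N.+1) => // v' a va an.
apply: (can_inj (@cstarK R A)); rewrite cstar0 cstarM cstarK.
suff fixed : lam ((word a)^† ** y) = (word a)^† ** y.
  by rewrite -fixed (star_homM lam_hom) y0 cmul0r.
elim: dw => [|c g z [b bn <-] _ IH]; first by rewrite cmul0r (star_hom0 lam_hom).
rewrite cmulDr cmulZr (star_homD lam_hom) (star_homZ lam_hom) IH; congr (_ *: _ + _).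
have [->|ab] := eqVneq a b; last first.
  by rewrite (word_star_neq0 E_sinks fam u1) ?bn // (star_hom0 lam_hom).
case: (pselect (exists u, walk u b)) => [[u ub]|nb].
  by rewrite (word_star_self E_sinks fam u1 _ ub) ?bn // endo_proj.
rewrite (word_nonwalk0 E_sinks fam u1) ?bn ?cmul0r ?(star_hom0 lam_hom) // => u.
by apply/negP => ub; apply: nb; exists u.
Qed.
End Endomorphism.

(** * The inverse of a synchronizing endomorphism *)

Section Inverse.
Variables (k : nat) (tau : {perm gpath E k.+1}).
Hypothesis tau_fix : endpoint_fixing tau.
Variable m : nat.
Hypotheses (tau_left : left_sync tau m) (tau_right : right_sync tau m).

Lemma conjugate_gpath (x : gpath E (m + m).+1) :
  exists y : gpath E (m + m).+1, [/\ psrc y = psrc x, prng y = prng x &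
   forall b, size b = k -> walk (psrc x) (pedges x ++ b) ->
    prefix_act tau (sweep tau (m + m).+1 (pedges y ++ b)) =
    sweep tau (m + m).+1 (pedges x ++ b)].
Proof.
have xw := gpath_walk x; have xs := size_tuple (pedges x); rewrite prngE.
case: (tval (pedges x)) xw xs => // e a eaw /eqP sa.
have am : size a = (m + m)%N by apply/eqP.
have [c cP] := conjugate_word_local tau_fix tau_left tau_right (psrc x) e am.
have [b bw bk] := walk_extension E_sinks (walk_end (psrc x) (e :: a)) k.
have eabw : walk (psrc x) (e :: a ++ b) by rewrite -cat_cons walk_cat bw andbT.
have [cs cw cE] := cP b bk eabw.
have cw' : walk (psrc x) c by move: cw; rewrite walk_cat => /andP[].
have [y y1 y2] := walk_gpath cw' cs.
exists y; split => //; last first.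
  by move=> b' b'k b'w; rewrite y2; have [_ _ ->] := cP b' b'k b'w.
rewrite prngE y1 y2.
have /andP[ex abw] : (src e == psrc x) && walk (rng e) (a ++ b) := eabw.
have [|_ e1] := sweep_walk (n := (m + m).+1) tau_fix cw.
  by rewrite size_cat cs bk.
have [|_ e2] := sweep_walk (n := m + m) tau_fix abw; first by rewrite size_cat am bk.
rewrite cE in e1; rewrite /walk_end /= -/(walk_end _ _) e2 in e1.
(* [e1] compares the ranges after appending [b]. For empty [b] this is the claim; otherwise both
   ranges are the source of [b]. *)
case: (posnP (size b)) => [/size0nil b0|b0].
  by move: e1; rewrite b0 !cats0.
apply: (walk_start b0 _ bw); by move: cw; rewrite walk_cat => /andP[].
Qed.

Definition conjugate_fun (x : gpath E (m + m).+1) := projT1 (cid (conjugate_gpath x)).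

Lemma conjugate_funP x :
  [/\ psrc (conjugate_fun x) = psrc x, prng (conjugate_fun x) = prng x &
   forall b, size b = k -> walk (psrc x) (pedges x ++ b) ->
    prefix_act tau (sweep tau (m + m).+1 (pedges (conjugate_fun x) ++ b)) =
    sweep tau (m + m).+1 (pedges x ++ b)].
Proof. exact: (projT2 (cid (conjugate_gpath x))). Qed.

Lemma conjugate_fun_inj : injective conjugate_fun.
Proof.
move=> x y xy; have [x1 x2 x3] := conjugate_funP x; have [y1 y2 y3] := conjugate_funP y.
have xyr : prng x = prng y by rewrite -x2 -y2 xy.
have [b bw bk] := walk_extension E_sinks (prng x) k.
have xb : walk (psrc x) (pedges x ++ b) by rewrite walk_cat gpath_walk -prngE bw.
have yb : walk (psrc y) (pedges y ++ b) by rewrite walk_cat gpath_walk -prngE -xyr bw.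
have := x3 b bk xb; rewrite xy (y3 b bk yb) => /esym.
move=> /(sweep_inj tau_fix xb yb); rewrite size_cat size_tuple bk leqnn => /(_ isT) /eqP.
by rewrite eqseq_cat ?size_tuple // => /andP[/eqP /gpath_pedges_inj].
Qed.

Definition conjugate_perm := perm conjugate_fun_inj.

Lemma conjugate_perm_fix : endpoint_fixing conjugate_perm.
Proof.
move=> u v; apply/eqP; rewrite eqEcard card_imset ?leqnn ?andbT; last exact: perm_inj.
apply/fintype.subsetP => _ /imsetP[x xuv ->]; move: xuv; rewrite !inE permE.
by have [-> -> _] := conjugate_funP x.
Qed.

Variable lam : A -> A.
Hypothesis lam_tau : is_permutative_endo P S tau lam.
Let lam_hom : is_star_hom lam. Proof. by have [] := lam_tau. Qed.

(** For a long path $w$ write $\tau w$ as the sweep of $x b$, so that $U_\tau S_w = \lambda(S_x)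
    S_b$. Then $\lambda(U_\pi)$ turns this into $\lambda(S_{\pi x}) S_b$, the word given by the
    sweep of $(\pi x) b$, which by the choice of $\pi$ is $\tau^{-1}\tau w = w$. *)
Lemma endo_conjugate_unitary : lam (U conjugate_perm) ** U tau = one.
Proof.
apply/eqP; rewrite -subr_eq0; apply/eqP.
apply: (@word_test _ E E_sinks _ P S fam u1 ((m + m).+1 + k)) => // v w vw wn.
have kw : (k < size w)%N by rewrite wn addSn ltnS leq_addl.
have [w1 _] := prefix_act_walk tau_fix vw kw.
rewrite cmulBl (u1 _).1 -cmulA (perm_unitary_word E_sinks fam u1 tau_fix vw kw).
have [|z [zw zs zE]] := @sweep_surj E k tau (m + m).+1 v _ tau_fix w1.
  by rewrite prefix_act_size wn.
rewrite prefix_act_size wn in zs.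
have z1w : walk v (take (m + m).+1 z).
  by move: zw; rewrite -{1}(cat_take_drop (m + m).+1 z) walk_cat => /andP[].
have [|x x1 x2] := walk_gpath (n := (m + m).+1) z1w; first by rewrite size_takel // zs leq_addr.
pose b := drop (m + m).+1 z; have bk : size b = k by rewrite size_drop zs addKn.
have zxb : z = pedges x ++ b by rewrite x2 cat_take_drop.
have xbw : walk (psrc x) (pedges x ++ b) by rewrite -zxb x1.
have [y1 y2 y3] := conjugate_funP x.
have ybw : walk (psrc x) (pedges (conjugate_fun x) ++ b).
  rewrite -y1 walk_cat gpath_walk -prngE y2 /=.
  by move: xbw; rewrite walk_cat => /andP[_].
have kb : (k <= size b)%N by rewrite bk.
have ex := endo_word tau_fix lam_tau xbw kb; rewrite size_tuple in ex.
have ey := endo_word tau_fix lam_tau ybw kb; rewrite size_tuple in ey.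
rewrite -zE zxb -ex.
rewrite cmulA -(star_homM lam_hom).
rewrite (perm_unitary_word E_sinks fam u1 conjugate_perm_fix (gpath_walk x)) ?size_tuple //.
rewrite -[tval (pedges x)]cats0 prefix_act_gpath cats0 permE.
rewrite ey.
have := y3 b bk xbw; rewrite -zxb zE.
have [|yw _] := sweep_walk (n := (m + m).+1) tau_fix ybw.
  by rewrite size_cat size_tuple bk.
move=> /(prefix_act_inj (v := psrc x) (v' := v)) -> //; first by rewrite subrr.
by rewrite sweep_size size_cat size_tuple bk addSn ltnS leq_addl.
Qed.

Lemma conjugate_endo : exists lam', is_permutative_endo P S conjugate_perm lam'.
Proof.
have pfam := perm_unitary_family E_sinks fam u1 conjugate_perm_fix.
have [f [fh fP fS]] := graph_cstar_univ A_graph pfam.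
exists f; split=> // u uu; have f1 : f one = one.
  by rewrite (star_hom_sum fh); apply: eq_bigr => v _; rewrite fP.
by rewrite (unit_elt_unique uu u1) f1; exact: u1.
Qed.

Lemma synchronized_inverse : exists lam' : A -> A,
  [/\ is_permutative_endo P S conjugate_perm lam', cancel lam lam' & cancel lam' lam].
Proof.
have [lam' lam'P] := conjugate_endo; have [lam'h _ lam'S] := lam'P.
have [_ _ lamS] := lam_tau.
have id_hom : is_star_hom (@id A) by split.
have lamlam' : cancel lam' lam.
  apply: (graph_hom_eq (star_hom_comp lam'h lam_hom) id_hom) => e /=.
  by rewrite lam'S (star_homM lam_hom) lamS cmulA endo_conjugate_unitary (u1 _).1.
exists lam'; split => //.
have unit' : lam' (U tau) ** U conjugate_perm = one.
  apply/eqP; rewrite -subr_eq0; apply/eqP.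
  apply: (endo_core_inj tau_fix lam_tau).
    apply: coreD; last exact/coreN/core_one.
    apply: coreM; first exact: (endo_core_unitary conjugate_perm_fix lam'P).
    exact: core_unitary conjugate_perm_fix.
  rewrite (star_homB lam_hom) (star_homM lam_hom) lamlam' (endo_one lam_tau).
  have UU : U tau ** (U tau)^† = one := perm_unitary_mulS E_sinks fam u1 tau_fix.
  have -> : lam (U conjugate_perm) = (U tau)^†.
    by rewrite -[LHS](u1 _).2 -UU cmulA endo_conjugate_unitary (u1 _).1.
  by rewrite UU subrr.
apply: (graph_hom_eq (star_hom_comp lam_hom lam'h) id_hom) => e /=.
by rewrite lamS (star_homM lam'h) lam'S cmulA unit' (u1 _).1.
Qed.
End Inverse.
End GraphAlgebra.

(** * The representation on the path space *)

Section PartialBijections.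
Variables (R : realType) (X : choiceType).
Local Notation H := (l2 R X).

(** The generators act as partial bijections of the basis. Carrying the inverse along gives the
    adjoint in closed form, as the pullback along the inverse. *)
Definition partial_inverse (g g' : X -> option X) :=
  forall x y, g y = Some x <-> g' x = Some y.

Definition pullback (g : X -> option X) (f : X -> R[i]) (y : X) : R[i] := oapp f 0 (g y).

Lemma partial_inverse_sym g g' : partial_inverse g g' -> partial_inverse g' g.
Proof. by move=> gg' x y; have [] := gg' y x. Qed.

Lemma sum_le_nsq (s : seq X) (f : H) : uniq s -> \sum_(x <- s) cdot (f x) (f x) <= nsq f.
Proof.
move=> us; apply: le_trans (sqsum_le_nsq [fset x in s]%fset f); rewrite /sqsum.
by rewrite (perm_big (enum_fset [fset x in s]%fset)) // uniq_perm // => x; rewrite !inE.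
Qed.

Lemma sqsum_pullback g g' (f : H) A : partial_inverse g g' -> sqsum A (pullback g f) <= nsq f.
Proof.
move=> gg'.
have -> : sqsum A (pullback g f) = \sum_(x <- pmap g A) cdot (f x) (f x).
  rewrite /sqsum; elim: (enum_fset A) => [|y s IH]; first by rewrite !big_nil.
  rewrite big_cons IH /pullback /=; case: (g y) => [x|] /=; first by rewrite big_cons.
  by rewrite cdot0l add0r.
apply: sum_le_nsq; apply: (@pmap_uniq _ _ g (fun x => odflt x (g' x))) => //.
by move=> y; case E : (g y) => [x|] //=; have [-> //] := gg' x y.
Qed.

Lemma pullback_l2 g g' (f : H) : partial_inverse g g' -> pullback g f \in @l2_pred R X.
Proof. by move=> gg'; apply/l2P; exists (nsq f) => A; exact: sqsum_pullback gg'. Qed.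

Section Operator.
Variables (g g' : X -> option X) (gg' : partial_inverse g g').

Definition pull (f : H) : H := L2 (pullback_l2 f gg').
Definition push (f : H) : H := L2 (pullback_l2 f (partial_inverse_sym gg')).

Lemma pull_nsq_le f : nsq (pull f) <= nsq f.
Proof. by apply: nsq_le => A; exact: sqsum_pullback gg'. Qed.

Lemma push_nsq_le f : nsq (push f) <= nsq f.
Proof. by apply: nsq_le => A; exact: sqsum_pullback (partial_inverse_sym gg'). Qed.

Lemma pull_push f y x : g y = Some x -> pull (push f) y = f y.
Proof. by move=> yx; rewrite /= /pullback yx /= ((gg' x y).1 yx). Qed.

Lemma push_pull f x y : g' x = Some y -> push (pull f) x = f x.
Proof. by move=> xy; rewrite /= /pullback xy /= ((gg' x y).2 xy). Qed.

Lemma pullK f : pull (push (pull f)) = pull f.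
Proof.
apply: l2_inj => y; case E : (g y) => [x|]; first exact: pull_push E.
by rewrite /= /pullback E.
Qed.

Lemma pushD f h : push (f + h) = push f + push h.
Proof. by apply: l2_inj => x; rewrite l2D /= /pullback; case: (g' x) => //=; rewrite addr0. Qed.

Lemma pullD f h : pull (f + h) = pull f + pull h.
Proof. by apply: l2_inj => x; rewrite l2D /= /pullback; case: (g x) => //=; rewrite addr0. Qed.

Lemma pullN f : pull (- f) = - pull f.
Proof. by apply: l2_inj => x; rewrite l2N /= /pullback; case: (g x) => //=; rewrite oppr0. Qed.

Lemma pushN f : push (- f) = - push f.
Proof. by apply: l2_inj => x; rewrite l2N /= /pullback; case: (g' x) => //=; rewrite oppr0. Qed.

Lemma nsq_pull f : nsq (pull f) = nsq (push (pull f)).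
Proof.
by apply/eqP; rewrite eq_le push_nsq_le andbT -{1}pullK pull_nsq_le.
Qed.

(** Both pairings only see the points matched by [g] and [g']. There the transport preserves [nsq],
    and [ip] is obtained from [nsq] by polarization. *)
Lemma pull_adjoint : adjoint_to pull push.
Proof.
move=> f h.
have -> : ip (pull f) h = ip (pull f) (pull (push h)).
  apply: ip_eq => y; case E : (g y) => [x|]; first by rewrite (pull_push _ E).
  by rewrite /= /pullback E /= !cdot0l.
have -> : ip f (push h) = ip (push (pull f)) (push (pull (push h))).
  apply: ip_eq => x; case E : (g' x) => [y|]; first by rewrite !(push_pull _ E).
  by rewrite cdotC [RHS]cdotC /= /pullback E /= !cdot0l.
by rewrite /ip -!pullN -!pushN -!pullD -!pushD -!pullN -!pullD !nsq_pull (pushN h).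
Qed.

Lemma pull_bop : pull \in @bop_pred R X.
Proof.
apply/bop_predP; split; last by exists push; exact: pull_adjoint.
  by move=> c f; apply: l2_inj => x; rewrite l2Z /= /pullback; case: (g x) => //=; rewrite mulr0.
exists 1 => f; rewrite mul1r; apply: l2norm_le; first exact: l2norm_ge0.
by rewrite l2norm_sq pull_nsq_le.
Qed.

Definition pullop : bop R X := Bop pull_bop.

End Operator.

Lemma pullopE g g' (gg' : partial_inverse g g') (f : H) y :
  pullop gg' f y = oapp f 0 (g y).
Proof. by []. Qed.

Lemma pullopS g g' (gg' : partial_inverse g g') (f : H) x :
  (pullop gg')^† f x = oapp f 0 (g' x).
Proof.
have /(congr1 (@^~ f)) E := @adj_unique R X (pullop gg') _ (pull_adjoint gg').
by rewrite -[(pullop gg')^† f]/(adj (pullop gg') f) E.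
Qed.

Lemma delta_l2 (x : X) : (fun y => (y == x)%:R) \in @l2_pred R X.
Proof.
apply/l2P; exists 1 => A; rewrite /sqsum; case: (boolP (x \in A)) => xA.
  rewrite (big_fsetD1 x) //= eqxx big_seq big1 ?addr0 => [|y].
    by rewrite /cdot /= mulr0 mulr1 addr0.
  by rewrite !inE => /andP[/negbTE -> _]; rewrite cdot0l.
rewrite big_seq big1 // => y yA; case: eqP => [yx|_]; last by rewrite cdot0l.
by rewrite -yx yA in xA.
Qed.

Definition delta x : H := L2 (delta_l2 x).

(** Letting the scalar [d] vary recovers the complex entry [f y] from the real pairing
    ([cdot_inj]). *)
Lemma ip_scale_delta f d y : ip f (d *: delta y) = cdot (f y) d.
Proof.
apply: ip_unique; apply: cvg_near_cst; first exact: finite_parts_filter.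
exists [fset y]%fset => // A /= yA.
have {}yA : y \in A by apply: (fsubsetP yA); rewrite inE.
have dE z : (d *: delta y : H) z = d * (z == y)%:R by [].
rewrite /dotsum (big_fsetD1 y) // dE eqxx mulr1 big_seq big1 => [|z]; first by rewrite /= addr0.
by rewrite !inE => /andP[/negbTE zy _]; rewrite dE zy mulr0 cdotC cdot0l.
Qed.

Lemma cdot_inj (z w : R[i]) : (forall d, cdot z d = cdot w d) -> z = w.
Proof.
move=> zw; have := zw 1; have := zw (Complex 0 1).
by case: z w {zw} => [a b] [c d]; rewrite /cdot /= !mulr0 !mulr1 !add0r !addr0 => -> ->.
Qed.

Lemma ip_delta_inj f h x y :
  (forall d, ip f (d *: delta x) = ip h (d *: delta y)) -> f x = h y.
Proof. by move=> E; apply: cdot_inj => d; rewrite -!ip_scale_delta. Qed.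

Lemma delta_norm_le1 x : l2norm (delta x) <= 1.
Proof.
apply: l2norm_le => //; rewrite -ipxx -{2}(scale1r (delta x)) ip_scale_delta /= eqxx.
by rewrite /cdot /= mulr0 mulr1 addr0 expr1n.
Qed.

Lemma entry_le (T : bop R X) x y : cdot (T (delta x) y) (T (delta x) y) <= cnrm T ^+ 2.
Proof.
rewrite (le_trans (cdot_le_opnorm _ _ _)) // /cnrm bop_normE /=.
rewrite ler_pXn2r ?nnegrE ?mulr_ge0 ?opnorm_ge0 ?l2norm_ge0 //.
by rewrite ler_piMr ?opnorm_ge0 ?delta_norm_le1.
Qed.

End PartialBijections.

(** * Infinite paths and the operators prepending an edge *)

Section PathSpace.
Variables (R : realType) (E : digraph).
Local Notation X := (nat -> edge E).
Implicit Types (x y z : X) (e f : edge E) (v : vert E) (w : seq (edge E)).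

Definition ipath x := forall i, rng (x i) = src (x i.+1).
Definition ishift n x : X := fun i => x (n + i)%N.
Definition icons e x : X := fun i => if i is j.+1 then x j else e.
Definition icat w x : X := foldr icons x w.

Lemma icons_ipath e x : rng e = src (x 0%N) -> ipath x -> ipath (icons e x).
Proof. by move=> ex xp [|i] //=; exact: xp. Qed.

Lemma ishift_ipath n x : ipath x -> ipath (ishift n x).
Proof. by move=> xp i; rewrite /ishift xp addnS. Qed.

Lemma ishift_icons e x : ishift 1 (icons e x) = x.
Proof. by []. Qed.

Lemma icons_ishift x : icons (x 0%N) (ishift 1 x) = x.
Proof. by apply/funext => -[]. Qed.

Lemma icat_ipath v w x : ipath x -> walk v w -> walk_end v w = src (x 0%N) ->
  ipath (icat w x) /\ src (icat w x 0%N) = v.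
Proof.
elim: w v => [|e w IH] v xp //= /andP[/eqP ev ww] we.
have [p1 p2] := IH _ xp ww we; split => //; apply: icons_ipath => //.
Qed.

Lemma icat_size w x i : icat w x (size w + i)%N = x i.
Proof. by elim: w. Qed.

Lemma ishift_icat w x : ishift (size w) (icat w x) = x.
Proof. by apply/funext => i; rewrite /ishift icat_size. Qed.

Lemma mkseq_icat w x : mkseq (icat w x) (size w) = w.
Proof.
elim: w => //= e w IH; rewrite /mkseq /= -[iota 1 _]/(iota (1 + 0) _) iotaDl -map_comp.
by congr cons; rewrite -{3}IH.
Qed.

Lemma icat_mkseq x n : icat (mkseq x n) (ishift n x) = x.
Proof.
elim: n x => [|n IH] x //.
rewrite /mkseq /= -[iota 1 _]/(iota (1 + 0) _) iotaDl -map_comp.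
rewrite -[in RHS](icons_ishift x) -[in RHS](IH (ishift 1 x)).
by [].
Qed.

Lemma icat_cat w w' x : icat (w ++ w') x = icat w (icat w' x).
Proof. exact: foldr_cat. Qed.

Lemma mkseq_walk x n : ipath x -> walk (src (x 0%N)) (mkseq x n) /\
  walk_end (src (x 0%N)) (mkseq x n) = src (x n).
Proof.
move=> xp; elim: n => [|n [IH1 IH2]] //.
by rewrite mkseqS -cats1 walk_cat walk_end_cat IH1 IH2 /= eqxx /walk_end /= xp.
Qed.

(** The basis is indexed by all sequences of edges; the partial maps are defined on infinite paths
    only, so every other sequence is sent to 0. *)
Definition isom_pull e y := if `[< ipath y >] && (y 0%N == e) then Some (ishift 1 y) else None.
Definition isom_push e x := if `[< ipath x >] && (src (x 0%N) == rng e) then Some (icons e x) else None.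
Definition vert_pull v x := if `[< ipath x >] && (src (x 0%N) == v) then Some x else None.

Lemma isom_partial_inverse e : partial_inverse (isom_pull e) (isom_push e).
Proof.
move=> x y; rewrite /isom_pull /isom_push; split.
  case: ifP => // /andP[/asboolP yp /eqP ye] [<-].
  rewrite asboolT; last exact: ishift_ipath.
  by rewrite -ye -(yp 0) eqxx /= icons_ishift.
case: ifP => // /andP[/asboolP xp /eqP xe] [<-].
by rewrite asboolT /= ?eqxx //; apply: icons_ipath.
Qed.

Lemma vert_partial_inverse v : partial_inverse (vert_pull v) (vert_pull v).
Proof. by move=> x y; rewrite /vert_pull; split; case: ifP => // xv [<-]; rewrite xv. Qed.

Definition path_isom e : bop R X := pullop R (isom_partial_inverse e).
Definition path_proj v : bop R X := pullop R (vert_partial_inverse v).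

Lemma path_isomE e (f : l2 R X) y : path_isom e f y =
  if `[< ipath y >] && (y 0%N == e) then f (ishift 1 y) else 0.
Proof. by rewrite pullopE /isom_pull; case: ifP. Qed.

Lemma path_isomSE e (f : l2 R X) x : (path_isom e)^† f x =
  if `[< ipath x >] && (src (x 0%N) == rng e) then f (icons e x) else 0.
Proof. by rewrite pullopS /isom_push; case: ifP. Qed.

Lemma path_projE v (f : l2 R X) x : path_proj v f x =
  if `[< ipath x >] && (src (x 0%N) == v) then f x else 0.
Proof. by rewrite pullopE /vert_pull; case: ifP. Qed.

Lemma bop_mulE (T U : bop R X) (f : l2 R X) : (T ** U) f = T (U f). Proof. by []. Qed.

Lemma bop_sumE (I : Type) (r : seq I) (D : pred I) (F : I -> bop R X) (f : l2 R X) x :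
  (\sum_(i <- r | D i) F i) f x = \sum_(i <- r | D i) F i f x.
Proof. by elim/big_rec2: _ => // i a b _ <-. Qed.

Lemma path_family : cuntz_krieger_family path_proj path_isom.
Proof.
apply: cuntz_krieger_intro.
- move=> v; split; apply: bop_inj => f; apply: l2_inj => x.
    by rewrite pullopS path_projE /vert_pull; case: ifP.
  by rewrite bop_mulE !path_projE; case: (_ && _).
- move=> v w vw; apply: bop_inj => f; apply: l2_inj => x.
  rewrite bop_mulE !path_projE bop0 l20.
  case: asboolP => //= _; case: eqP => // ->; by rewrite (negbTE vw).
- move=> e; apply: bop_inj => f; apply: l2_inj => x.
  rewrite bop_mulE path_isomSE path_projE; case: asboolP => xp; rewrite ?andTb ?andFb //; case: eqP => // xe.
  by rewrite path_isomE eqxx asboolT //; exact: icons_ipath.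
- move=> e e' ee'; apply: bop_inj => f; apply: l2_inj => x.
  rewrite bop_mulE path_isomSE bop0 l20; case: ifP => // _.
  by rewrite path_isomE [icons _ _ _]/= (negbTE ee') andbF.
move=> v; apply: bop_inj => f; apply: l2_inj => x.
rewrite bop_sumE path_projE.
have term e : (path_isom e ** (path_isom e)^†) f x =
    if `[< ipath x >] && (x 0%N == e) then f x else 0.
  rewrite bop_mulE path_isomE; case: asboolP => xp; rewrite ?andTb ?andFb //; case: eqP => // <-.
  rewrite path_isomSE icons_ishift asboolT; last exact: ishift_ipath.
  by rewrite /ishift -(xp 0) eqxx.
under eq_bigr do rewrite term.
case: asboolP => /= xp; last by rewrite big1.
case: eqP => xv; last first.
  by rewrite big1 // => e /eqP ev; case: eqP => // xe; case: xv; rewrite xe.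
rewrite (bigD1 (x 0%N)) /= ?xv // eqxx big1 ?addr0 // => e /andP[_ ex].
by rewrite eq_sym (negbTE ex).
Qed.

Lemma path_isom_delta e x : ipath x -> rng e = src (x 0%N) ->
  path_isom e (delta R x) = delta R (icons e x).
Proof.
move=> xp ex; apply: l2_inj => y; rewrite path_isomE /=.
have [->|yx] := eqVneq y (icons e x).
  by rewrite /= eqxx asboolT ?ishift_icons ?eqxx //; exact: icons_ipath.
case: ifP => // /andP[_ /eqP ye]; case: eqP => // yx'.
by rewrite -yx' -ye icons_ishift eqxx in yx.
Qed.

Lemma path_proj_delta v x : ipath x -> path_proj v (delta R x) =
  if src (x 0%N) == v then delta R x else 0.
Proof.
move=> xp; apply: l2_inj => y; rewrite path_projE /=.
have [->|yx] := eqVneq y x; first by rewrite asboolT //=; case: ifP => //=; rewrite eqxx.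
by case: ifP; case: ifP => //=; rewrite (negbTE yx).
Qed.

End PathSpace.

(** * Paths without small periods *)

Section AperiodicPaths.
Variable E : digraph.
Hypotheses (E_sinks : no_sinks E) (E_exits : every_cycle_has_exit E).
Implicit Types (x y z : nat -> edge E) (v : vert E) (w : seq (edge E)).

Lemma ipath_from v : exists2 z, ipath z & src (z 0%N) = v.
Proof.
pose out u := projT1 (cid (E_sinks u)).
have outP u : src (out u) = u by exact: (projT2 (cid (E_sinks u))).
exists (fun i => out (iter i (fun u => rng (out u)) v)) => [i|] /=; last exact: outP.
by rewrite outP.
Qed.

(* If [z] repeats with period [d] from position [n] on, then it runs through a cycle;
   leaving this cycle through an exit breaks the repetition. *)
Lemma break_period z n d : ipath z -> (0 < d)%N ->
  exists y i, [/\ ipath y, src (y 0%N) = src (z 0%N),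
    forall j, (j < n)%N -> y j = z j, (n <= i)%N & y (i + d)%N <> y i].
Proof.
move=> zp d0.
have [[i [ni iz]]|per] := pselect (exists i, (n <= i)%N /\ z (i + d)%N <> z i).
  by exists z, i; split.
have {}per i : (n <= i)%N -> z (i + d)%N = z i.
  by move=> ni; apply: contrapT => iz; apply: per; exists i.
case: d d0 per => // d _ per.
have [cw ce] := mkseq_walk d.+1 (ishift_ipath n zp).
have [c c1 c2] := walk_gpath cw (size_mkseq _ d.+1).
have [|i] := E_exits (x := c).
  rewrite prngE c1 c2 ce /ishift addn0 addnS -addSn -/(n.+1 + d)%N.
  by rewrite addSn -addnS per.
rewrite (tnth_nth (z 0%N)) c2 nth_mkseq // => two.
have [g /eqP gs gz] : exists2 g, src g == src (z (n + i)%N) & g != z (n + i)%N.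
  have : (0 < #|[predD1 [pred e | src e == src (ishift n z i)] & ishift n z i]|)%N.
    by move: two; rewrite (cardD1 (ishift n z i)) inE eqxx add1n ltnS.
  by move=> /card_gt0P[g]; rewrite !inE => /andP[gz gs]; exists g.
have [u up us] := ipath_from (rng g).
(* [m] is one period after [n + i], where [z] would use the edge [z (n + i)] again; the new path
   takes the exit [g] there. *)
pose m := (n + i + d.+1)%N; pose w := rcons (mkseq z m) g.
have sw : size w = m.+1 by rewrite size_rcons size_mkseq.
have [zw ze] := mkseq_walk m zp.
have ww : walk (src (z 0%N)) w.
  by rewrite /w -cats1 walk_cat zw ze /= gs /m per ?leq_addr ?eqxx.
have we : walk_end (src (z 0%N)) w = src (u 0%N).
  by rewrite /w -cats1 walk_end_cat /walk_end /= us.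
have [yp ys] := icat_ipath up ww we.
have yE j : (j < m)%N -> icat w u j = z j.
  move=> jm; have := mkseq_icat w u; rewrite sw => E1.
  have : nth (z 0%N) (mkseq (icat w u) m.+1) j = nth (z 0%N) w j by rewrite E1.
  rewrite nth_mkseq; last exact: ltnW jm.
  by rewrite /w nth_rcons size_mkseq jm nth_mkseq.
exists (icat w u), (n + i)%N; split => //; last 2 first.
- exact: leq_addr.
- rewrite -/m (yE (n + i)%N); last by rewrite /m addnS ltnS leq_addr.
  have := mkseq_icat w u; rewrite sw => E1.
  have : nth (z 0%N) (mkseq (icat w u) m.+1) m = nth (z 0%N) w m by rewrite E1.
  rewrite nth_mkseq // /w nth_rcons size_mkseq ltnn eqxx => ->.
  by apply/eqP.
by move=> j jn; apply: yE; rewrite /m (leq_trans jn) // -addnA leq_addr.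
Qed.

(** Only finitely many periods are excluded, each by a violation at or after [J], so that they can
    be broken one after the other. *)
Definition aperiodic M J z := forall d, (0 < d <= M)%N ->
  exists2 i, (J <= i)%N & z (i + d)%N <> z i.

Lemma aperiodic_mono M M' J J' z : (M <= M')%N -> (J <= J')%N ->
  aperiodic M' J' z -> aperiodic M J z.
Proof.
move=> MM JJ za d /andP[d0 dM]; have [|i Ji iz] := za d; first by rewrite d0 (leq_trans dM).
by exists i => //; exact: leq_trans Ji.
Qed.

Lemma aperiodic_icat M J w z : aperiodic M J z -> aperiodic M J (icat w z).
Proof.
move=> za d /za[i Ji iz]; exists (size w + i)%N; first by rewrite (leq_trans Ji) // leq_addl.
by rewrite -addnA !icat_size.
Qed.

Lemma aperiodic_path_ex M J v : exists z, [/\ ipath z, src (z 0%N) = v & aperiodic M J z].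
Proof.
(* The bound [n] confines the violations found so far to a finite prefix, which the next
   modification leaves intact. *)
suff [z [n [zp zv za]]] : exists z n, [/\ ipath z, src (z 0%N) = v &
    forall d, (0 < d <= M)%N -> exists i, [/\ (J <= i)%N, (i + d < n)%N & z (i + d)%N <> z i]].
  by exists z; split => // d /za[i [Ji _ iz]]; exists i.
elim: M => [|M [z [n [zp zv za]]]].
  have [z zp zv] := ipath_from v; exists z, 0%N; split => // d.
  by case: d.
have [y [i [yp ys yz ni iy]]] := break_period (maxn J n) zp (ltn0Sn M).
exists y, (maxn n (i + M.+1).+1); split => //; first by rewrite ys.
move=> d /andP[d0]; rewrite leq_eqVlt => /orP[/eqP ->|dM].
  exists i; split => //; first by rewrite (leq_trans (leq_maxl J n)).
  by rewrite leq_maxr.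
have [|j [Jj jn jz]] := za d; first by rewrite d0.
exists j; split => //; first by rewrite (leq_trans jn) // leq_maxl.
rewrite !yz //; first by rewrite (leq_trans _ (leq_maxr J n)) // (leq_ltn_trans _ jn) ?leq_addr.
by rewrite (leq_trans jn) // leq_maxr.
Qed.
End AperiodicPaths.

(** * Surjective endomorphisms synchronize *)

Section SweepStates.
Variables (E : digraph) (k : nat) (tau : {perm gpath E k.+1}).
Hypothesis tau_fix : endpoint_fixing tau.
Implicit Types (v : vert E) (a b w z : seq (edge E)).

(* Reading the word [w] of length [n + k], the transducer outputs [a] and ends in the
   state [b]. *)
Definition sweeps_from n w a b :=
  exists v, [/\ walk v (a ++ b), size a = n, size b = k & w = sweep tau n (a ++ b)].

Lemma sweeps_from_ex n v w : walk v w -> size w = (n + k)%N -> exists a b, sweeps_from n w a b.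
Proof.
move=> vw wn; have [|z [vz zs zw]] := sweep_surj (n := n) tau_fix vw; first by rewrite wn.
rewrite wn in zs; exists (take n z), (drop n z), v; rewrite cat_take_drop; split => //.
  by rewrite size_takel // zs leq_addr.
by rewrite size_drop zs addKn.
Qed.

Lemma sweeps_from_inj n w a b a' b' : sweeps_from n w a b -> sweeps_from n w a' b' ->
  a = a' /\ b = b'.
Proof.
move=> [v [abw an bk ->]] [v' [abw' an' bk' E1]].
have sw : (n + k <= size (a ++ b))%N by rewrite size_cat an bk.
have /eqP := sweep_inj tau_fix abw abw' sw E1.
by rewrite eqseq_cat ?an ?an' // => /andP[/eqP -> /eqP ->].
Qed.

(** The state reached by the first run is the input of the second. Positivity of [k] makes the word
    of this state nonempty, so that it fixes the vertex at which the two outputs are joined. *)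
Lemma sweeps_from_cat p q w y a b a' b' : (0 < k)%N ->
  sweeps_from p w a b -> sweeps_from q (b ++ y) a' b' -> size y = q ->
  sweeps_from (p + q) (w ++ y) (a ++ a') b'.
Proof.
move=> k0 [v [abw ap bk ->]] [v' [abw' aq bk' byE]] yq; exists v.
have b0 : (0 < size b)%N by rewrite bk.
have /andP[aw bw] : walk v a && walk (walk_end v a) b by rewrite -walk_cat.
have [|sw _] := sweep_walk (n := q) tau_fix abw'; first by rewrite size_cat aq bk'.
rewrite -byE walk_cat in sw; have /andP[bw' _] := sw.
have vv' : walk_end v a = v' := walk_start b0 bw bw'.
split=> //; first by rewrite -catA walk_cat aw vv'.
  by rewrite size_cat ap aq.
rewrite -sweep_cat; last by rewrite size_cat ap bk.
by rewrite -[(a ++ b) ++ y]catA byE -ap -sweep_add catA.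
Qed.

Lemma sweeps_from_take n m w a b : (n <= m)%N -> sweeps_from m w a b ->
  exists s, sweeps_from n (take (n + k) w) (take n a) s.
Proof.
move=> nm [v [abw am bk ->]].
have a1 : size (take n a) = n by rewrite size_takel // am.
have a2 : size (drop n a ++ b) = (m - n + k)%N by rewrite size_cat size_drop am bk.
have aE : a ++ b = take n a ++ (drop n a ++ b) by rewrite catA cat_take_drop.
exists (take k (sweep tau (m - n) (drop n a ++ b))), v.
have ts : size (take k (sweep tau (m - n) (drop n a ++ b))) = k.
  by rewrite size_takel // sweep_size a2 leq_addl.
rewrite aE walk_cat in abw; have /andP[w1 w2] := abw.
split=> //.
  rewrite walk_cat w1 /=.
  have [|w3 _] := sweep_walk (n := (m - n)%N) tau_fix w2; first by rewrite a2.
  by move: w3; rewrite -{1}(cat_take_drop k (sweep _ _ _)) walk_cat => /andP[].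
rewrite aE -{1}(subnKC nm) (sweep_split tau a1 a2) take_size_cat //.
by rewrite sweep_size size_cat a1 ts.
Qed.

End SweepStates.

(** * Density of the span of the products $S_a S_b^*$ *)

Section Density.
Variables (R : realType) (E : digraph).
Hypotheses (E_sinks : no_sinks E) (E_sources : no_sources E).
Variables (A : cstarAlgType R) (P : vert E -> A) (S : edge E -> A).
Hypothesis A_graph : is_graph_cstar P S.
Let fam := graph_cstar_family A_graph.
Let one : A := \sum_v P v.
Let u1 : is_unit_elt one := graph_unit E_sinks A_graph.
Local Notation word := (word P S).

(** Nonempty words suit the formulas for $S_a^* S_a$ and for the decoding of paths; the unit still
    lies in the span because $P_v$ is a sum of $S_e S_e^*$ ([one_span]). *)
Definition word_pairs : set A :=
  [set g | exists a b, [/\ (0 < size a)%N, (0 < size b)%N & g = word a ** (word b)^†]].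

Definition approximable x := forall r : R, 0 < r ->
  exists2 y, lspan word_pairs y & cnrm (x - y) < r.

Lemma approximableD x y : approximable x -> approximable y -> approximable (x + y).
Proof.
move=> xa ya r r0; have r2 : 0 < r / 2 by rewrite divr_gt0.
have [x' x1 x2] := xa _ r2; have [y' y1 y2] := ya _ r2.
exists (x' + y'); first exact: lspanD.
have -> : x + y - (x' + y') = (x - x') + (y - y') by rewrite opprD addrACA.
have := cnrmD (x - x') (y - y'); lra.
Qed.

Lemma approximable_mull a x :
  (forall g, word_pairs g -> lspan word_pairs (a ** g)) -> approximable x -> approximable (a ** x).
Proof.
move=> aW xa r r0; have d0 : 0 < cnrm a + 1 by rewrite ltr_wpDl ?cnrm_ge0.
have [y y1 y2] := xa _ (divr_gt0 r0 d0); exists (a ** y); first exact: lspan_mull aW y1.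
rewrite -cmulBr (le_lt_trans (cnrmM _ _)) //; move: y2; rewrite ltr_pdivlMr //.
have := cnrm_ge0 a; have := cnrm_ge0 (x - y); lra.
Qed.

Lemma approximableZ c x : approximable x -> approximable (c *: x).
Proof.
move=> xa; have -> : c *: x = (c *: one) ** x by rewrite cmulZl (u1 x).1.
apply: approximable_mull xa => g gW; rewrite cmulZl (u1 g).1.
by apply: lspanZ; apply: lspan_gen.
Qed.

Lemma pair_span a b : (0 < size a)%N -> (0 < size b)%N ->
  lspan word_pairs (word a ** (word b)^†).
Proof. by move=> a0 b0; apply: lspan_gen; exists a, b. Qed.

Lemma proj_pairs v g : word_pairs g -> lspan word_pairs (P v ** g).
Proof.
move=> [[|e a] [b [// _ b0 ->]]]; rewrite cmulA (proj_word E_sinks fam).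
by case: eqP => _; [exact: pair_span | rewrite cmul0l; exact: lspan_zero].
Qed.

Lemma isom_pairs e g : word_pairs g -> lspan word_pairs (S e ** g).
Proof. by move=> [a [b [a0 b0 ->]]]; rewrite cmulA; apply: (pair_span (a := e :: a)). Qed.

Lemma proj_span v b : (0 < size b)%N -> lspan word_pairs (P v ** (word b)^†).
Proof.
move=> b0; rewrite (proj_sum E_sinks fam) cmul_suml; apply: lspan_sum => e _.
rewrite -cmulA -cstarM -(word1 S u1 e) -(word_cat S u1).
by apply: pair_span; rewrite // size_cat addn1.
Qed.

Lemma isomS_pairs e g : word_pairs g -> lspan word_pairs ((S e)^† ** g).
Proof.
move=> [[|f a] [b [// _ b0 ->]]]; rewrite /= !cmulA (isom_starM fam).
case: eqP => _; last by rewrite !cmul0l; exact: lspan_zero.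
case: a => [|f' a]; last first.
  by rewrite -cmulA; apply: proj_pairs; exists (f' :: a), b.
by rewrite /= (u1 _).2; exact: proj_span.
Qed.

Lemma one_span : lspan word_pairs one.
Proof.
apply: lspan_sum => v _; rewrite (proj_sum E_sinks fam); apply: lspan_sum => e _.
by rewrite -(word1 S u1 e); exact: pair_span.
Qed.

Lemma span_approximable x : lspan word_pairs x -> approximable x.
Proof. by move=> xW r r0; exists x => //; rewrite subrr cnrm0. Qed.

(** The elements that preserve approximability under left multiplication, together with their
    adjoints, form a closed star subalgebra containing the generators. So every [x] is one of them,
    and it is applied to the unit. *)
Lemma word_pairs_dense x : approximable x.
Proof.
rewrite -[x](u1 x).2.
suff : forall y, approximable y -> approximable (x ** y) /\ approximable (x^† ** y).
  by move=> H; have [] := H one (span_approximable one_span).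
pose multiplier := [set a | forall y, approximable y ->
  approximable (a ** y) /\ approximable (a^† ** y)].
apply: (graph_cstar_gen A_graph (B := multiplier)); rewrite /multiplier /=.
- split=> /=.
  + apply: approx_closed => a aP y ya.
    have mult_close b : cnrm (a - b) = cnrm (a^† - b^†) by rewrite -cstarB cnrm_cstar.
    have close (r : R) : 0 < r -> exists b, [/\ approximable (b ** y), approximable (b^† ** y),
        cnrm (a - b) * cnrm y < r & cnrm (a^† - b^†) * cnrm y < r].
      move=> r0; have d0 : 0 < cnrm y + 1 by rewrite ltr_wpDl ?cnrm_ge0.
      have [b /= bP ab] := aP _ (divr_gt0 r0 d0); have [b1 b2] := bP y ya.
      have lt1 : cnrm (a - b) * cnrm y < r.
        move: ab; rewrite ltr_pdivlMr //; have := cnrm_ge0 y; have := cnrm_ge0 (a - b); lra.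
      by exists b; rewrite -mult_close.
    split=> r r0; have r2 : 0 < r / 2 by rewrite divr_gt0.
      have [b [b1 _ ab _]] := close _ r2; have [z z1 z2] := b1 _ r2.
      exists z => //; have -> : a ** y - z = (a - b) ** y + (b ** y - z).
        by rewrite cmulBl addrA subrK.
      have := cnrmD ((a - b) ** y) (b ** y - z); have := cnrmM (a - b) y; lra.
    have [b [_ b1 _ ab]] := close _ r2; have [z z1 z2] := b1 _ r2.
    exists z => //; have -> : a^† ** y - z = (a^† - b^†) ** y + (b^† ** y - z).
      by rewrite cmulBl addrA subrK.
    have := cnrmD ((a^† - b^†) ** y) (b^† ** y - z); have := cnrmM (a^† - b^†) y; lra.
  + by move=> y _; rewrite cstar0 !cmul0l; split; apply: span_approximable; exact: lspan_zero.
  + move=> c a b aP bP y ya; have [a1 a2] := aP y ya; have [b1 b2] := bP y ya.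
    rewrite cstarD cstarZ !cmulDl !cmulZl.
    by split; apply: approximableD => //; exact: approximableZ.
  + move=> a b aP bP y ya; rewrite cstarM -!cmulA.
    by split; [apply: (aP _ _).1; apply: (bP _ _).1 | apply: (bP _ _).2; apply: (aP _ _).2].
  + by move=> a aP y ya; rewrite cstarK; have [] := aP y ya.
- move=> v y ya; rewrite (projS fam).
  by split; apply: approximable_mull ya => g; exact: proj_pairs.
move=> e y ya.
by split; apply: approximable_mull ya => g; [exact: isom_pairs | exact: isomS_pairs].
Qed.

End Density.

(** * Matrix entries of a surjective permutative endomorphism *)

Section SurjectiveEndomorphism.
Variables (R : realType) (E : digraph).
Hypotheses (E_sinks : no_sinks E) (E_sources : no_sources E).
Hypothesis E_exits : every_cycle_has_exit E.
Variables (A : cstarAlgType R) (P : vert E -> A) (S : edge E -> A).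
Hypothesis A_graph : is_graph_cstar P S.
Let fam := graph_cstar_family A_graph.
Let one : A := \sum_v P v.
Let u1 : is_unit_elt one := graph_unit E_sinks A_graph.
Local Notation word := (word P S).
Local Notation U := (perm_unitary P S).
Variables (k : nat) (tau : {perm gpath E k.+1}).
Hypothesis tau_fix : endpoint_fixing tau.
Variable lam : A -> A.
Hypothesis lam_tau : is_permutative_endo P S tau lam.
Let lam_hom : is_star_hom lam. Proof. by have [] := lam_tau. Qed.

Local Notation X := (nat -> edge E).
Local Notation dl := (delta R).
Implicit Types (x y z : X) (a b w : seq (edge E)).

Variable rho : A -> bop R X.
Hypotheses (rho_hom : is_star_hom rho) (rhoP : forall v, rho (P v) = path_proj R v)
  (rhoS : forall e, rho (S e) = path_isom R e).

Let psi := rho \o lam.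
Let psi_hom : is_star_hom psi := star_hom_comp lam_hom rho_hom.

Lemma rho_one z : ipath z -> rho one (dl z) = dl z.
Proof.
move=> zp; rewrite (star_hom_sum rho_hom); apply: l2_inj => y; rewrite bop_sumE.
rewrite (bigD1 (src (z 0%N))) //= rhoP path_proj_delta // eqxx big1 ?addr0 // => v vz.
by rewrite rhoP path_proj_delta // eq_sym (negbTE vz).
Qed.

Lemma rho_word v w z : ipath z -> walk v w -> walk_end v w = src (z 0%N) ->
  rho (word w) (dl z) = dl (icat w z).
Proof.
move=> zp; elim: w v => [|e w IH] v /=; first by move=> _ _; exact: rho_one.
move=> /andP[_ ww] we; have [p1 p2] := icat_ipath zp ww we.
by rewrite (star_homM rho_hom) bop_mulE (IH _ ww we) rhoS path_isom_delta.
Qed.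

Lemma rho_wordS a x : ipath x -> (0 < size a)%N ->
  (rho (word a))^† (dl x) = if mkseq x (size a) == a then dl (ishift (size a) x) else 0.
Proof.
move=> xp a0; pose n := size a; rewrite -/n; pose z := ishift n x.
have zp : ipath z := ishift_ipath n xp.
have [w1 w2] := mkseq_walk n xp.
have zE : walk_end (src (x 0%N)) (mkseq x n) = src (z 0%N) by rewrite w2 /z /ishift addn0.
have -> : dl x = rho (word (mkseq x n)) (dl z) by rewrite (rho_word zp w1 zE) icat_mkseq.
rewrite -bop_mulE -(star_homS rho_hom) -(star_homM rho_hom).
case: eqP => [xa|xa]; last first.
  rewrite (word_star_neq0 E_sinks fam u1) ?(star_hom0 rho_hom) // ?size_mkseq //.
  by rewrite eq_sym; apply/eqP.
rewrite -xa (word_star_self E_sinks fam u1 _ w1) ?size_mkseq // rhoP path_proj_delta //.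
by rewrite zE eqxx.
Qed.

(** As $\lambda(S_{a'}) S_b$ is the word formed by the first $n + k$ letters of [x], the basis
    vector of [x] is the image under $\lambda(S_{a'})$ of that of [b] followed by the rest of [x].
    The adjoint for [a] undoes this if $a = a'$ and gives 0 otherwise. *)
Lemma psi_wordS n x a a' b : (0 < n)%N -> ipath x -> size a = n ->
  sweeps_from tau n (mkseq x (n + k)) a' b ->
  (psi (word a))^† (dl x) = if a == a' then dl (icat b (ishift (n + k) x)) else 0.
Proof.
move=> n0 xp an [v [abw an' bk xE]].
pose z := ishift (n + k) x; have zp : ipath z := ishift_ipath (n + k) xp.
have [w1 w2] := mkseq_walk (n + k) xp.
have zE : walk_end (src (x 0%N)) (mkseq x (n + k)) = src (z 0%N).
  by rewrite w2 /z /ishift addn0.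
have nk0 : (0 < size (mkseq x (n + k)))%N by rewrite size_mkseq addn_gt0 n0.
have [|sw1 sw2] := sweep_walk (n := n) tau_fix abw; first by rewrite size_cat an' bk.
have bE : walk_end (walk_end v a') b = src (z 0%N).
  by rewrite -walk_end_cat -sw2 -zE -xE; apply: walk_end_size.
have bw : walk (walk_end v a') b by move: abw; rewrite walk_cat => /andP[].
have [ip1 ip2] := icat_ipath zp bw bE.
have xE' : dl x = psi (word a') (dl (icat b z)).
  rewrite -(rho_word zp bw bE) /psi /= -bop_mulE -(star_homM rho_hom).
  rewrite (endo_word E_sinks A_graph tau_fix lam_tau abw) ?bk // an' -xE.
  by rewrite (rho_word zp w1 zE) icat_mkseq.
rewrite xE' -bop_mulE -(star_homS psi_hom) -(star_homM psi_hom).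
case: eqP => [->|aa']; last first.
  rewrite (word_star_neq0 E_sinks fam u1) ?an' // ?(star_hom0 psi_hom) //.
  exact/eqP.
have aw : walk v a' by move: abw; rewrite walk_cat => /andP[].
rewrite (word_star_self E_sinks fam u1 _ aw) ?an' //.
rewrite /psi /= (endo_proj E_sinks E_sources A_graph tau_fix lam_tau) rhoP path_proj_delta //.
by rewrite ip2 eqxx.
Qed.

Lemma ip_psi_pair a c (x y : X) d :
  ip (psi (word a ** (word c)^†) (dl x)) (d *: dl y) =
  ip ((psi (word c))^† (dl x)) (d *: (psi (word a))^† (dl y)).
Proof.
have adj_scale (T : bop R X) c' f : adj T (c' *: f) = c' *: T^† f.
  exact: (bop_scale (bopS T) c' f).
rewrite (star_homM psi_hom) (star_homS psi_hom) bop_mulE (adjE (psi (word a))).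
by rewrite adj_scale.
Qed.

(** Different [m] and [n] would give the period $|m - n| \le M$ from position $M + k + 1$ on. The
    offset by one letter keeps all indices beyond [k], where the two paths of [psi_entry_merges]
    agree. *)
Lemma aperiodic_states x m n M : (m <= M)%N -> (n <= M)%N -> aperiodic M (M + k).+1 x ->
  (forall j, x (m + k + j.+1)%N = x (n + k + j.+1)%N) -> m = n.
Proof.
move=> mM nM xa.
have key p q : (p < q)%N -> (q <= M)%N ->
    (forall j, x (p + k + j.+1)%N = x (q + k + j.+1)%N) -> False.
  move=> pq qM pqE; have [|i Mi iE] := xa (q - p)%N.
    by rewrite subn_gt0 pq leq_subLR (leq_trans qM) // leq_addl.
  apply: iE; have := pqE (i - (p + k).+1)%N; rewrite -!addSnnS => pqE'.
  have pi : ((p + k).+1 <= i)%N.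
    by rewrite (leq_trans _ Mi) // ltnS leq_add2r ltnW // (leq_trans pq).
  move: pqE'; rewrite subnKC // => ->; congr x; move: pq pi; lia.
move=> E1; case: (ltngtP m n) => // lt; exfalso; first exact: (key m n lt nM).
by apply: (key n m lt mM) => j; rewrite E1.
Qed.

Lemma icat_shift_inj b b' z z' n : size b = n -> size b' = n -> icat b z = icat b' z' ->
  b = b' /\ z = z'.
Proof.
move=> bn bn' E1; split; first by rewrite -(mkseq_icat b z) -(mkseq_icat b' z') E1 bn bn'.
by rewrite -(ishift_icat b z) -(ishift_icat b' z') E1 bn bn'.
Qed.

(* Along aperiodic paths only the pairs of words of equal length contribute to the
   diagonal entries, so these depend only on finitely many letters of the output. *)
Lemma psi_diagonal g : lspan (word_pairs P S) g -> exists M, forall x x' e b b',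
  ipath x -> ipath x' -> aperiodic M (M + k).+1 x -> aperiodic M (M + k).+1 x' ->
  sweeps_from tau M (mkseq x (M + k)) e b -> sweeps_from tau M (mkseq x' (M + k)) e b' ->
  psi g (dl x) x = psi g (dl x') x'.
Proof.
elim=> [|c h h' [a [c' [a0 c0 ->]]] _ [N NP]].
  by exists 0%N => *; rewrite (star_hom0 psi_hom) !bop0 !l20.
pose n := size a; pose m := size c'; pose M := maxn (maxn n m) N.
have mkt x p : (p <= M)%N -> take (p + k) (mkseq x (M + k)) = mkseq x (p + k).
  move=> pM; rewrite -map_take take_iota; congr map; congr iota.
  by apply/minn_idPl; rewrite leq_add2r.
have nM : (n <= M)%N by rewrite /M !leq_max leqnn.
have mM : (m <= M)%N by rewrite /M !leq_max leqnn orbT.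
have NM : (N <= M)%N by rewrite /M !leq_max leqnn orbT.
exists M => x x' e b b' xp xp' xa xa' xe xe'.
rewrite !(star_homD psi_hom) !(star_homZ psi_hom) !bopD !bopZ !l2D !l2Z.
have low p y s : (p <= M)%N -> sweeps_from tau M (mkseq y (M + k)) e s ->
    exists t, sweeps_from tau p (mkseq y (p + k)) (take p e) t.
  move=> pM ye; have [t tP] := sweeps_from_take tau_fix pM ye.
  by exists t; rewrite -mkt.
congr (_ * _ + _); last first.
  have [t tP] := low N x b NM xe; have [t' tP'] := low N x' b' NM xe'.
  apply: NP tP tP' => //; [apply: aperiodic_mono xa | apply: aperiodic_mono xa'] => //;
    by rewrite ltnS leq_add2r.
apply: ip_delta_inj => d; rewrite !ip_psi_pair.
have [t1 t1P] := low n x b nM xe; have [t1' t1P'] := low n x' b' nM xe'.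
have [t2 t2P] := low m x b mM xe; have [t2' t2P'] := low m x' b' mM xe'.
rewrite (psi_wordS a0 xp erefl t1P) (psi_wordS c0 xp erefl t2P).
rewrite (psi_wordS a0 xp' erefl t1P') (psi_wordS c0 xp' erefl t2P').
case: (c' == _); last by rewrite !ip0l.
case: (a == _); last by rewrite !scaler0 ipC ip0l ipC ip0l.
rewrite !ip_scale_delta /=.
(* The surviving entry is 1 exactly when [n = m]: equal tails force equal lengths by aperiodicity,
   and for equal lengths both states come from the same decoding. *)
have val y s s' : aperiodic M (M + k).+1 y ->
    sweeps_from tau n (mkseq y (n + k)) (take n e) s ->
    sweeps_from tau m (mkseq y (m + k)) (take m e) s' ->
    (icat s (ishift (n + k) y) == icat s' (ishift (m + k) y)) = (n == m).
  move=> ya sP s'P; have [v [_ _ sk _]] := sP; have [v' [_ _ sk' _]] := s'P.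
  apply/eqP/eqP => [sE|nm].
    have [_ tE] := icat_shift_inj sk sk' sE.
    apply: (aperiodic_states nM mM ya) => j.
    exact: (congr1 (fun u : X => u j.+1) tE).
  by rewrite -nm in s'P *; have [_ ->] := sweeps_from_inj tau_fix sP s'P.
by rewrite -/n -/m (val x _ _ xa t1P t2P) (val x' _ _ xa' t1P' t2P').
Qed.

(* A nonzero matrix entry of [psi g] between two aperiodic paths that agree past position
   [k] forces the transducer to reach the same state on both within [M] steps. *)
Lemma psi_entry_merges g : lspan (word_pairs P S) g -> exists M, forall x y,
  ipath x -> ipath y -> aperiodic M (M + k).+1 x ->
  (forall i, (k < i)%N -> x i = y i) -> psi g (dl x) y != 0 ->
  exists n s a a', [/\ (0 < n <= M)%N, sweeps_from tau n (mkseq x (n + k)) a s &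
    sweeps_from tau n (mkseq y (n + k)) a' s].
Proof.
elim=> [|d h h' [a [c [a0 c0 ->]]] _ [N NP]].
  by exists 0%N => x y _ _ _ _; rewrite (star_hom0 psi_hom) bop0 l20 eqxx.
pose n := size a; pose m := size c; pose M := maxn (maxn n m) N.
have nM : (n <= M)%N by rewrite /M !leq_max leqnn.
have mM : (m <= M)%N by rewrite /M !leq_max leqnn orbT.
have NM : (N <= M)%N by rewrite /M !leq_max leqnn orbT.
exists M => x y xp yp xa xy.
rewrite (star_homD psi_hom) (star_homZ psi_hom) bopD bopZ l2D l2Z => nz.
have [h0|h0] := eqVneq (psi h' (dl x) y) 0; last first.
  have xa' : aperiodic N (N + k).+1 x.
    by apply: aperiodic_mono xa => //; rewrite ltnS leq_add2r.
  have [p [s [b [b' [/andP[p0 pN] h1 h2]]]]] := NP x y xp yp xa' xy h0.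
  by exists p, s, b, b'; rewrite p0 (leq_trans pN NM).
have {nz} : psi (word a ** (word c)^†) (dl x) y != 0.
  by apply: contraNneq nz => ->; rewrite h0 mulr0 addr0.
have [xw _] := mkseq_walk (m + k) xp; have [yw _] := mkseq_walk (n + k) yp.
have [c1 [s1 x1]] := sweeps_from_ex tau_fix xw (size_mkseq _ _).
have [a1 [s2 y1]] := sweeps_from_ex tau_fix yw (size_mkseq _ _).
have entry0 : (forall d', ip (psi (word a ** (word c)^†) (dl x)) (d' *: dl y) = 0) ->
    psi (word a ** (word c)^†) (dl x) y = 0.
  by move=> z0; rewrite -(l20 R y); apply: ip_delta_inj => d'; rewrite z0 ip0l.
have [[ca aa]|] := pselect (c = c1 /\ a = a1); last first.
  move=> nca; rewrite entry0 ?eqxx // => d'.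
  rewrite ip_psi_pair (psi_wordS c0 xp erefl x1) (psi_wordS a0 yp erefl y1).
  case: eqP => [cc|_]; last by rewrite ip0l.
  case: eqP => [aa|_]; last by rewrite scaler0 ipC ip0l.
  by case: nca.
have [sE|sE] := pselect (icat s1 (ishift (m + k) x) = icat s2 (ishift (n + k) y)); last first.
  rewrite entry0 ?eqxx // => d'.
  rewrite ip_psi_pair (psi_wordS c0 xp erefl x1) (psi_wordS a0 yp erefl y1) ca aa !eqxx.
  rewrite ip_scale_delta /=; case: eqP => [E1|_]; first by case: sE; rewrite /m /n aa ca; exact: esym E1.
  by rewrite cdot0l.
move=> _; have [v [_ _ sk _]] := x1; have [v' [_ _ sk' _]] := y1.
have [ss tE] := icat_shift_inj sk sk' sE.
have mn : m = n.
  apply: (aperiodic_states mM nM xa) => j.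
  have := congr1 (fun u : X => u j.+1) tE; rewrite /ishift => ->.
  by rewrite xy // addnS ltnS (leq_trans (leq_addl n k)) // leq_addr.
exists n, s2, c1, a1; rewrite nM /n a0; split => //.
by rewrite -/n -mn -ss.
Qed.

Hypothesis lam_surj : forall t : A, exists t' : A, lam t' = t.

(** An error below $1/16$ in a preimage of [t] grows to at most $1/4$ by the Lipschitz constant 4;
    [cdot] squares it. No number is within $1/4$ of both 0 and 1. *)
Lemma entry_approx (t : A) : exists2 g, lspan (word_pairs P S) g & forall x y,
  cdot (rho t (dl x) y - psi g (dl x) y) (rho t (dl x) y - psi g (dl x) y) <= 16^-1.
Proof.
have [t' tt'] := lam_surj t; have r0 : 0 < 16^-1 :> R by [].
have [g gW tg] := word_pairs_dense E_sinks A_graph t' r0.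
exists g => // x y.
have -> : rho t (dl x) y - psi g (dl x) y = psi (t' - g) (dl x) y.
  by rewrite (star_homB psi_hom) bopD bopN l2D l2N -tt'.
rewrite (le_trans (entry_le _ _ _)) //.
have := star_hom_lip psi_hom u1 (t' - g); have := cnrm_ge0 (psi (t' - g)).
move: tg; nra.
Qed.

Lemma mkseq_take x n m : (n <= m)%N -> take n (mkseq x m) = mkseq x n.
Proof. by move=> nm; rewrite -map_take take_iota (minn_idPl nm). Qed.

Lemma rho_range_entry w x : ipath x -> size w = k -> (0 < k)%N ->
  rho (word w ** (word w)^†) (dl x) x = (mkseq x k == w)%:R.
Proof.
move=> xp wk k0; apply: cdot_inj => d; rewrite -ip_scale_delta.
have adj_scale (T : bop R X) c' f : adj T (c' *: f) = c' *: T^† f.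
  exact: (bop_scale (bopS T) c' f).
rewrite (star_homM rho_hom) (star_homS rho_hom) bop_mulE (adjE (rho (word w))) adj_scale.
rewrite (rho_wordS xp) wk //; case: eqP => _; last by rewrite ip0l cdot0l.
by rewrite ip_scale_delta /= eqxx.
Qed.

Lemma zero_one_far (z : R[i]) : cdot (1 - z) (1 - z) <= 16^-1 ->
  cdot (0 - z) (0 - z) <= 16^-1 -> False.
Proof. by case: z => [a b]; rewrite /cdot /=; nra. Qed.

Lemma diagonal_sync w : size w = k -> (0 < k)%N -> exists M, forall x x' e b b',
  ipath x -> ipath x' -> aperiodic M (M + k).+1 x -> aperiodic M (M + k).+1 x' ->
  sweeps_from tau M (mkseq x (M + k)) e b -> sweeps_from tau M (mkseq x' (M + k)) e b' ->
  mkseq x k = w -> mkseq x' k = w.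
Proof.
move=> wk k0; have [g gW gE] := entry_approx (word w ** (word w)^†).
have [M MP] := psi_diagonal gW; exists M => x x' e b b' xp xp' xa xa' xe xe' xw.
have := MP _ _ _ _ _ xp xp' xa xa' xe xe'.
have := gE x' x'; have := gE x x.
rewrite !rho_range_entry // xw eqxx; case: eqP => // _.
by move=> le1 le2 zz'; rewrite -zz' in le2; case: (zero_one_far le1 le2).
Qed.

Lemma aperiodic_sweep M v a b : walk v (a ++ b) -> size a = M -> size b = k ->
  exists x, [/\ ipath x, aperiodic M (M + k).+1 x & mkseq x (M + k) = sweep tau M (a ++ b)].
Proof.
move=> abw aM bk; have sab : size (a ++ b) = (M + k)%N by rewrite size_cat aM bk.
have [|sw _] := sweep_walk (n := M) tau_fix abw; first by rewrite sab.
have [z [zp zv za]] := aperiodic_path_ex E_sinks E_exits M (M + k).+1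
  (walk_end v (sweep tau M (a ++ b))).
have [xp _] := icat_ipath zp sw (esym zv).
exists (icat (sweep tau M (a ++ b)) z); split => //; first exact: aperiodic_icat.
by rewrite -sab -(sweep_size tau M) mkseq_icat.
Qed.

Lemma surjective_left_sync : exists M, left_sync tau M.
Proof.
case: (posnP k) => [k0|k0].
  have take0k (s : seq (edge E)) : take k s = [::] by rewrite k0 take0.
  by exists 0%N => v v' a b b' *; rewrite !take0k.
have sync (t : k.-tuple (edge E)) := diagonal_sync (size_tuple t) k0.
(* The bound depends on the source word, of which there are finitely many. *)
pose Mt t := projT1 (cid (sync t)); pose M := (\max_t Mt t)%N.
exists M => v v' a b b' abw abw' aM bk bk'.
have [x [xp xa xE]] := aperiodic_sweep abw aM bk.
have [x' [xp' xa' xE']] := aperiodic_sweep abw' aM bk'.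
rewrite -xE -xE' !mkseq_take ?leq_addl //.
have xt : size (mkseq x k) == k by rewrite size_mkseq.
pose t : k.-tuple (edge E) := Tuple xt.
have tM : (Mt t <= M)%N by apply: leq_bigmax.
have tMk : (Mt t + k <= M + k)%N by rewrite leq_add2r.
have xs : sweeps_from tau M (mkseq x (M + k)) a b by exists v; rewrite xE.
have xs' : sweeps_from tau M (mkseq x' (M + k)) a b' by exists v'; rewrite xE'.
have [s sP] := sweeps_from_take tau_fix tM xs; rewrite mkseq_take // in sP.
have [s' sP'] := sweeps_from_take tau_fix tM xs'; rewrite mkseq_take // in sP'.
symmetry; apply: (projT2 (cid (sync t)) x x' _ _ _ xp xp' _ _ sP sP') => //.
  by apply: aperiodic_mono xa; rewrite ?ltnS.
by apply: aperiodic_mono xa'; rewrite ?ltnS.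
Qed.

Lemma rho_unitaryS v w z : ipath z -> walk v w -> walk_end v w = src (z 0%N) ->
  size w = k.+1 -> rho (U tau)^† (dl (icat (prefix_act tau w) z)) = dl (icat w z).
Proof.
move=> zp ww we wk; have kw : (k < size w)%N by rewrite wk.
have [tw te] := prefix_act_walk tau_fix ww kw.
rewrite -(rho_word zp tw); last by rewrite te.
rewrite -bop_mulE -(star_homM rho_hom) (perm_unitaryS _ u1).
rewrite (perm_unitary_word E_sinks fam u1 (endpoint_fixingV tau_fix) tw); last first.
  by rewrite prefix_act_size wk.
by rewrite (prefix_actK tau ww kw) (rho_word zp ww we).
Qed.

(* The states reached from [w] and from [prefix_act tau w] agree within [M] steps; as
   [prefix_act tau (e :: sweep tau M z) = sweep tau M.+1 (e :: z)], dropping the first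
   letter of [w] does not change the state reached at the end either. *)
Lemma surjective_state_shift : (0 < k)%N -> exists M, forall v w, walk v w ->
  size w = (M.+1 + k)%N -> exists a a' b,
  sweeps_from tau M.+1 w a b /\ sweeps_from tau M (behead w) a' b.
Proof.
move=> k0; have [g gW gE] := entry_approx (U tau)^†.
have [M MP] := psi_entry_merges gW; exists M => v w ww wk.
have kw : (k < size w)%N by rewrite wk addSn ltnS leq_addl.
have [tw te] := prefix_act_walk tau_fix ww kw.
have [z [zp zv za]] := aperiodic_path_ex E_sinks E_exits M (M + k).+1 (walk_end v w).
have tze : walk_end v (prefix_act tau w) = src (z 0%N) by rewrite te zv.
pose x := icat (prefix_act tau w) z; pose y := icat w z.
have [xp _] : ipath x /\ _ := icat_ipath zp tw tze.
have [yp _] : ipath y /\ _ := icat_ipath zp ww (esym zv).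
(* The matrix entry of $U_\tau^*$ from [x] to [y] is therefore 1, and its approximation cannot
   vanish. *)
have rxy : rho (U tau)^† (dl x) = dl y.
  pose q := take k.+1 w; pose r := icat (drop k.+1 w) z.
  have qw : walk v q by move: ww; rewrite -{1}(cat_take_drop k.+1 w) walk_cat => /andP[].
  have rw : walk (walk_end v q) (drop k.+1 w).
    by move: ww; rewrite -{1}(cat_take_drop k.+1 w) walk_cat => /andP[].
  have re : walk_end (walk_end v q) (drop k.+1 w) = src (z 0%N).
    by rewrite -walk_end_cat cat_take_drop.
  have [rp rv] := icat_ipath zp rw re.
  have qs : size q = k.+1 by rewrite size_takel.
  have yE : y = icat q r by rewrite /r -icat_cat cat_take_drop.
  have xE : x = icat (prefix_act tau q) r.
    by rewrite /r -icat_cat -prefix_act_cat ?qs // cat_take_drop.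
  by rewrite yE xE; apply: (rho_unitaryS rp qw _ qs); rewrite rv.
have xy i : (k < i)%N -> x i = y i.
  move=> ki; have -> : x = icat (take k.+1 (prefix_act tau w)) (icat (drop k.+1 w) z).
    by rewrite -icat_cat -(prefix_act_drop tau) cat_take_drop.
  have -> : y = icat (take k.+1 w) (icat (drop k.+1 w) z).
    by rewrite -icat_cat cat_take_drop.
  have s1 : size (take k.+1 w) = k.+1 by rewrite size_takel.
  have s2 : size (take k.+1 (prefix_act tau w)) = k.+1 by rewrite size_takel // prefix_act_size.
  have at_size (p : seq (edge E)) u j : size p = k.+1 -> icat p u (k.+1 + j)%N = u j.
    by move=> <-; exact: icat_size.
  by rewrite -(subnKC ki) (at_size _ _ _ s1) (at_size _ _ _ s2).
have xM : mkseq x (M.+1 + k) = prefix_act tau w.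
  by rewrite -wk -(prefix_act_size tau) mkseq_icat.
have yM : mkseq y (M.+1 + k) = w by rewrite -wk mkseq_icat.
have [|n [s [a [a' [/andP[n0 nM] xs ys]]]]] := MP x y xp yp (aperiodic_icat _ za) xy.
  have := gE x y; rewrite rxy [dl y y]/= eqxx; set u := psi g _ _ => le1.
  apply/eqP => u0; move: le1; rewrite u0 subr0 /cdot /=; lra.
(* The runs merge after some $n \le M$ steps; beyond the letters read so far [x] and [y] coincide,
   so the same [m] further steps bring both to $M + 1$. *)
pose m := (M.+1 - n)%N; have nm : (n + m = M.+1)%N by rewrite subnKC // (leq_trans nM).
pose rest := mkseq (ishift (n + k) x) m.
have restE : rest = mkseq (ishift (n + k) y) m.
  apply: eq_map => i; rewrite /ishift xy // (leq_trans _ (leq_addr i _)) //.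
  by rewrite -(addn1 k) addnC leq_add2r.
have split_at u : mkseq u (M.+1 + k) = mkseq u (n + k) ++ mkseq (ishift (n + k) u) m.
  rewrite -nm addnAC /mkseq iotaD map_cat; congr (_ ++ _).
  by rewrite add0n -[in LHS](addn0 (n + k)%N) iotaDl -map_comp.
have [u [usw us sk uE]] := xs.
have [|cw ce] := sweep_walk (n := n) tau_fix usw; first by rewrite size_cat us sk.
have [xw xe] := mkseq_walk (n + k) xp; have [rw _] := mkseq_walk m (ishift_ipath (n + k) xp).
have srest : walk (walk_end u a) (s ++ rest).
  rewrite walk_cat; have /andP[_ -> /=] : walk u a && walk (walk_end u a) s by rewrite -walk_cat.
  rewrite -walk_end_cat -ce -uE (@walk_end_size _ _ (src (x 0%N))) ?xe.
    by rewrite /rest; move: rw; rewrite {1}/ishift addn0.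
  by rewrite size_mkseq (leq_trans n0) // leq_addr.
have [|c [c' cP]] := sweeps_from_ex (n := m) tau_fix srest.
  by rewrite size_cat sk size_mkseq addnC.
have xc := sweeps_from_cat tau_fix k0 xs cP (size_mkseq _ _).
have yc := sweeps_from_cat tau_fix k0 ys cP (size_mkseq _ _).
rewrite {1}restE in yc.
rewrite -split_at nm xM in xc; rewrite -split_at nm yM in yc.
(* The run on [prefix_act tau w] ends with an application of $\tau$ in front; cancelling it
   expresses [w] as a letter followed by the sweep of the remaining output, which thus decodes
   [behead w] with the same state. *)
exists (a' ++ c), (behead (a ++ c)), c'; split => //.
have [u' [acw acs ck acE]] := xc.
case: (a ++ c) acw acs acE => // e p /= /andP[eu pw] [ps] wE.
have [|pw' _] := sweep_walk (n := M) tau_fix pw; first by rewrite size_cat ps ck.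
have wE' : w = e :: sweep tau M (p ++ c').
  by apply: (prefix_act_inj ww _ kw wE (v' := u')); rewrite /= eu pw'.
by exists (rng e); rewrite wE'; split.
Qed.

(** Dropping the first letter [k] times removes the source state and leaves just the second label.
    As the state reached never changes, it is a function of that label. *)
Lemma surjective_right_sync : exists M, right_sync tau M.
Proof.
case: (posnP k) => [k0|k0].
  exists 0%N => v v' a a' b b' _ _ _ _ bk bk' _.
  by rewrite (size0nil (etrans bk k0)) (size0nil (etrans bk' k0)).
have [M MP] := surjective_state_shift k0.
have shift j v w : walk v w -> size w = (M + j + k)%N -> exists a a' b,
    sweeps_from tau (M + j) w a b /\ sweeps_from tau M (drop j w) a' b.
  elim: j v w => [|j IH] v w ww wk.
    rewrite addn0 in wk *; have [a [b abP]] := sweeps_from_ex tau_fix ww wk.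
    by exists a, a, b; rewrite drop0.
  pose w1 := take (M.+1 + k) w; pose y := drop (M.+1 + k) w.
  have w1s : size w1 = (M.+1 + k)%N by rewrite size_takel // wk; lia.
  have ys : size y = j by rewrite size_drop wk; lia.
  have wE : w = w1 ++ y by rewrite cat_take_drop.
  have /andP[w1w yw] : walk v w1 && walk (walk_end v w1) y by rewrite -walk_cat -wE.
  have [a [a' [b [s1 s2]]]] := MP v w1 w1w w1s.
  have bw : behead w = behead w1 ++ y by rewrite wE; case: (w1) w1s.
  have [u [abw as_ bk w1E]] := s1.
  have [|sw se] := sweep_walk (n := M.+1) tau_fix abw; first by rewrite size_cat as_ bk.
  have by_walk : walk (walk_end u a) (b ++ y).
    rewrite walk_cat; have /andP[_ -> /=] : walk u a && walk (walk_end u a) b by rewrite -walk_cat.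
    rewrite -walk_end_cat -se -w1E (@walk_end_size _ u v) //.
    by rewrite w1s addSn.
  have [|c [c' cP]] := sweeps_from_ex (n := j) tau_fix by_walk.
    by rewrite size_cat bk ys addnC.
  have t1 := sweeps_from_cat tau_fix k0 s1 cP ys; rewrite -wE addSnnS in t1.
  have t2 := sweeps_from_cat tau_fix k0 s2 cP ys; rewrite -bw in t2.
  have [v' bww] : exists v', walk v' (behead w).
    case: (w) ww => [|e p] /=; first by exists v.
    by move=> /andP[_ pw]; exists (rng e).
  have [|d [d' [b' [r1 r2]]]] := IH v' _ bww; first by rewrite size_behead wk; lia.
  have [_ cb] := sweeps_from_inj tau_fix t2 r1.
  exists (a ++ c), d', c'; split => //.
  by move: r2; rewrite -drop1 drop_drop addn1 -cb.
exists (M + k)%N => v v' a a' b b' abw abw' aM aM' bk bk' E1.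
have [|sw _] := sweep_walk (n := M + k) tau_fix abw; first by rewrite size_cat aM bk.
have [|sw' _] := sweep_walk (n := M + k) tau_fix abw'; first by rewrite size_cat aM' bk'.
have [|p [p' [c [c1 c2]]]] := shift k v _ sw; first by rewrite sweep_size size_cat aM bk.
have [|q [q' [d [d1 d2]]]] := shift k v' _ sw'; first by rewrite sweep_size size_cat aM' bk'.
have e1 : sweeps_from tau (M + k) (sweep tau (M + k) (a ++ b)) a b by exists v.
have e2 : sweeps_from tau (M + k) (sweep tau (M + k) (a' ++ b')) a' b' by exists v'.
have [_ ->] := sweeps_from_inj tau_fix e1 c1; have [_ ->] := sweeps_from_inj tau_fix e2 d1.
by rewrite E1 in c2; have [] := sweeps_from_inj tau_fix c2 d2.
Qed.

End SurjectiveEndomorphism.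

(** * The equivalences and the permutative inverse *)

Lemma sync_of_surjective (R : realType) (E : digraph)
    (E_sinks : no_sinks E) (E_sources : no_sources E)
    (E_exits : every_cycle_has_exit E)
    (k : nat) (tau : {perm gpath E k.+1}) (tau_fix : endpoint_fixing tau)
    (A : cstarAlgType R) (P : vert E -> A) (S : edge E -> A)
    (A_graph : is_graph_cstar P S)
    (lam : A -> A) (lam_tau : is_permutative_endo P S tau lam) :
  (forall t, exists t', lam t' = t) -> sync_first tau /\ sync_second tau.
Proof.
move=> lam_surj.
have [rho [rho_hom rhoP rhoS]] := graph_cstar_univ A_graph (path_family R E).
have [m ls] := surjective_left_sync E_sinks E_sources E_exits A_graph tau_fix lam_tau
  rho_hom rhoP rhoS lam_surj.
have [n rs] := surjective_right_sync E_sinks E_sources E_exits A_graph tau_fix lam_tau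
  rho_hom rhoP rhoS lam_surj.
by split; [apply: (first_of_left_sync tau_fix ls) | apply: (second_of_right_sync tau_fix rs)].
Qed.

Lemma inverse_of_sync (R : realType) (E : digraph)
    (E_sinks : no_sinks E) (E_sources : no_sources E)
    (k : nat) (tau : {perm gpath E k.+1}) (tau_fix : endpoint_fixing tau)
    (A : cstarAlgType R) (P : vert E -> A) (S : edge E -> A)
    (A_graph : is_graph_cstar P S)
    (lam : A -> A) (lam_tau : is_permutative_endo P S tau lam) :
  sync_first tau -> sync_second tau ->
  exists (l : nat) (pi : {perm gpath E l.+1}) (lam' : A -> A),
    [/\ endpoint_fixing pi, is_permutative_endo P S pi lam',
        cancel lam lam' & cancel lam' lam].
Proof.
move=> /(left_sync_of_first tau_fix)[m ls] /(right_sync_of_second tau_fix)[n rs].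
have {}ls := left_sync_mono (leq_maxl m n) ls.
have {}rs := right_sync_mono (leq_maxr m n) rs.
have [lam' [lam'P lamK lam'K]] :=
  synchronized_inverse E_sinks E_sources A_graph tau_fix ls rs lam_tau.
(* A permutation indexed by [l] acts on paths of length [l + 1], here twice the common bound plus
   one. *)
by exists (maxn m n + maxn m n)%N, (conjugate_perm E_sinks tau_fix ls rs), lam'; split;
  [exact: conjugate_perm_fix | exact: lam'P | |].
Qed.

Theorem theorem3p13 (R : realType) (E : digraph)
    (E_sinks : no_sinks E) (E_sources : no_sources E)
    (E_exits : every_cycle_has_exit E)
    (k : nat) (tau : {perm gpath E k.+1}) (tau_fix : endpoint_fixing tau)
    (A : cstarAlgType R) (P : vert E -> A) (S : edge E -> A)
    (A_graph : is_graph_cstar P S)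
    (lam : A -> A) (lam_tau : is_permutative_endo P S tau lam) :
  ((sync_first tau /\ sync_second tau) <-> two_sided_11 (perm_textile tau_fix))
  /\ (two_sided_11 (perm_textile tau_fix) <-> is_star_automorphism lam)
  /\ (is_star_automorphism lam ->
      exists (l : nat) (pi : {perm gpath E l.+1}) (lam' : A -> A),
        [/\ endpoint_fixing pi, is_permutative_endo P S pi lam',
            cancel lam lam' & cancel lam' lam]).
Proof.
have sync_two : sync_first tau /\ sync_second tau <-> two_sided_11 (perm_textile tau_fix).
  split=> [[]|two]; first exact: two_sided_of_sync.
  by split; [exact: sync_first_of_two_sided two | exact: sync_second_of_two_sided two].
have auto_sync : is_star_automorphism lam -> sync_first tau /\ sync_second tau.
  move=> [_ [mu lamK muK]]; apply: (sync_of_surjective E_sinks E_sources E_exits tau_fix A_graph lam_tau).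
  by move=> t; exists (mu t).
have inverse := inverse_of_sync E_sinks E_sources tau_fix A_graph lam_tau.
split=> //; split; last by move=> /auto_sync[]; exact: inverse.
rewrite -sync_two; split=> [[sf ss]|//].
have [_ [_ [lam' [_ _ lamK lam'K]]]] := inverse sf ss.
by split; [have [] := lam_tau | exists lam'].
Qed.
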